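(* Suppose that $\omega$ satisfies the Mammen–Tsybakov condition with parameter $\alpha>0$. Then the plug-in classifier $\ell_n(x)=\mathbf{1}(h_n(x)>1/2)$ has excess risk bounded as $$\mathbb{E}[\mathcal{E}(\ell_n)]\le c\,n^{-\frac{1+\alpha}{2}},$$ where $c=c(\eta)$ is a constant depending only on $\eta$.
   Context: Fix $d\ge 1$, $n \ge 1$, $\eta>0$, and probability measures $\mu,\nu$ on $\mathbb{R}^d$ such that $\|x\|\le 1/2$ for $\mu$-almost every $x$ and $\|y\|\le 1/2$ for $\nu$-almost every $y$ (Euclidean norm). Let $\pi_\star$ be the Schrödinger coupling $$\pi_\star=\operatorname{argmin}_{\pi\in\Pi(\mu,\nu)}\Big\{\int\|x-y\|^2d\pi(x,y)+\frac1\eta\mathsf{KL}(\pi\|\mu\otimes\nu)\Big\},$$ where $\Pi(\mu,\nu)$ is the set of couplings of $\mu$ and $\nu$ and $\mathsf{KL}$ is the Kullback–Leibler divergence (the minimizer exists and is unique). Transfer learning model: labels take values in $\{0,1\}$, and $q(\cdot\mid y)$ is an unknown conditional distribution (Markov kernel) on $\{0,1\}$. The joint distribution $\omega$ of $(X,Y,A)$ is given by $(X,Y)\sim\pi_\star$ and, conditionally on $(X,Y)$, $A\sim q(\cdot\mid Y)$. The observations are unlabeled $X_1,\dots,X_n\sim\mu$ i.i.d. and, independently of them, i.i.d. labeled pairs $(Y_1,A_1),\dots,(Y_n,A_n)$ with $Y_j\sim\nu$ and $A_j\sim q(\cdot\mid Y_j)$. Let $h_\star(x)=\mathbb{E}_\omega[A\mid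 X=x]$. Let $\mu_n=\frac1n\sum_{i=1}^n\delta_{X_i}$, $\nu_n=\frac1n\sum_{j=1}^n\delta_{Y_j}$. Empirical dual potentials: $(f_n,g_n)$ is the unique maximizer over $L^\infty(\mu_n)\times L^\infty(\nu_n)$ of $$\Phi_n(f,g)=\int f\,d\mu_n+\int g\,d\nu_n-\frac1\eta\int e^{-\eta(\|x-y\|^2-f(x)-g(y))}\,d(\mu_n\otimes\nu_n)(x,y)+\frac1\eta$$ such that $\int g_n\,d\nu_n=0$. They are extended to all of $\mathbb{R}^d$ by $$e^{-\eta f_n(x)}=\frac1n\sum_{j=1}^n e^{-\eta\|x-Y_j\|^2+\eta g_n(Y_j)},\qquad e^{-\eta g_n(y)}=\frac1n\sum_{i=1}^n e^{-\eta\|X_i-y\|^2+\eta f_n(X_i)}.$$ Put $p_n(x,y)=e^{-\eta(\|x-y\|^2-f_n(x)-g_n(y))}$ and $h_n(x)=\frac1n\sum_{j=1}^nA_j\,p_n(x,Y_j)$ for $x,y\in\mathbb{R}^d$. The Bayes classifier is $\ell_\star(x)=\mathbf{1}(h_\star(x)>1/2)$. The excess risk of a classifier $\ell:\mathbb{R}^d\to\{0,1\}$ is $\mathcal{E}(\ell)=\mathbb{P}[\ell(X)\ne A]-\mathbb{P}[\ell_\star(X)\ne A]$, where $(X,Y,A)\sim\omega$; for the data-dependent $\ell_n$, $(X,Y,A)$ is independent of the observations and $\mathcal{E}(\ell_n)$ is computed conditionally on the observations, the outer expectation being over the observations. Mammen–Tsybakov condition with parameter $\alpha>0$: $\omega$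 satisfies it if there exists a constant $C_0>0$ such that $\mu(0<|h_\star-1/2|\le\varepsilon)\le C_0\varepsilon^\alpha$ for all $\varepsilon\in(0,1/2]$.
   Formalization: The constant c may depend on η, on α and on the constant C_0 of the Mammen–Tsybakov condition, not on η only; with c = c(η) the claim fails, e.g. for μ = ν = δ_0, q(1|0) = 1/2 + n^{-1/2}, α = 1, C_0 = n^{1/2}. *)

(* Defs.v *)
From HB Require Import structures.
From mathcomp Require Import all_boot all_order all_algebra.
From mathcomp Require Import all_classical all_reals all_analysis.
From mathcomp Require Import measurable_realfun.

Set Implicit Arguments.
Unset Strict Implicit.
Unset Printing Implicit Defensive.

Import Order.TTheory GRing.Theory Num.Theory.

Local Open Scope classical_set_scope.
Local Open Scope ring_scope.

(* R^d is [d.-tuple R] with the library's product sigma-algebra (generated by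
   the coordinates), that is, the Borel sigma-algebra. *)
Section euclidean.
Context {R : realType} {d : nat}.

Definition enorm (x : d.-tuple R) : R :=
  Num.sqrt (\sum_(i < d) tnth x i ^+ 2).

Definition esub (x y : d.-tuple R) : d.-tuple R :=
  [tuple tnth x i - tnth y i | i < d].

Definition qcost (x y : d.-tuple R) : R := enorm (esub x y) ^+ 2.

End euclidean.

Section entropic_transport.
Context {R : realType}.
Local Open Scope ereal_scope.

Definition product_probability d1 d2 (T1 : measurableType d1)
    (T2 : measurableType d2) (P1 : probability T1 R) (P2 : probability T2 R)
    : probability (T1 * T2)%type R := P1 \x P2.

Definition KL d (T : measurableType d) (P Q : probability T R) : \bar R :=
  if `[< P `<< Q >] then
    \int[P]_z lne (Radon_Nikodym (charge_of_finite_measure P) Q z)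
  else +oo.

(* Equality of measures is only required on measurable sets: a measure of the
   library is a function on all sets, unconstrained on nonmeasurable ones. *)
Definition coupling d1 d2 (T1 : measurableType d1) (T2 : measurableType d2)
    (mu : probability T1 R) (nu : probability T2 R)
    (pi : probability (T1 * T2)%type R) : Prop :=
  (forall B, measurable B -> pi (fst @^-1` B) = mu B) /\
  (forall B, measurable B -> pi (snd @^-1` B) = nu B).

Definition entropic_cost (eta : R) d (mu nu : probability (d.-tuple R) R)
    (pi : probability (d.-tuple R * d.-tuple R)%type R) : \bar R :=
  \int[pi]_z (qcost z.1 z.2)%:E
  + (eta^-1)%:E * KL pi (product_probability mu nu).

Definition schrodinger_coupling (eta : R) d (mu nu : probability (d.-tuple R) R)
    (pi : probability (d.-tuple R * d.-tuple R)%type R) : Prop :=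
  coupling mu nu pi /\
  forall pi', coupling mu nu pi' ->
    entropic_cost eta mu nu pi <= entropic_cost eta mu nu pi'.

End entropic_transport.

(* [semidirect rho k] is the law of (Z, A) when Z ~ rho and, given Z,
   A ~ k Z. *)
Section semidirect_product.
Context {R : realType} d d' {T : measurableType d} {U : measurableType d'}.
Variables (rho : probability T R) (k : R.-pker T ~> U).
Local Open Scope ereal_scope.

Definition semidirect (E : set (T * U)) : \bar R :=
  \int[rho]_x k x (xsection E x).

Let semidirect0 : semidirect set0 = 0.
Proof.
by rewrite /semidirect integral0_eq// => x _; rewrite xsection0 measure0.
Qed.

Let semidirect_ge0 E : 0 <= semidirect E.
Proof. by apply: integral_ge0 => x _; exact: measure_ge0. Qed.

Let semidirect_sigma_additive : semi_sigma_additive semidirect.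
Proof.
move=> F mF tF mUF.
rewrite [X in _ --> X](_ : _ = \sum_(n <oo) semidirect (F n)).
  by apply/cvg_closeP; split; [exact: is_cvg_nneseries|rewrite closeE].
rewrite -integral_nneseries//; last first.
  by move=> n; apply: measurable_fun_xsection_finite_kernel; rewrite inE.
apply: eq_integral => x _; apply/esym/cvg_lim => //=; rewrite xsection_bigcup.
apply: (measure_sigma_additive _ (trivIset_xsection tF)) => ?.
exact: measurable_xsection.
Qed.

HB.instance Definition _ := isMeasure.Build _ _ _ semidirect
  semidirect0 semidirect_ge0 semidirect_sigma_additive.

Let semidirect_setT : semidirect [set: T * U] = 1.
Proof.
rewrite /semidirect -[RHS](probability_setT rho) -[RHS]mul1e -integral_cst//.
apply: eq_integral => x _.
by rewrite -setXTT in_xsectionX ?inE// prob_kernel.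
Qed.

HB.instance Definition _ :=
  Measure_isProbability.Build _ _ _ semidirect semidirect_setT.

End semidirect_product.

Section kernel_of_second_component.
Context {R : realType} d d' d'' {S : measurableType d} {T : measurableType d'}
  {U : measurableType d''}.
Variable q : R.-pker T ~> U.

Definition ksnd : (S * T)%type -> {measure set U -> \bar R} := q \o snd.

Let measurable_ksnd A : measurable A ->
  measurable_fun [set: (S * T)%type] (ksnd ^~ A).
Proof.
move=> mA; have mq : measurable_fun [set: T] (q ^~ A) by exact: measurable_kernel.
exact: (measurableT_comp mq measurable_snd).
Qed.

HB.instance Definition _ := @isKernel.Build _ _ _ _ R ksnd measurable_ksnd.

Let ksnd_prob x : ksnd x [set: U] = 1%E.
Proof. exact: prob_kernel. Qed.

HB.instance Definition _ :=
  @Kernel_isProbability.Build _ _ _ _ R ksnd ksnd_prob.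

End kernel_of_second_component.

(* Labels in {0,1} are booleans; omega is the law of ((X, Y), A). *)
Section transfer_model.
Context {R : realType} {d : nat}.
Local Notation E := (d.-tuple R).
Implicit Types (pi : probability (E * E)%type R) (q : R.-pker E ~> bool).
Implicit Types (omega : probability (E * E * bool)%type R).
Local Open Scope ereal_scope.

Definition transfer_law pi q : probability (E * E * bool)%type R :=
  semidirect pi (ksnd q).

(* h is a version of x |-> E_omega[A | X = x] *)
Definition is_regression_function omega (h : E -> R) : Prop :=
  [/\ measurable_fun [set: E] h,
      omega.-integrable [set: E * E * bool] (fun z => (h z.1.1)%:E) &
      forall B, measurable B ->
        \int[omega]_(z in [set z | B z.1.1]) ((z.2 : nat)%:R)%:E =
        \int[omega]_(z in [set z | B z.1.1]) (h z.1.1)%:E].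

Definition plugin (h : E -> R) : E -> bool := fun x => (2^-1 < h x)%R.

Definition risk omega (l : E -> bool) : R :=
  fine (omega [set z | l z.1.1 != z.2]).

(* [h] is the regression function, so [plugin h] is the Bayes classifier *)
Definition excess_risk omega (h : E -> R) (l : E -> bool) : R :=
  (risk omega l - risk omega (plugin h))%R.

Definition mammen_tsybakov (mu : probability E R) (h : E -> R) (alpha C0 : R)
    : Prop :=
  forall eps : R, (0 < eps <= 2^-1)%R ->
    mu [set x | (0 < `|h x - 2^-1| <= eps)%R] <= (C0 * eps `^ alpha)%:E.

End transfer_model.

Section independence.
Context d {W : measurableType d} {R : realType} (P : probability W R).
Local Open Scope ereal_scope.

Definition mutually_independent (I : finType) (F : I -> set (set W)) : Prop :=
  forall (J : {set I}) (B : I -> set W), (forall i, i \in J -> F i (B i)) ->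
    P (\bigcap_(i in [set` J]) B i) = \prod_(i in J) P (B i).

Definition sigma_generated d' {V : measurableType d'} (Z : W -> V)
    : set (set W) := preimage_set_system [set: W] Z measurable.

(* X_1, ..., X_n ~ mu and (Y_1, A_1), ..., (Y_n, A_n) ~ nu(dy) q(da | y), all
   2n random elements being mutually independent; L j is (Y_j, A_j). *)
Definition transfer_sample (n m : nat) (mu nu : probability (m.-tuple R) R)
    (q : R.-pker (m.-tuple R) ~> bool)
    (X : 'I_n -> {RV P >-> m.-tuple R})
    (L : 'I_n -> {RV P >-> (m.-tuple R * bool)%type}) : Prop :=
  [/\ forall i B, measurable B -> distribution P (X i) B = mu B,
      forall j C, measurable C -> distribution P (L j) C = semidirect nu q C &
      mutually_independent (fun k : 'I_n + 'I_n =>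
        match k with
        | inl i => sigma_generated (X i)
        | inr j => sigma_generated (L j)
        end)].

End independence.

(* Integrals against the empirical measures mu_n and nu_n are written as the
   averages (1/n) \sum_i over the sample points x_i and y_j. *)
Section empirical.
Context {R : realType} {d n : nat}.
Local Notation E := (d.-tuple R).
Variables (eta : R) (x y : 'I_n -> E).

Definition dual_objective (f g : E -> R) : R :=
  n%:R^-1 * (\sum_(i < n) f (x i))
  + n%:R^-1 * (\sum_(j < n) g (y j))
  - eta^-1 * ((n%:R ^+ 2)^-1 * \sum_(i < n) \sum_(j < n)
      expR (- eta * (qcost (x i) (y j) - f (x i) - g (y j))))
  + eta^-1.

(* The objective only sees f on the x_i and g on the y_j, so elements of
   L^oo(mu_n) and L^oo(nu_n) are represented by arbitrary functions on R^d;
   the last two conditions fix their values on all of R^d. *)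
Definition empirical_potentials (f g : E -> R) : Prop :=
  [/\ forall f' g', dual_objective f' g' <= dual_objective f g,
      n%:R^-1 * (\sum_(j < n) g (y j)) = 0,
      forall u, expR (- eta * f u) =
        n%:R^-1 * \sum_(j < n) expR (- eta * qcost u (y j) + eta * g (y j)) &
      forall v, expR (- eta * g v) =
        n%:R^-1 * \sum_(i < n) expR (- eta * qcost (x i) v + eta * f (x i))].

Definition empirical_density (f g : E -> R) (u v : E) : R :=
  expR (- eta * (qcost u v - f u - g v)).

Definition empirical_regression (a : 'I_n -> bool) (f g : E -> R) (u : E) : R :=
  n%:R^-1 * \sum_(j < n) (a j : nat)%:R * empirical_density f g u (y j).

End empirical.

(* Main.v *)
Require Import Defs.
From HB Require Import structures.
From mathcomp Require Import all_boot all_order all_algebra.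
From mathcomp Require Import all_classical all_reals all_analysis.
From mathcomp Require Import measurable_realfun.
From mathcomp Require Import ring lra.

(** Why the rate n^(-(1+alpha)/2) holds.

    The excess risk of a plug-in classifier is the integral of |2 h - 1| over the
    region where the estimate and h are on opposite sides of 1/2, and there the
    estimate deviates from h by at least |h - 1/2|.  Hence the rate follows from
    the margin condition as soon as the pointwise deviation of h_n from h at mu-
    almost every x is of order n^(-1/2), with moments of order 2m, 2m >= 2 + alpha,
    of order n^(-m) (margin_majorant_int, by peeling).

    The deviation is compared with fluctuations of empirical averages.  The
    population potentials solve the Schrodinger system for the kernel
    e^(-eta c): the Sinkhorn iteration contracts the range of the ratio of two
    successive iterates, because the cost is bounded by 1 on the supports
    (sinkhorn_fixpoint).  Truncating the cost at 1 makes all of this valid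
    everywhere and not only almost everywhere.  The coupling with the resulting
    density p satisfies an inequality of Gibbs type, whose equality case
    identifies it with the minimizer of the entropic cost (KL_le_density,
    schrodinger_coupling_density).  So h(x) is the integral of q(1 | y) p(x, y)
    with respect to nu (regression_function_unique).

    On the sample, p and the empirical density p_n are both bounded between
    e^(-2 eta) and e^(2 eta), and they differ by the exponential of a sum of a
    function of x and a function of y.  Strong concavity of the dual objective
    (potential_stability) bounds the difference of the potentials by the marginal
    defects of p on the sample, and the extension formulas carry the bound to
    every x of the support (density_stability, empirical_regression_deviation).
    What remains are averages of bounded variables that are centered given the
    other sample, so that their moments of order 2m are of order n^(-m)
    (mean_moment_le); all constants depend on eta, alpha and C0 only. *)

Set Implicit Arguments.
Unset Strict Implicit.
Unset Printing Implicit Defensive.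
Import Order.TTheory GRing.Theory Num.Theory.
Local Open Scope classical_set_scope.
Local Open Scope ring_scope.

(** * Stability of the empirical potentials *)

Section exponential_slope.
Context {R : realType}.
Implicit Types x y : R.

(** The increment of the exponential, with a mean value slope. *)
Lemma expR_diff_slope x y : exists2 c : R,
  Num.min (expR x) (expR y) <= c <= Num.max (expR x) (expR y) &
  expR x - expR y = c * (x - y).
Proof.
have slope (a b : R) : b < a -> exists2 c : R,
    expR b <= c <= expR a & expR a - expR b = c * (a - b).
  move=> ba; have ab0 : 0 < a - b by rewrite subr_gt0.
  exists ((expR a - expR b) / (a - b)); last by rewrite divfK// gt_eqF.
  rewrite ler_pdivlMr// ler_pdivrMr//.
  have := expR_ge1Dx (a - b); have := expR_ge1Dx (b - a).
  have ea := expR_gt0 a; have eb := expR_gt0 b.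
  rewrite !expRB => h1 h2; apply/andP; split.
    have := ler_wpM2l (ltW eb) h2.
    by rewrite [expR b * (_ / _)]mulrC divfK ?gt_eqF//; lra.
  have := ler_wpM2l (ltW ea) h1.
  by rewrite [expR a * (_ / _)]mulrC divfK ?gt_eqF//; lra.
have [xy|yx|->] := ltgtP x y.
- have [c cP cE] := slope _ _ xy; exists c.
    by rewrite min_l ?max_r// ler_expR ltW.
  by move: cE; lra.
- have [c cP cE] := slope _ _ yx; exists c => //.
  by rewrite min_r ?max_l// ler_expR ltW.
- by exists (expR y); rewrite ?minxx ?maxxx ?lexx// !subrr mulr0.
Qed.

(** The same for two densities p and q = p e^s lying in [k, M]: the slope lies
    in [k, M] as well. *)
Lemma density_slope (k M p q s : R) : k <= p <= M -> k <= q <= M -> 0 < p ->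
  q = p * expR s -> exists2 c : R, k <= c <= M & q - p = c * s.
Proof.
move=> /andP[kp pM] /andP[kq qM] p0 qE.
have [c /andP[c1 c2] cE] := expR_diff_slope s 0; exists (p * c).
  rewrite expR0 in c1 c2.
  have [s1|s1] := leP 1 (expR s).
    move: c1 c2; rewrite min_r// max_l// => c1 c2; apply/andP; split.
      by apply: (le_trans kp); rewrite ler_peMr// ltW.
    by apply: (le_trans _ qM); rewrite qE ler_pM2l.
  move: c1 c2; rewrite min_l ?(ltW s1)// max_r ?(ltW s1)// => c1 c2.
  apply/andP; split.
    by apply: (le_trans kq); rewrite qE ler_pM2l.
  by apply: (le_trans _ pM); rewrite ler_piMr// ltW.
by rewrite qE; move: cE; rewrite expR0 subr0 -mulrA => <-; ring.
Qed.
End exponential_slope.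

Section dual_stability.
Context {R : realType} {n : nat}.
Variables (k M : R) (k0 : 0 < k).

(** Strong concavity of the empirical dual objective, written with its optimality
    conditions: p is the empirical density on the sample, q the population one,
    and a, b are the differences of the potentials.  The right-hand side is the
    squared norm of the gradient of the objective at the population potentials;
    it controls b once the additive constant is fixed by the condition that b
    has mean zero. *)
Lemma potential_stability (p q : 'I_n -> 'I_n -> R) (a b : 'I_n -> R) :
  (forall i j, k <= p i j <= M) -> (forall i j, k <= q i j <= M) ->
  (forall i j, q i j = p i j * expR (a i + b j)) ->
  (forall i, n%:R^-1 * \sum_j p i j = 1) ->
  (forall j, n%:R^-1 * \sum_i p i j = 1) -> \sum_j b j = 0 ->
  k ^+ 2 * \sum_j b j ^+ 2 <=
    \sum_i (n%:R^-1 * \sum_j q i j - 1) ^+ 2 +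
    \sum_j (n%:R^-1 * \sum_i q i j - 1) ^+ 2.
Proof.
move=> pk qk qE pr pc b0.
case: n => [|m] in p q a b pk qk qE pr pc b0 *.
  by rewrite !big_ord0 mulr0 addr0.
set N : R := m.+1%:R in pr pc *.
have N0 : 0 < N by rewrite ltr0n.
set r := fun i => N^-1 * \sum_j q i j - 1.
set t := fun j => N^-1 * \sum_i q i j - 1.
have rE i : \sum_j (q i j - p i j) = N * r i.
  by rewrite sumrB /r -(pr i) mulrBr !mulrA mulfV ?gt_eqF// !mul1r.
have tE j : \sum_i (q i j - p i j) = N * t j.
  by rewrite sumrB /t -(pc j) mulrBr !mulrA mulfV ?gt_eqF// !mul1r.
have E1 : \sum_i \sum_j (q i j - p i j) * (a i + b j) =
    N * (\sum_i a i * r i + \sum_j b j * t j).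
  transitivity (\sum_i (a i * \sum_j (q i j - p i j)) +
      \sum_j (b j * \sum_i (q i j - p i j))).
    under [X in _ + X]eq_bigr do rewrite mulr_sumr.
    rewrite [X in _ + X]exchange_big -big_split /=; apply: eq_bigr => i _.
    by rewrite mulr_sumr -big_split /=; apply: eq_bigr => j _; ring.
  rewrite mulrDr !mulr_sumr; congr (_ + _); apply: eq_bigr => i _.
    by rewrite rE; ring.
  by rewrite tE; ring.
have E2 : \sum_i \sum_j (a i + b j) ^+ 2 =
    N * (\sum_i a i ^+ 2 + \sum_j b j ^+ 2).
  transitivity (\sum_i (N * a i ^+ 2 + \sum_j b j ^+ 2)).
    apply: eq_bigr => i _.
    transitivity (\sum_(j < m.+1) (a i ^+ 2 + 2 * a i * b j + b j ^+ 2)).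
      by apply: eq_bigr => j _; ring.
    have b0' : \sum_j 2 * a i * b j = 0 by rewrite -mulr_sumr b0 mulr0.
    by rewrite !big_split /= b0' addr0 sumr_const card_ord -mulr_natl.
  by rewrite big_split /= sumr_const card_ord -mulr_sumr -mulr_natl mulrDr.
have L : k * \sum_i \sum_j (a i + b j) ^+ 2 <=
    \sum_i \sum_j (q i j - p i j) * (a i + b j).
  rewrite mulr_sumr; apply: ler_sum => i _.
  rewrite mulr_sumr; apply: ler_sum => j _.
  have p0 : 0 < p i j by case/andP: (pk i j) => + _; exact: lt_le_trans.
  have [c /andP[kc _] ->] := density_slope (pk i j) (qk i j) p0 (qE i j).
  by rewrite -mulrA -expr2 ler_wpM2r// sqr_ge0.
move: L; rewrite E1 E2 mulrCA ler_pM2l// => L.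
(* Young's inequality, weighted so that half of the left-hand side absorbs
   the potentials *)
have yg (x y : R) : 2 * k * (x * y) <= k ^+ 2 * x ^+ 2 + y ^+ 2.
  by have := sqr_ge0 (k * x - y); nra.
have S (x y : 'I_m.+1 -> R) : 2 * k * \sum_i (x i * y i) <=
    k ^+ 2 * \sum_i x i ^+ 2 + \sum_i y i ^+ 2.
  by rewrite !mulr_sumr -big_split /=; apply: ler_sum => i _; exact: yg.
have := S a r; have := S b t.
have : 2 * k * (k * (\sum_i a i ^+ 2 + \sum_j b j ^+ 2)) <=
    2 * k * (\sum_i a i * r i + \sum_j b j * t j).
  by rewrite ler_wpM2l// mulr_ge0// ltW.
have : 0 <= k ^+ 2 * \sum_i a i ^+ 2.
  by rewrite mulr_ge0 ?sqr_ge0 ?sumr_ge0// => i _; exact: sqr_ge0.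
by rewrite /r /t; lra.
Qed.

Lemma sqr_mean_le (x : 'I_n -> R) : (0 < n)%N ->
  (n%:R^-1 * \sum_i x i) ^+ 2 <= n%:R^-1 * \sum_i x i ^+ 2.
Proof.
move=> n0; have N0 : 0 < n%:R :> R by rewrite ltr0n.
set m := _ * \sum_i x i; rewrite -subr_ge0.
have -> : n%:R^-1 * \sum_i x i ^+ 2 - m ^+ 2 =
    n%:R^-1 * \sum_i (x i - m) ^+ 2.
  have -> : \sum_i (x i - m) ^+ 2 =
      \sum_i x i ^+ 2 - 2 * m * \sum_i x i + n%:R * m ^+ 2.
    transitivity (\sum_i (x i ^+ 2 - 2 * m * x i + m ^+ 2)).
      by apply: eq_bigr => i _; ring.
    rewrite [in RHS]mulr_sumr big_split sumrB /= sumr_const card_ord.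
    by rewrite -(mulr_natl (m ^+ 2)).
  have sE : \sum_i x i = n%:R * m by rewrite /m mulrA mulfV ?mul1r ?gt_eqF.
  by rewrite sE; field; rewrite gt_eqF.
by rewrite mulr_ge0 ?invr_ge0 ?(ltW N0)// sumr_ge0// => i _; exact: sqr_ge0.
Qed.

(** Stability at a point off the sample: p and q are the two densities there,
    seen as functions of the sample index, and th is the difference of the
    first potentials, which is controlled through the defect of q from total
    mass 1. *)
Lemma density_stability (p q b : 'I_n -> R) (th : R) : (0 < n)%N ->
  k <= 1 -> M = k^-1 ->
  (forall j, k <= p j <= M) -> (forall j, k <= q j <= M) ->
  (forall j, q j = p j * expR (th + b j)) -> n%:R^-1 * \sum_j p j = 1 ->
  (n%:R^-1 * \sum_j `|q j - p j|) ^+ 2 <=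
    8 * k^-1 ^+ 8 * ((n%:R^-1 * \sum_j q j - 1) ^+ 2 +
      n%:R^-1 * \sum_j b j ^+ 2).
Proof.
move=> n0 k1 ME pk qk qE p1; have N0 : 0 < n%:R :> R by rewrite ltr0n.
have M0 : 0 < M by rewrite ME invr_gt0.
have M1 : 1 <= M by rewrite ME invf_ge1.
set N := n%:R in N0 p1 *; set r := _ - 1; set D := _ * \sum_j `|_|.
set B := N^-1 * \sum_j `|b j|.
have c j : {c | k <= c <= M & q j - p j = c * (th + b j)}.
  have p0 : 0 < p j by case/andP: (pk j) => + _; exact: lt_le_trans.
  apply: cid2; exact: density_slope (pk j) (qk j) p0 (qE j).
pose C j := s2val (c j).
have Ck j : k <= C j <= M by exact: (s2valP (c j)).
have CE j : q j - p j = C j * (th + b j) by exact: (s2valP' (c j)).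
have C0 j : 0 <= C j by case/andP: (Ck j) => + _; exact: (le_trans (ltW k0)).
have B0 : 0 <= B by rewrite mulr_ge0 ?invr_ge0 ?(ltW N0)// sumr_ge0.
have D0 : 0 <= D by rewrite mulr_ge0 ?invr_ge0 ?(ltW N0)// sumr_ge0.
have avg (x : R) : N^-1 * \sum_(j < n) x = x.
  by rewrite sumr_const card_ord -mulr_natl mulrA mulVf ?mul1r ?gt_eqF.
have DB : D <= M * (`|th| + B).
  rewrite -[in X in _ <= _ * (X + _)](avg `|th|) -mulrDr -big_split /=.
  rewrite mulrCA ler_pM2l ?invr_gt0// mulr_sumr; apply: ler_sum => j _.
  rewrite CE normrM (ger0_norm (C0 j)); apply: ler_pM => //.
    by case/andP: (Ck j).
  exact: ler_normD.
have rE : r = th * (N^-1 * \sum_j C j) + N^-1 * \sum_j C j * b j.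
  rewrite /r -p1 -mulrBr -sumrB mulrCA -mulrDr; congr (_ * _).
  by rewrite mulr_sumr -big_split/=; apply: eq_bigr => j _; rewrite CE; ring.
have th_le : k * `|th| <= `|r| + M * B.
  have h1 : k <= N^-1 * \sum_j C j.
    rewrite -[leLHS]avg ler_pM2l ?invr_gt0//; apply: ler_sum => j _.
    by case/andP: (Ck j).
  have h2 : `|N^-1 * \sum_j C j * b j| <= M * B.
    rewrite normrM ger0_norm ?invr_ge0 ?(ltW N0)// mulrCA ler_pM2l ?invr_gt0//.
    apply: (le_trans (ler_norm_sum _ _ _)); rewrite mulr_sumr.
    apply: ler_sum => j _; rewrite normrM (ger0_norm (C0 j)) ler_wpM2r//.
    by case/andP: (Ck j).
  have h3 : th * (N^-1 * \sum_j C j) = r - N^-1 * \sum_j C j * b j.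
    by rewrite rE; ring.
  have h4 : `|th| * (N^-1 * \sum_j C j) <= `|r| + M * B.
    rewrite -{1}(@ger0_norm _ (N^-1 * \sum_j C j)); last first.
      exact: (le_trans (ltW k0)).
    rewrite -normrM h3; apply: (le_trans (ler_normB _ _)).
    by rewrite lerD2l.
  by apply: le_trans h4; rewrite mulrC ler_wpM2l.
have th_le' : `|th| <= M * (`|r| + M * B).
  by rewrite [X in X * _]ME ler_pdivlMl.
have M2 : 1 <= M ^+ 2 by rewrite exprn_ege1.
have DM : D <= 2 * M ^+ 4 * (`|r| + B).
  apply: (le_trans DB).
  have r0 := normr_ge0 r.
  have M3 : M <= M ^+ 4 by rewrite ler_eXnr.
  have M4 : M ^+ 2 <= M ^+ 4 by rewrite ler_weXn2l.
  have M5 : M ^+ 3 <= M ^+ 4 by rewrite ler_weXn2l.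
  apply: (@le_trans _ _ (M ^+ 2 * `|r| + M ^+ 3 * B + M * B)).
    have -> : M ^+ 2 * `|r| + M ^+ 3 * B + M * B = M * (M * (`|r| + M * B) + B).
      by ring.
    by rewrite ler_pM2l// lerD2r.
  have := ler_wpM2r r0 M4; have := ler_wpM2r B0 M5; have := ler_wpM2r B0 M3.
  have : 0 <= M ^+ 4 * `|r| by rewrite mulr_ge0// exprn_ge0// ltW.
  lra.
have B2 : B ^+ 2 <= N^-1 * \sum_j b j ^+ 2.
  apply: (le_trans (sqr_mean_le _ n0)).
  rewrite ler_pM2l ?invr_gt0//; apply: ler_sum => j _.
  by rewrite real_normK// num_real.
have : D ^+ 2 <= (2 * M ^+ 4 * (`|r| + B)) ^+ 2.
  by rewrite lerXn2r// nnegrE (le_trans D0).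
move/le_trans; apply.
rewrite exprMn exprMn -exprM /= -ME.
have -> : 8 * M ^+ 8 * (r ^+ 2 + N^-1 * \sum_j b j ^+ 2) =
    2 ^+ 2 * M ^+ 8 * (2 * (r ^+ 2 + N^-1 * \sum_j b j ^+ 2)) by ring.
rewrite ler_pM2l; last by rewrite mulr_gt0 ?exprn_gt0.
have := sqr_ge0 (`|r| - B); have : `|r| ^+ 2 = r ^+ 2.
  by rewrite real_normK// num_real.
by move: B2; rewrite sqrrB sqrrD; lra.
Qed.

End dual_stability.

(** * Products of independent variables *)

Section decoupling.
Context d (W : measurableType d) (R : realType) (P : probability W R).
Context d1 (V : measurableType d1) d2 (T : measurableType d2).
Local Open Scope ereal_scope.

(** Fubini's theorem for two independent variables, the law of the second one
    being la. *)
Lemma indep_integral (Z : {mfun W >-> V}) (U : {mfun W >-> T})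
    (la : probability T R) :
  (forall A B, measurable A -> measurable B ->
    P (Z @^-1` A `&` U @^-1` B) = P (Z @^-1` A) * la B) ->
  forall F : V * T -> \bar R, measurable_fun setT F -> (forall x, 0 <= F x) ->
  \int[P]_w F (Z w, U w) = \int[P]_w \int[la]_u F (Z w, u).
Proof.
move=> ZU F mF F0.
have mZU : measurable_fun setT (fun w => (Z w, U w)).
  by apply: measurable_fun_pair; exact: measurable_funPT.
pose ZU' : {mfun W >-> (V * T)%type} := HB.pack_for {mfun W >-> (V * T)%type}
  (fun w => (Z w, U w)) (isMeasurableFun.Build _ _ _ _ _ mZU).
have -> : \int[P]_w F (Z w, U w) = \int[P]_w (F \o ZU') w by [].
rewrite -ge0_integral_distribution//.
rewrite (eq_measure_integral (distribution P Z \x la)).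
  rewrite fubini_tonelli1// ge0_integral_distribution//.
    exact: measurable_fun_fubini_tonelli_F.
  by move=> y; apply: integral_ge0.
move=> A mA _; apply/esym.
apply: (@product_measure_unique _ _ _ _ _ (distribution P Z) la
  (distribution P ZU')) => // B C mB mC; exact: ZU.
Qed.

End decoupling.

Section pi_system.
Context d (W : measurableType d) (R : realType) (P : probability W R).
Local Open Scope ereal_scope.

(** Independence from an event C extends from a pi-system to the sigma-algebra
    that it generates. *)
Lemma pi_system_indep (G : set (set W)) (C : set W) (c : R) : (0 <= c)%R ->
  measurable C -> G `<=` measurable -> setI_closed G -> G setT ->
  (forall A, G A -> P (A `&` C) = c%:E * P A) ->
  forall A, <<s G >> A -> P (A `&` C) = c%:E * P A.
Proof.
move=> c0 mC mG GI GT GC A GA.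
have := @g_sigma_algebra_measure_unique d R W G mG (fun=> setT) (fun=> GT) _
  (mrestr P mC) (mscale (NngNum c0) P) GI.
apply => //; first by rewrite bigcup_const.
by move=> k; rewrite /= /mrestr setTI (le_lt_trans (probability_le1 _ _))// ltry.
Qed.

End pi_system.

Section product_of_independent.
Context d (W : measurableType d) (R : realType) (P : probability W R).
Context d1 (T1 : measurableType d1) d2 (T2 : measurableType d2).
Local Open Scope ereal_scope.
Variables (I : finType) (Z : {mfun W >-> T1}) (U : I -> {mfun W >-> T2}).
Variable la : probability T2 R.
Hypothesis Ula : forall i B, measurable B -> P (U i @^-1` B) = la B.
Hypothesis ZU : forall C D, measurable C -> (forall i, measurable (D i)) ->
  P (Z @^-1` C `&` \bigcap_i (U i @^-1` D i)) =
  (P (Z @^-1` C) * \prod_i P (U i @^-1` D i))%E.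

(* The pi-system of the events determined by Z and the U i with i in s; the
   sigma-algebra that it generates is put on W itself, so that no product type
   is needed for the past of the sample. *)
Let past (s : seq I) : set (set W) :=
  [set A | exists C D, [/\ measurable C, (forall i, measurable (D i)),
     (forall i, i \notin s -> D i = setT) &
     A = Z @^-1` C `&` \bigcap_i (U i @^-1` D i)]].

Let past_measurable s : past s `<=` measurable.
Proof.
move=> _ [C [D [mC mD _ ->]]]; apply: measurableI.
  by rewrite -[X in measurable X]setTI; exact: measurable_funPT.
apply: fin_bigcap_measurable => // i _.
by rewrite -[X in measurable X]setTI; exact: measurable_funPT.
Qed.

Let pastI s : setI_closed (past s).
Proof.
move=> _ _ [C [D [mC mD Ds ->]]] [C' [D' [mC' mD' Ds' ->]]].
exists (C `&` C'), (fun i => D i `&` D' i); split.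
- exact: measurableI.
- by move=> i; exact: measurableI.
- by move=> i si; rewrite Ds// Ds'// setTI.
- by rewrite preimage_setI setIACA bigcapI.
Qed.

Let pastT s : past s setT.
Proof.
exists setT, (fun=> setT); split => //; rewrite preimage_setT setTI.
by apply/esym/seteqP; split.
Qed.

Let past_indep j s : j \notin s -> forall B, measurable B ->
  forall A, past s A -> P (A `&` U j @^-1` B) = P (U j @^-1` B) * P A.
Proof.
move=> js B mB _ [C [D [mC mD Ds ->]]].
have -> : Z @^-1` C `&` \bigcap_i (U i @^-1` D i) `&` U j @^-1` B =
    Z @^-1` C `&` \bigcap_i (U i @^-1` (if i == j then B else D i)).
  rewrite -setIA; congr (_ `&` _); apply/seteqP; split => w.
    by move=> [wD wB] i _; case: eqP => [->//|_]; exact: wD.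
  move=> wD; split; last by have := wD j Logic.I; rewrite eqxx.
  by move=> i _; have := wD i Logic.I; case: eqP => // -> _; rewrite Ds.
rewrite !ZU//; last by move=> i; case: ifP.
rewrite (bigD1 j)//= [in RHS](bigD1 j)//= eqxx Ds// preimage_setT.
rewrite probability_setT mul1e muleCA; congr (_ * (_ * _)).
by apply: eq_bigr => i /negbTE ->.
Qed.

(** If phi(z, U) has mean at most K for every fixed z, the product of the
    phi(Z, U_i) has mean at most K^#|I|: condition on the past, one variable at
    a time. *)
Lemma prod_indep_le (phi : T1 * T2 -> R) (K : R) : measurable_fun setT phi ->
  (forall x, 0 <= phi x)%R -> (0 <= K)%R ->
  (forall z, \int[la]_u (phi (z, u))%:E <= K%:E) ->
  \int[P]_w (\prod_i phi (Z w, U i w))%:E <= (K ^+ #|I|)%:E.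
Proof.
move=> mphi phi0 K0 phiK.
suff main s : uniq s ->
    \int[P]_w (\prod_(i <- s) phi (Z w, U i w))%:E <= (K ^+ size s)%:E.
  have := main _ (enum_uniq I); rewrite -cardE.
  by under eq_integral do rewrite big_enum.
elim: s => [_|j s IH /= /andP[js us]].
  under eq_integral do rewrite big_nil.
  by rewrite integral_cst//= mul1e expr0 probability_le1.
pose V := g_sigma_algebraType (past s).
have midV : measurable_fun [set: W] (id : W -> V).
  move=> _ A mA; rewrite setTI preimage_id.
  exact: (smallest_sub (@sigma_algebra_measurable _ W) (@past_measurable s)).
pose idV : {mfun W >-> V} := HB.pack_for {mfun W >-> V} (id : W -> V)
  (isMeasurableFun.Build _ _ _ _ _ midV).
have mZV : measurable_fun [set: V] (Z : V -> T1).
  move=> _ A mA; rewrite setTI; apply: sub_sigma_algebra.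
  exists A, (fun=> setT); split => //.
  by rewrite (_ : \bigcap_i _ = setT) ?setIT//; apply/seteqP; split.
have mUV i : i \in s -> measurable_fun [set: V] (U i : V -> T2).
  move=> si _ A mA; rewrite setTI; apply: sub_sigma_algebra.
  exists setT, (fun k => if k == i then A else setT); split => //.
  - by move=> k; case: ifP.
  - by move=> k; case: eqP => // ->; rewrite si.
  apply/seteqP; split => w.
    by move=> wA; split => // k _; case: eqP => // ->.
  by case=> _ /(_ i Logic.I); rewrite eqxx.
pose G (v : V) : R := (\prod_(i <- s) phi (Z v, U i v))%R.
have mG : measurable_fun [set: V] G.
  apply: measurable_prod => i si.
  apply: (measurableT_comp mphi); apply: measurable_fun_pair => //.
  exact: mUV.
have G0 v : (0 <= G v)%R by apply: prodr_ge0.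
pose F (x : V * T2) : \bar R := (G x.1 * phi (Z x.1 : T1, x.2))%:E.
have mF : measurable_fun setT F.
  apply/measurable_EFinP; apply: measurable_funM.
    exact: measurableT_comp mG measurable_fst.
  apply: (measurableT_comp mphi); apply: measurable_fun_pair => //.
  exact: (measurableT_comp mZV).
rewrite (_ : \int[P]_w _ = \int[P]_w F (idV w, U j w)); last first.
  by apply: eq_integral => w _; rewrite big_cons mulrC.
rewrite (indep_integral (la := la))//; last 2 first.
- move=> A B mA mB; rewrite preimage_id.
  have mUB : measurable (U j @^-1` B).
    by rewrite -[X in measurable X]setTI; exact: measurable_funPT.
  have PB : P (U j @^-1` B) \is a fin_num by exact: fin_num_measure.
  rewrite -(Ula j mB) muleC -[in RHS](fineK PB).
  apply: (pi_system_indep (G := past s)) => //.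
  + by rewrite fine_ge0.
  + by move=> D sD; rewrite fineK//; exact: (past_indep js).
- by move=> x; rewrite lee_fin mulr_ge0.
have mG' : measurable_fun [set: W] (fun w => (K * G w)%:E).
  apply/measurable_EFinP; apply: measurable_funM => //.
  exact: (measurableT_comp mG midV).
apply: (@le_trans _ _ (\int[P]_w (K * G w)%:E)).
  apply: ge0_le_integral => //.
  - by move=> w _; apply: integral_ge0 => u _; rewrite lee_fin mulr_ge0.
  - have mF' : measurable_fun [set: V] (fun v => \int[la]_u F (v, u)).
      apply: (measurable_fun_fubini_tonelli_F F) => // x.
      by rewrite lee_fin mulr_ge0.
    exact: (measurableT_comp mF' midV).
  - move=> w _; rewrite /F /=.
    under eq_integral do rewrite EFinM.
    rewrite ge0_integralZl//.
    + by rewrite muleC EFinM lee_wpmul2r ?lee_fin ?G0//; exact: phiK.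
    + apply/measurable_EFinP; apply: (measurableT_comp mphi).
      exact: pair1_measurable.
    + by move=> u _; rewrite lee_fin.
    + by rewrite lee_fin.
under eq_integral do rewrite EFinM.
rewrite ge0_integralZl//.
- by rewrite exprS EFinM lee_wpmul2l ?lee_fin// IH.
- by apply/measurable_EFinP; exact: (measurableT_comp mG midV).
- by move=> w _; rewrite lee_fin.
Qed.

End product_of_independent.

(** * Moments of averages *)

Section exponential_estimates.
Context {R : realType}.
Implicit Types t : R.

Lemma expR_le1DxDsqr t : `|t| <= 3^-1 -> expR t <= 1 + t + t ^+ 2.
Proof.
rewrite ler_norml => /andP[t1 t2].
have e0 := expR_gt0 t.
have h : (1 - t / 2) ^+ 2 * expR t <= 1.
  have -> : expR t = expR (t / 2) ^+ 2 by rewrite -expRM_natl; congr expR; field.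
  rewrite -exprMn -[leRHS](expr1n _ 2) lerXn2r ?nnegrE//.
    by rewrite mulr_ge0 ?expR_ge0//; lra.
  have := expR_ge1Dx (- (t / 2)); rewrite expRN => h.
  have := ler_wpM2r (expR_ge0 (t / 2)) h.
  by rewrite mulVf ?gt_eqF ?expR_gt0// mulrDl mulNr; lra.
have d0 : 0 < (1 - t / 2) ^+ 2 by apply: exprn_gt0; lra.
rewrite -(ler_pM2l d0); apply: (le_trans h).
have : 0 <= t ^+ 2 * (4^-1 - 3 / 4 * t + t ^+ 2 / 4).
  by rewrite mulr_ge0 ?sqr_ge0//; have := sqr_ge0 t; lra.
by lra.
Qed.

Lemma exprD2n_le_expR m t :
  t ^+ (2 * m) <= (2 * m)`!%:R * (expR t + expR (- t)).
Proof.
have H (x : R) : 0 <= x -> x ^+ (2 * m) <= (2 * m)`!%:R * expR x.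
  move=> x0; case: m => [|m].
    by rewrite muln0 fact0 mul1r expr0; have := expR_ge1Dx x; lra.
  rewrite mulnS; set k := (2 * m).+1; have -> : (2 + 2 * m)%N = k.+1 by [].
  have := expR_ge1Dxn k x0 => h.
  have f0 : 0 < (k.+1)`!%:R :> R by rewrite ltr0n fact_gt0.
  by rewrite -ler_pdivrMl// mulrC; apply: le_trans h; rewrite lerDr.
have f0 : 0 <= (2 * m)`!%:R :> R by [].
have E1 := expR_ge0 t; have E2 := expR_ge0 (- t).
have [t0|t0] := leP 0 t.
  apply: (le_trans (H _ t0)); rewrite ler_wpM2l//; lra.
have -> : t ^+ (2 * m) = (- t) ^+ (2 * m) by rewrite !exprM sqrrN.
apply: (le_trans (H _ _)); first by lra.
rewrite ler_wpM2l//; lra.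
Qed.

End exponential_estimates.

Section moment_bound.
Context d (W : measurableType d) (R : realType) (P : probability W R).
Context d1 (T1 : measurableType d1) d2 (T2 : measurableType d2).
Variables (n : nat) (Z : {mfun W >-> T1}) (U : 'I_n -> {mfun W >-> T2}).
Variable la : probability T2 R.
Hypothesis n0 : (0 < n)%N.
Hypothesis Ula : forall i B, measurable B -> P (U i @^-1` B) = la B.
Hypothesis ZU : forall C D, measurable C -> (forall i, measurable (D i)) ->
  P (Z @^-1` C `&` \bigcap_i (U i @^-1` D i)) =
  (P (Z @^-1` C) * \prod_i P (U i @^-1` D i))%E.
Variables (xi : T1 * T2 -> R) (B : R).
Hypothesis mxi : measurable_fun setT xi.
Hypothesis B0 : 0 < B.
Hypothesis xiB : forall x, `|xi x| <= B.
Hypothesis xi0 : forall z, (\int[la]_u (xi (z, u))%:E = 0)%E.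

(* Exponential moments of the sum, by second order expansion: the first order
   term vanishes. *)
Let exp_moment (s : R) : 0 <= s -> s * B <= 3^-1 ->
  (\int[P]_w (expR (\sum_i s * xi (Z w, U i w)))%:E <=
    ((1 + (s * B) ^+ 2) ^+ n)%:E)%E /\
  (\int[P]_w (expR (- \sum_i s * xi (Z w, U i w)))%:E <=
    ((1 + (s * B) ^+ 2) ^+ n)%:E)%E.
Proof.
move=> s0 sB.
have H (e : R) : `|e| = 1 ->
    (\int[P]_w (expR (\sum_i e * (s * xi (Z w, U i w))))%:E <=
    ((1 + (s * B) ^+ 2) ^+ n)%:E)%E.
  move=> e1.
  pose phi x := expR (e * (s * xi x)).
  have mphi : measurable_fun setT phi.
    apply: measurableT_comp => //; apply: measurable_funM => //.
    exact: measurable_funM.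
  under eq_integral do rewrite expR_sum.
  rewrite -[n in (_ ^+ n)%:E]card_ord.
  apply: (prod_indep_le Ula ZU (phi := phi)).
  - exact: mphi.
  - by move=> x; exact: expR_ge0.
  - by rewrite addr_ge0 ?sqr_ge0.
  move=> z.
  have mz : measurable_fun setT (fun u => xi (z, u)).
    by apply: (measurableT_comp mxi); exact: pair1_measurable.
  have iz : la.-integrable setT (fun u => (xi (z, u))%:E).
    apply: measurable_bounded_integrable => //.
      by rewrite -ge0_fin_numE// fin_num_measure.
    by exists B; split; [exact: num_real|move=> x Bx u _; exact: le_trans (ltW Bx)].
  apply: (@le_trans _ _
    (\int[la]_u ((1 + (s * B) ^+ 2)%:E + (e * s)%:E * (xi (z, u))%:E))%E).
    apply: ge0_le_integral => //.
    - by move=> u _; rewrite lee_fin expR_ge0.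
    - apply/measurable_EFinP; apply: (measurableT_comp mphi).
      exact: pair1_measurable.
    - apply: emeasurable_funD => //; apply: measurable_funeM.
      exact/measurable_EFinP.
    move=> u _; rewrite -EFinM -EFinD lee_fin.
    have b : `|e * (s * xi (z, u))| <= s * B.
      by rewrite !normrM e1 mul1r (ger0_norm s0) ler_wpM2l.
    apply: (le_trans (expR_le1DxDsqr (le_trans b sB))).
    have : (e * (s * xi (z, u))) ^+ 2 <= (s * B) ^+ 2.
      by rewrite -real_normK ?num_real// lerXn2r ?nnegrE// (le_trans _ b).
    lra.
  rewrite integralD//; last 2 first.
  - by apply: finite_measure_integrable_cst.
  - exact: integrableZl.
  by rewrite integralZl// xi0 mule0 adde0 integral_cst//= probability_setT mule1.
split.
  have := H 1 (normr1 _); under eq_integral do under eq_bigr do rewrite mul1r.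
  by [].
have := H (-1) _; rewrite normrN1 => /(_ erefl).
under eq_integral do (under eq_bigr do rewrite mulN1r; rewrite sumrN).
by [].
Qed.

(** The moment of order 2m of an average of n conditionally centered variables
    bounded by B is of order (B^2/n)^m, with a constant depending on m only:
    the exponential moments of the sum at scale n^(-1/2) are bounded by e, and
    they dominate every even moment. *)
Lemma mean_moment_le m :
  (\int[P]_w ((n%:R^-1 * \sum_i xi (Z w, U i w)) ^+ (2 * m))%:E <=
   (2 * expR 1 * (2 * m)`!%:R * (9 * B ^+ 2 / n%:R) ^+ m)%:E)%E.
Proof.
have N0 : 0 < n%:R :> R by rewrite ltr0n.
have N1 : 1 <= n%:R :> R by rewrite ler1n.
pose rn := Num.sqrt (n%:R : R).
have rn0 : 0 < rn by rewrite sqrtr_gt0.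
have rnE : rn ^+ 2 = n%:R by rewrite sqr_sqrtr// ltW.
have rn1 : 1 <= rn by rewrite -(expr_ge1 (n:=2))// ?rnE// ltW.
(* the factor 3 brings every summand below 1/3, where the second order bound
   on the exponential holds *)
pose s := (3 * B * rn)^-1.
have s0 : 0 < s by rewrite invr_gt0 !mulr_gt0.
have sBE : s * B = (3 * rn)^-1 by rewrite /s; field; rewrite !gt_eqF.
have sB : s * B <= 3^-1.
  by rewrite sBE lef_pV2 ?posrE ?mulr_gt0// ler_peMr.
have [H1 H2] := exp_moment (ltW s0) sB.
have K1 : (1 + (s * B) ^+ 2) ^+ n <= expR 1.
  apply: (@le_trans _ _ (expR (n%:R^-1) ^+ n)); last first.
    by rewrite -expRM_natl mulfV// gt_eqF.
  rewrite lerXn2r ?nnegrE ?expR_ge0 ?addr_ge0 ?sqr_ge0//.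
  apply: le_trans (expR_ge1Dx _); rewrite lerD2l sBE exprVn exprMn rnE.
  by rewrite lef_pV2 ?posrE ?mulr_gt0// ler_peMl// ?ltW//; lra.
pose T w := \sum_i s * xi (Z w, U i w).
have mT : measurable_fun setT T.
  apply: measurable_sum => i; apply: measurable_funM => //.
  by apply: (measurableT_comp mxi); apply: measurable_fun_pair;
    exact: measurable_funPT.
have mE : measurable_fun setT (fun w => (expR (T w))%:E).
  by apply/measurable_EFinP; exact: measurableT_comp.
have mE' : measurable_fun setT (fun w => (expR (- T w))%:E).
  apply/measurable_EFinP; apply: measurableT_comp => //.
  exact: measurableT_comp.
set k := (9 * B ^+ 2 / n%:R) ^+ m.
have k0 : 0 <= k.
  by rewrite exprn_ge0// divr_ge0 ?ltW// mulr_gt0 ?exprn_gt0.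
have E w : (n%:R^-1 * \sum_i xi (Z w, U i w)) ^+ (2 * m) = k * T w ^+ (2 * m).
  rewrite /T -mulr_sumr exprM [X in _ = _ * X]exprM -exprMn; congr (_ ^+ _).
  rewrite exprMn [in RHS]exprMn mulrA; congr (_ * _).
  rewrite /s !(exprVn, exprMn) rnE; field.
  by rewrite !gt_eqF.
under eq_integral do rewrite E.
apply: (@le_trans _ _ (\int[P]_w ((k * (2 * m)`!%:R)%:E *
    ((expR (T w))%:E + (expR (- T w))%:E)))%E).
  apply: ge0_le_integral => //.
  - move=> w _; rewrite lee_fin mulr_ge0//; case: {E k k0}m => [|m].
      by rewrite muln0 expr0.
    by rewrite exprM exprn_ge0// sqr_ge0.
  - apply/measurable_EFinP; apply: measurable_funM => //.
    exact: measurable_funX.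
  - apply: measurable_funeM; exact: emeasurable_funD.
  move=> w _; rewrite -EFinD -EFinM lee_fin -mulrA ler_wpM2l//.
  exact: exprD2n_le_expR.
rewrite ge0_integralZl//; last 3 first.
- exact: emeasurable_funD.
- by move=> w _; rewrite adde_ge0// lee_fin expR_ge0.
- by rewrite lee_fin mulr_ge0.
rewrite ge0_integralD//.
apply: (@le_trans _ _ ((k * (2 * m)`!%:R)%:E * ((expR 1)%:E + (expR 1)%:E))%E).
  rewrite lee_wpmul2l ?lee_fin ?mulr_ge0//.
  by apply: leeD; [apply: (le_trans H1)|apply: (le_trans H2)]; rewrite lee_fin.
by rewrite -EFinD -EFinM lee_fin; lra.
Qed.

End moment_bound.

(** * Bounded measurable functions *)

Section bounded_functions.
Context d (T : measurableType d) (R : realType).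
Implicit Types f g : T -> R.

(** Bounded measurable functions; they are integrable for every probability. *)
Definition bounded_mfun f : Prop :=
  measurable_fun setT f /\ exists M, forall x, `|f x| <= M.

(** Measurable functions bounded above and away from 0. *)
Definition positive_mfun f : Prop :=
  measurable_fun setT f /\ exists m M, 0 < m /\ forall x, m <= f x <= M.

Lemma bounded_mfun_cst c : bounded_mfun (fun=> c).
Proof. by split => //; exists `|c|. Qed.

Lemma bounded_mfunD f g : bounded_mfun f -> bounded_mfun g ->
  bounded_mfun (fun x => f x + g x).
Proof.
move=> [mf [M fM]] [mg [N gN]]; split; first exact: measurable_funD.
by exists (M + N) => x; rewrite (le_trans (ler_normD _ _))// lerD.
Qed.

Lemma bounded_mfunM f g : bounded_mfun f -> bounded_mfun g ->
  bounded_mfun (fun x => f x * g x).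
Proof.
move=> [mf [M fM]] [mg [N gN]]; split; first exact: measurable_funM.
by exists (M * N) => x; rewrite normrM ler_pM.
Qed.

Lemma bounded_mfunN f : bounded_mfun f -> bounded_mfun (fun x => - f x).
Proof.
move=> [mf [M fM]]; split; first exact: measurable_funN.
by exists M => x; rewrite normrN.
Qed.

Lemma positive_mfun_bounded f : positive_mfun f -> bounded_mfun f.
Proof.
move=> [mf [m [M [m0 fM]]]]; split => //; exists M => x.
have /andP[h1 h2] := fM x; rewrite ger0_norm//.
by rewrite (le_trans (ltW m0)).
Qed.

Lemma positive_mfun_gt0 f : positive_mfun f -> forall x, 0 < f x.
Proof.
by move=> [_ [m [M [m0 fM]]]] x; have /andP[+ _] := fM x; exact: lt_le_trans.
Qed.

Lemma positive_mfun_ln f : positive_mfun f -> bounded_mfun (fun x => ln (f x)).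
Proof.
move=> pf; have f0 := positive_mfun_gt0 pf.
have [mf [m [M [m0 fM]]]] := pf; split; first exact: measurableT_comp.
exists (`|ln m| + `|ln M|) => x; have /andP[h1 h2] := fM x.
have l1 : ln m <= ln (f x) by rewrite ler_ln// posrE f0.
have l2 : ln (f x) <= ln M.
  by rewrite ler_ln ?posrE ?f0// (lt_le_trans _ h2)// f0.
have := ler_norm (ln M); have := ler_norm (- ln m); rewrite normrN.
have := normr_ge0 (ln m); have := normr_ge0 (ln M).
by move=> ? ? ? ?; rewrite ler_norml; apply/andP; split; lra.
Qed.

Lemma positive_mfunV f : positive_mfun f -> positive_mfun (fun x => (f x)^-1).
Proof.
move=> pf; have f0 := positive_mfun_gt0 pf.
have [mf [m [M [m0 fM]]]] := pf; split.
  rewrite (_ : (fun x => _) = (fun x => expR (- ln (f x)))); last first.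
    by apply/funext => x; rewrite expRN lnK// posrE.
  apply: measurableT_comp => //; apply: measurable_funN.
  exact: measurableT_comp.
have [x0|nx] := pselect (exists x : T, True); last first.
  by exists 1, 1; split => // x; exfalso; apply: nx; exists x.
have [x _] := x0; have M0 : 0 < M.
  by have /andP[_] := fM x; apply: lt_le_trans.
exists M^-1, m^-1; split; first by rewrite invr_gt0.
move=> y; have /andP[h1 h2] := fM y; have fy := f0 y.
by rewrite !lef_pV2 ?posrE// h1 h2.
Qed.

Lemma positive_mfunM f g : positive_mfun f -> positive_mfun g ->
  positive_mfun (fun x => f x * g x).
Proof.
move=> [mf [m [M [m0 fM]]]] [mg [k [N [k0 gN]]]].
split; first exact: measurable_funM.
exists (m * k), (M * N); split; first by rewrite mulr_gt0.
move=> x; have /andP[h1 h2] := fM x; have /andP[h3 h4] := gN x.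
have ? : 0 <= f x by exact: le_trans (ltW m0) _.
have ? : 0 <= g x by exact: le_trans (ltW k0) _.
by rewrite !ler_pM// ltW.
Qed.

Variable P : probability T R.

Lemma bounded_mfun_integrable f :
  bounded_mfun f -> P.-integrable setT (EFin \o f).
Proof.
move=> [mf [M fM]]; apply: measurable_bounded_integrable => //.
  by rewrite -ge0_fin_numE// fin_num_measure.
exists M; split; first exact: num_real.
by move=> x Mx y _; exact: le_trans (ltW Mx).
Qed.

Lemma le_prob_Rintegral f g : bounded_mfun f -> bounded_mfun g ->
  (forall x, f x <= g x) -> \int[P]_x f x <= \int[P]_x g x.
Proof.
by move=> bf bg fg; apply: le_Rintegral => //; exact: bounded_mfun_integrable.
Qed.

Lemma prob_Rintegral_cst c : \int[P]_x c = c.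
Proof. by rewrite Rintegral_cst//= probability_setT mulr1. Qed.

Lemma Rintegral_EFin f : bounded_mfun f ->
  (\int[P]_x (f x)%:E)%E = (\int[P]_x f x)%:E.
Proof.
move=> bf; rewrite /Rintegral fineK//; apply: integrable_fin_num => //.
exact: bounded_mfun_integrable.
Qed.

Lemma prob_RintegralZl c f : bounded_mfun f ->
  \int[P]_x (c * f x) = c * \int[P]_x f x.
Proof. by move=> bf; rewrite RintegralZl//; exact: bounded_mfun_integrable. Qed.

Lemma prob_RintegralD f g : bounded_mfun f -> bounded_mfun g ->
  \int[P]_x (f x + g x) = \int[P]_x f x + \int[P]_x g x.
Proof. by move=> ? ?; rewrite RintegralD//; exact: bounded_mfun_integrable. Qed.

Lemma prob_RintegralB f g : bounded_mfun f -> bounded_mfun g ->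
  \int[P]_x (f x - g x) = \int[P]_x f x - \int[P]_x g x.
Proof. by move=> ? ?; rewrite RintegralB//; exact: bounded_mfun_integrable. Qed.

Lemma prob_Rintegral_bounds m M f : bounded_mfun f ->
  (forall x, m <= f x <= M) -> m <= \int[P]_x f x <= M.
Proof.
move=> bf mfM; have bc := bounded_mfun_cst; apply/andP; split.
  rewrite -[leLHS]prob_Rintegral_cst; apply: le_prob_Rintegral => // x.
  by have /andP[] := mfM x.
rewrite -[leRHS]prob_Rintegral_cst; apply: le_prob_Rintegral => // x.
by have /andP[] := mfM x.
Qed.

End bounded_functions.

Section partial_integrals.
Context d1 (T1 : measurableType d1) d2 (T2 : measurableType d2) (R : realType).
Variable P2 : probability T2 R.

Lemma bounded_mfun_comp d (T : measurableType d) (f : T2 -> R) (g : T -> T2) :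
  measurable_fun setT g -> bounded_mfun f -> bounded_mfun (f \o g).
Proof.
move=> mg [mf [M fM]]; split; first exact: measurableT_comp.
by exists M => x; exact: fM.
Qed.

Lemma bounded_mfun_pair1 (F : T1 * T2 -> R) x : bounded_mfun F ->
  bounded_mfun (fun y => F (x, y)).
Proof.
move=> [mF [M FM]]; split; last by exists M.
by apply: (measurableT_comp mF); exact: pair1_measurable.
Qed.

Lemma bounded_mfun_pair2 (F : T1 * T2 -> R) y : bounded_mfun F ->
  bounded_mfun (fun x => F (x, y)).
Proof.
move=> [mF [M FM]]; split; last by exists M.
by apply: (measurableT_comp mF); exact: pair2_measurable.
Qed.

Lemma bounded_mfun_prod_integrable (P1 : probability T1 R) (F : T1 * T2 -> R) :
  bounded_mfun F -> (P1 \x P2)%E.-integrable setT (EFin \o F).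
Proof.
move=> [mF [M FM]]; apply: measurable_bounded_integrable => //.
  by have := probability_setT (product_probability P1 P2); rewrite /= => ->;
    rewrite ltry.
exists M; split; first exact: num_real.
by move=> x Mx y _; exact: le_trans (ltW Mx).
Qed.

Lemma bounded_mfun_Rintegral (F : T1 * T2 -> R) : bounded_mfun F ->
  bounded_mfun (fun x => \int[P2]_y F (x, y)).
Proof.
move=> bF; have [mF [M FM]] := bF; split.
  apply/measurable_EFinP.
  rewrite (_ : EFin \o _ = fubini_F P2 (EFin \o F)); last first.
    apply/funext => x; rewrite /= -Rintegral_EFin//.
    exact: bounded_mfun_pair1.
  (* any measure on the first factor will do *)
  exact: (measurable_fubini_F (bounded_mfun_prod_integrable (dirac point) bF)).
exists M => x; rewrite ler_norml.
apply: prob_Rintegral_bounds; first exact: bounded_mfun_pair1.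
by move=> y; rewrite -ler_norml.
Qed.

Lemma bounded_Fubini (P1 : probability T1 R) (F : T1 * T2 -> R) : bounded_mfun F ->
  \int[P1]_x \int[P2]_y F (x, y) = \int[P2]_y \int[P1]_x F (x, y).
Proof.
move=> bF; have := Fubini (bounded_mfun_prod_integrable P1 bF).
have E1 : fubini_F P2 (EFin \o F) = fun x => (\int[P2]_y F (x, y))%:E.
  by apply/funext => x; rewrite -Rintegral_EFin//; exact: bounded_mfun_pair1.
have E2 : fubini_G P1 (EFin \o F) = fun y => (\int[P1]_x F (x, y))%:E.
  by apply/funext => y; rewrite -Rintegral_EFin//; exact: bounded_mfun_pair2.
rewrite -/(fubini_F P2 (EFin \o F)) -/(fubini_G P1 (EFin \o F)) E1 E2.
exact: congr1.
Qed.

End partial_integrals.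

(** * The half-step of the Sinkhorn iteration *)

Section half_step.
Context d1 (T1 : measurableType d1) d2 (T2 : measurableType d2) (R : realType).
Variables (P : probability T2 R) (K : T1 * T2 -> R) (k : R).
Hypothesis k0 : 0 < k.
Hypotheses (mK : measurable_fun setT K) (K1 : forall z, k <= K z <= 1).

(** The half-step b |-> 1 / int K(x, y) b(y) dP(y) of the Sinkhorn iteration,
    written with the exponentials b = e^(eta g) of the potentials. *)
Definition half_step (b : T2 -> R) (x : T1) : R :=
  (\int[P]_y (K (x, y) * b y))^-1.

Lemma kernel_positive : positive_mfun K.
Proof. by split => //; exists k, 1. Qed.

Lemma kernel_mul_bounded b : positive_mfun b ->
  bounded_mfun (fun z => K z * b z.2).
Proof.
move=> /positive_mfun_bounded pb.
apply: bounded_mfunM; first exact/positive_mfun_bounded/kernel_positive.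
exact: (bounded_mfun_comp (@measurable_snd _ _ T1 T2)).
Qed.

Lemma kernel_mul_section_bounded b x : positive_mfun b ->
  bounded_mfun (fun y => K (x, y) * b y).
Proof. by move=> /kernel_mul_bounded /(bounded_mfun_pair1 x). Qed.

Lemma half_step_positive b : positive_mfun b -> positive_mfun (half_step b).
Proof.
move=> pb; apply: positive_mfunV.
have b0 := positive_mfun_gt0 pb.
have bf := kernel_mul_bounded pb.
split; first by have [] := bounded_mfun_Rintegral P bf.
have [mb [m [M [m0 bM]]]] := pb.
exists (k * m), M; split; first by rewrite mulr_gt0.
move=> x; apply: prob_Rintegral_bounds; first exact: kernel_mul_section_bounded.
move=> y; have /andP[h1 h2] := K1 (x, y); have /andP[h3 h4] := bM y.
apply/andP; split; first by rewrite ler_pM// ltW.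
by rewrite -[M]mul1r ler_pM ?(ltW (b0 _))// (le_trans (ltW k0)).
Qed.

Lemma half_step_gt0 b x : positive_mfun b -> 0 < half_step b x.
Proof. by move=> /half_step_positive/positive_mfun_gt0. Qed.

Lemma kernel_int_gt0 b x : positive_mfun b -> 0 < \int[P]_y (K (x, y) * b y).
Proof. by move=> /half_step_gt0 => /(_ x); rewrite invr_gt0. Qed.

Lemma half_step_int b x : positive_mfun b ->
  half_step b x * \int[P]_y (K (x, y) * b y) = 1.
Proof. by move=> pb; rewrite mulVf// gt_eqF// kernel_int_gt0. Qed.

(** The image of a half-step varies at most by the factor 1/k. *)
Lemma half_step_osc b x x' : positive_mfun b ->
  k * half_step b x <= half_step b x'.
Proof.
move=> pb; have b0 := positive_mfun_gt0 pb.
rewrite ler_pdivrMr ?kernel_int_gt0// ler_pdivlMl ?kernel_int_gt0//.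
have bb := positive_mfun_bounded pb.
apply: (@le_trans _ _ (k * \int[P]_y b y)).
  rewrite mulrC ler_wpM2l ?(ltW k0)//; apply: le_prob_Rintegral => //.
    exact: kernel_mul_section_bounded.
  by move=> y; rewrite ler_piMl ?(ltW (b0 _))//; have /andP[] := K1 (x', y).
rewrite -prob_RintegralZl//; apply: le_prob_Rintegral => //.
- by apply: bounded_mfunM => //; exact: bounded_mfun_cst.
- exact: kernel_mul_section_bounded.
by move=> y; rewrite ler_wpM2r ?(ltW (b0 _))//; have /andP[] := K1 (x, y).
Qed.

(** The half-step reverses the order of the arguments, up to factors. *)
Lemma half_step_antitone c b b' : 0 < c -> positive_mfun b -> positive_mfun b' ->
  (forall y, c * b y <= b' y) -> forall x, c * half_step b' x <= half_step b x.
Proof.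
move=> c0 pb pb' cb x.
rewrite ler_pdivrMr ?kernel_int_gt0// ler_pdivlMl ?kernel_int_gt0//.
rewrite mulrC -prob_RintegralZl; last exact: kernel_mul_section_bounded.
apply: le_prob_Rintegral.
- apply: bounded_mfunM; first exact: bounded_mfun_cst.
  exact: kernel_mul_section_bounded.
- exact: kernel_mul_section_bounded.
move=> y; rewrite mulrCA ler_wpM2l//.
by have /andP[+ _] := K1 (x, y); exact: (le_trans (ltW k0)).
Qed.

(** The half-step contracts the range of the ratio of two arguments: for every
    x, the density K(x, .) b / int K(x, .) b is at least k^2, so the average of
    b'/b against it lies closer to the P-average than the extremes m and M. *)
Lemma half_step_contracts b b' m M : 0 < m -> positive_mfun b ->
  positive_mfun b' -> (forall y y', k * b y <= b y') ->
  (forall y, m * b y <= b' y <= M * b y) ->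
  let rbar := \int[P]_y (b' y / b y) in
  forall x, ((1 - k ^+ 2) * m + k ^+ 2 * rbar) * half_step b' x <= half_step b x
    <= ((1 - k ^+ 2) * M + k ^+ 2 * rbar) * half_step b' x.
Proof.
move=> m0 pb pb' osc mM rbar x.
have b0 := positive_mfun_gt0 pb; have b'0 := positive_mfun_gt0 pb'.
set I := \int[P]_y (K (x, y) * b y); set I' := \int[P]_y (K (x, y) * b' y).
have I0 : 0 < I by exact: kernel_int_gt0.
have I'0 : 0 < I' by exact: kernel_int_gt0.
have bKb := kernel_mul_section_bounded x pb.
have bKb' := kernel_mul_section_bounded x pb'.
have br : bounded_mfun (fun y => b' y / b y).
  apply: positive_mfun_bounded; apply: positive_mfunM => //.
  exact: positive_mfunV.
have bb := positive_mfun_bounded pb.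
have bc := @bounded_mfun_cst _ T2 R.
have dom y : k ^+ 2 * I <= K (x, y) * b y.
  have h1 : k * I <= b y.
    rewrite -prob_RintegralZl// -[leRHS](prob_Rintegral_cst P).
    apply: le_prob_Rintegral => //; first exact: bounded_mfunM.
    move=> y'; apply: le_trans (osc y' y); rewrite ler_wpM2l ?(ltW k0)//.
    by rewrite ler_piMl ?(ltW (b0 _))//; have /andP[] := K1 (x, y').
  rewrite expr2 -mulrA ler_pM ?mulr_ge0 ?(ltW k0) ?(ltW I0)//.
  by have /andP[] := K1 (x, y).
have K0 y : 0 <= K (x, y) * b y.
  by rewrite (le_trans _ (dom y))// mulr_ge0// ltW// exprn_gt0.
have ratio y : K (x, y) * b' y = K (x, y) * b y * (b' y / b y).
  by rewrite -!mulrA; congr (_ * _); rewrite mulrCA mulfV ?mulr1 ?gt_eqF.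
have rm y : m <= b' y / b y by rewrite ler_pdivlMr//; have /andP[] := mM y.
have rM y : b' y / b y <= M by rewrite ler_pdivrMr//; have /andP[] := mM y.
have dI : bounded_mfun (fun y => k ^+ 2 * I * (b' y / b y)) by exact: bounded_mfunM.
have low : I * ((1 - k ^+ 2) * m + k ^+ 2 * rbar) <= I'.
  have h : \int[P]_y (k ^+ 2 * I * (b' y / b y) - k ^+ 2 * I * m)
      <= \int[P]_y (K (x, y) * b' y - m * (K (x, y) * b y)).
    apply: le_prob_Rintegral.
    - by apply: bounded_mfunD => //; exact: bounded_mfun_cst.
    - apply: bounded_mfunD => //; apply: bounded_mfunN.
      by apply: bounded_mfunM => //.
    move=> y; rewrite ratio [m * _]mulrC -!mulrBr ler_wpM2r ?subr_ge0//.
  move: h; rewrite !prob_RintegralB//; last exact: bounded_mfunM.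
  rewrite !prob_RintegralZl// prob_Rintegral_cst -/I -/I' -/rbar.
  by rewrite -subr_ge0 => h; rewrite -subr_ge0; apply: (le_trans h); lra.
have upp : I' <= I * ((1 - k ^+ 2) * M + k ^+ 2 * rbar).
  have h : \int[P]_y (k ^+ 2 * I * M - k ^+ 2 * I * (b' y / b y))
      <= \int[P]_y (M * (K (x, y) * b y) - K (x, y) * b' y).
    apply: le_prob_Rintegral.
    - by apply: bounded_mfunD => //; exact: bounded_mfunN.
    - apply: bounded_mfunD => //; last exact: bounded_mfunN.
      exact: bounded_mfunM.
    move=> y; rewrite ratio [M * _]mulrC -!mulrBr ler_wpM2r ?subr_ge0//.
  move: h; rewrite !prob_RintegralB//; last exact: bounded_mfunM.
  rewrite !prob_RintegralZl// prob_Rintegral_cst -/I -/I' -/rbar.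
  by rewrite -subr_ge0 => h; rewrite -subr_ge0; apply: (le_trans h); lra.
rewrite /half_step -/I -/I' ler_pdivrMr// ler_pdivlMr//.
by rewrite ler_pdivlMl// ler_pdivrMl// low upp.
Qed.

End half_step.

(** * Solution of the Schrodinger system *)

(** A sequence with geometrically small increments converges geometrically: with
    E_k the tail of the increments, u_k - E_k increases, u_k + E_k decreases,
    and the limit is the supremum of the former. *)
Lemma geometric_cauchy_limit (R : realType) (u : nat -> R) (C r : R) : 0 <= C ->
  0 <= r < 1 -> (forall k, `|u k.+1 - u k| <= C * r ^+ k) ->
  exists l, forall k, `|l - u k| <= C / (1 - r) * r ^+ k.
Proof.
move=> C0 /andP[r0 r1] uC; have r1' : 0 < 1 - r by rewrite subr_gt0.
pose E k := C / (1 - r) * r ^+ k.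
have E0 k : 0 <= E k by rewrite mulr_ge0 ?exprn_ge0// divr_ge0// ltW.
have ES k : E k - E k.+1 = C * r ^+ k.
  by rewrite /E exprS; field; rewrite gt_eqF.
have lo k j : u k - E k <= u (j + k)%N - E (j + k)%N.
  elim: j => // j IH; apply: (le_trans IH); rewrite addSn.
  by have := ES (j + k)%N; have := uC (j + k)%N; rewrite ler_norml; lra.
have up k j : u (j + k)%N + E (j + k)%N <= u k + E k.
  elim: j => // j IH; apply: le_trans IH; rewrite addSn.
  by have := ES (j + k)%N; have := uC (j + k)%N; rewrite ler_norml; lra.
have lu k l : u k - E k <= u l + E l.
  apply: (le_trans (lo k l)); apply: le_trans (up l k); rewrite addnC.
  by have := E0 (k + l)%N; lra.
pose S := range (fun k => u k - E k).
have S0 : S !=set0 by exists (u 0%N - E 0%N), 0%N.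
have ubS k : ubound S (u k + E k) by move=> _ [l _ <-]; exact: lu.
exists (sup S) => k; rewrite ler_norml -/(E k); apply/andP; split.
  have : u k - E k <= sup S.
    by apply: ub_le_sup; [exists (u 0%N + E 0%N)|exists k].
  by lra.
have : sup S <= u k + E k by exact: ge_sup.
by lra.
Qed.

Lemma ln_expRM_le (R : realType) (e x y : R) : 0 < x -> 0 < y ->
  expR e * x <= y -> e + ln x <= ln y.
Proof. by move=> x0 y0 h; rewrite -ler_expR expRD !lnK. Qed.

Section sinkhorn.
Context d1 (T1 : measurableType d1) d2 (T2 : measurableType d2) (R : realType).
Variables (mu : probability T1 R) (nu : probability T2 R).
Variables (K : T1 * T2 -> R) (k : R).
Hypotheses (k0 : 0 < k) (k1 : k <= 1).
Hypotheses (mK : measurable_fun setT K) (K1 : forall z, k <= K z <= 1).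

Let K' (z : T2 * T1) : R := K (z.2, z.1).
Let mK' : measurable_fun setT K'.
Proof.
apply: (measurableT_comp mK).
by apply: measurable_fun_pair; [exact: measurable_snd|exact: measurable_fst].
Qed.
Let K'1 z : k <= K' z <= 1. Proof. exact: K1. Qed.

Let A := half_step nu K.
Let B := half_step mu K'.
Let b_ j := iter j (B \o A) (fun=> 1).

Let A_pos b : positive_mfun b -> positive_mfun (A b).
Proof. exact: (half_step_positive nu k0). Qed.

Let B_pos a : positive_mfun a -> positive_mfun (B a).
Proof. exact: (half_step_positive mu k0). Qed.

Let b_pos j : positive_mfun (b_ j).
Proof.
elim: j => [|j IH]; last exact/B_pos/A_pos.
by split; [exact: measurable_cst|exists 1, 1; split => // y; rewrite lexx].
Qed.

Let b_osc j y y' : k * b_ j y <= b_ j y'.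
Proof.
case: j => [|j]; first by rewrite mulr1.
exact/half_step_osc/A_pos/b_pos.
Qed.

(* Both b and its image have total mass 1 against A b, so that 1 lies between
   the extremes of their ratio: no renormalization is needed. *)
Let mass b : positive_mfun b ->
  \int[mu]_x \int[nu]_y (A b x * (K (x, y) * B (A b) y)) = 1.
Proof.
move=> pb; have pA := A_pos pb; have pB := B_pos pA.
pose F (z : T1 * T2) := A b z.1 * (K z * B (A b) z.2).
have bF : bounded_mfun F.
  apply: bounded_mfunM; last exact: (kernel_mul_bounded k0).
  apply: (bounded_mfun_comp (@measurable_fst _ _ T1 T2)).
  exact: positive_mfun_bounded.
rewrite (bounded_Fubini nu mu bF) -[RHS](prob_Rintegral_cst nu).
apply: eq_Rintegral => y _.
transitivity (\int[mu]_x (B (A b) y * (K' (y, x) * A b x))).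
  by apply: eq_Rintegral => x _; rewrite /F /K' /=; ring.
rewrite prob_RintegralZl ?(half_step_int mu k0)//.
exact: (kernel_mul_section_bounded k0).
Qed.

Let ratio_le1 b m : positive_mfun b -> 0 < m ->
  (forall y, m * b y <= B (A b) y) -> m <= 1.
Proof.
move=> pb m0 mb; rewrite -(mass pb).
have pA := A_pos pb; have pB := B_pos pA.
have A0 := positive_mfun_gt0 pA.
rewrite -[leLHS](prob_Rintegral_cst mu); apply: le_prob_Rintegral.
- exact: bounded_mfun_cst.
- apply: (@bounded_mfun_Rintegral _ _ _ _ _ nu
    (fun z => A b z.1 * (K z * B (A b) z.2))).
  apply: bounded_mfunM; last exact: (kernel_mul_bounded k0).
  apply: (bounded_mfun_comp (@measurable_fst _ _ T1 T2)).
  exact: positive_mfun_bounded.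
move=> x; rewrite prob_RintegralZl; last exact: (kernel_mul_section_bounded k0).
rewrite -[leLHS]mulr1 -(half_step_int nu k0 mK K1 x pb) mulrCA ler_pM2l//.
rewrite -prob_RintegralZl; last exact: (kernel_mul_section_bounded k0).
apply: le_prob_Rintegral; last 1 first.
- move=> y; rewrite mulrCA ler_wpM2l//.
  by have /andP[+ _] := K1 (x, y); exact: (le_trans (ltW k0)).
- apply: bounded_mfunM; first exact: bounded_mfun_cst.
  exact: (kernel_mul_section_bounded k0).
- exact: (kernel_mul_section_bounded k0).
Qed.

Let ratio_ge1 b M : positive_mfun b ->
  (forall y, B (A b) y <= M * b y) -> 1 <= M.
Proof.
move=> pb Mb; rewrite -(mass pb).
have pA := A_pos pb; have pB := B_pos pA.
have A0 := positive_mfun_gt0 pA.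
rewrite -[leRHS](prob_Rintegral_cst mu); apply: le_prob_Rintegral.
- apply: (@bounded_mfun_Rintegral _ _ _ _ _ nu
    (fun z => A b z.1 * (K z * B (A b) z.2))).
  apply: bounded_mfunM; last exact: (kernel_mul_bounded k0).
  apply: (bounded_mfun_comp (@measurable_fst _ _ T1 T2)).
  exact: positive_mfun_bounded.
- exact: bounded_mfun_cst.
move=> x; rewrite prob_RintegralZl; last exact: (kernel_mul_section_bounded k0).
rewrite -[leRHS]mulr1 -(half_step_int nu k0 mK K1 x pb) mulrCA ler_pM2l//.
rewrite -prob_RintegralZl; last exact: (kernel_mul_section_bounded k0).
apply: le_prob_Rintegral; last 1 first.
- move=> y; rewrite [leRHS]mulrCA ler_wpM2l//.
  by have /andP[+ _] := K1 (x, y); exact: (le_trans (ltW k0)).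
- exact: (kernel_mul_section_bounded k0).
- apply: bounded_mfunM; first exact: bounded_mfun_cst.
  exact: (kernel_mul_section_bounded k0).
Qed.

(* one full step of the iteration contracts the range of the ratio of two
   successive iterates *)
Let step_contracts m M j : 0 < m -> m <= M ->
  (forall y, m * b_ j y <= b_ j.+1 y <= M * b_ j y) ->
  exists m' M', [/\ m <= m', M' - m' = (1 - k ^+ 2) * (M - m) &
    forall y, m' * b_ j.+1 y <= b_ j.+2 y <= M' * b_ j.+1 y].
Proof.
move=> m0 mM h; have p0 := b_pos j; have p1 := b_pos j.+1.
have b0 := positive_mfun_gt0 p0.
have := half_step_contracts nu k0 mK K1 m0 p0 p1 (b_osc j) h.
set rbar := \int[nu]_y _ => /= H.
have mr : m <= rbar.
  have br : bounded_mfun (fun y => b_ j.+1 y / b_ j y).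
    apply: positive_mfun_bounded; apply: positive_mfunM => //.
    exact: positive_mfunV.
  rewrite -[leLHS](prob_Rintegral_cst nu); apply: le_prob_Rintegral => //.
    exact: bounded_mfun_cst.
  by move=> y; rewrite ler_pdivlMr//; have /andP[] := h y.
have k21 : k ^+ 2 <= 1 by rewrite exprn_ile1// ltW.
have k20 : 0 < k ^+ 2 by rewrite exprn_gt0.
set m' := (1 - k ^+ 2) * m + k ^+ 2 * rbar in H.
set M' := (1 - k ^+ 2) * M + k ^+ 2 * rbar in H.
have mm' : m <= m'.
  rewrite -subr_ge0 /m' (_ : _ - m = k ^+ 2 * (rbar - m)); last by ring.
  by rewrite mulr_ge0 ?subr_ge0// ltW.
have m'M' : m' <= M' by rewrite lerD2r ler_wpM2l// subr_ge0.
have m'0 : 0 < m' by exact: lt_le_trans mm'.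
have M'0 : 0 < M' by exact: lt_le_trans m'M'.
exists m', M'; split => //; first by rewrite /m' /M'; ring.
have pA := A_pos p0; have pA' := A_pos p1.
move=> y; apply/andP; split.
  apply: (half_step_antitone mu k0 mK' K'1 m'0 pA' pA) => x.
  by have /andP[] := H x.
rewrite -ler_pdivrMl//.
apply: (half_step_antitone mu k0 mK' K'1 _ pA pA') => [|x]; first by rewrite invr_gt0.
by rewrite ler_pdivrMl//; have /andP[] := H x.
Qed.

Let ratio_bounds : exists m0 D : R, [/\ 0 < m0, 0 <= D & forall j, exists m M,
  [/\ m0 <= m, m <= 1, 1 <= M, M - m <= D * (1 - k ^+ 2) ^+ j &
     forall y, m * b_ j y <= b_ j.+1 y <= M * b_ j y]].
Proof.
have [_ [m [M [m0 bM]]]] := b_pos 1%N.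
have hb1 y : m * b_ 0 y <= b_ 1 y <= M * b_ 0 y by rewrite !mulr1.
have k21 : k ^+ 2 <= 1 by rewrite exprn_ile1// ltW.
have m1 : m <= 1.
  by apply: (ratio_le1 (b_pos 0) m0) => y; have /andP[] := hb1 y.
have M1 : 1 <= M.
  by apply: (ratio_ge1 (b_pos 0)) => y; have /andP[] := hb1 y.
have mM : m <= M by exact: le_trans M1.
exists m, (M - m); split; rewrite ?subr_ge0//.
elim=> [|j [n [N [mn n1 N1 nN h]]]].
  by exists m, M; split => //; rewrite expr0 mulr1.
have n0 : 0 < n by exact: lt_le_trans mn.
have [n' [N' [nn' nN' h']]] := step_contracts n0 (le_trans n1 N1) h.
exists n', N'; split => //.
- exact: le_trans nn'.
- apply: (ratio_le1 (b_pos j.+1)) => [|y]; first exact: lt_le_trans nn'.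
  by have /andP[] := h' y.
- by apply: (ratio_ge1 (b_pos j.+1)) => y; have /andP[] := h' y.
- by rewrite nN' (exprS (1 - k ^+ 2)) [leRHS]mulrCA ler_wpM2l// subr_ge0.
Qed.

(** Existence of bounded potentials a = e^(eta f), b = e^(eta g) solving the
    Schrodinger system everywhere, for a kernel bounded away from 0. *)
Lemma sinkhorn_fixpoint : exists a b, [/\ positive_mfun a, positive_mfun b,
  forall x, a x * \int[nu]_y (K (x, y) * b y) = 1 &
  forall y, b y * \int[mu]_x (K (x, y) * a x) = 1].
Proof.
have [m0 [D [m00 D0 H]]] := ratio_bounds.
have k21 : k ^+ 2 <= 1 by rewrite exprn_ile1// ltW.
have k20 : 0 < k ^+ 2 by rewrite exprn_gt0.
set r := 1 - k ^+ 2 in H.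
have r0 : 0 <= r by rewrite subr_ge0.
have r1 : r < 1 by rewrite /r; lra.
pose C := D / m0; have C0 : 0 <= C by rewrite divr_ge0// ltW.
have bj0 j y : 0 < b_ j y by exact: (positive_mfun_gt0 (b_pos j)).
have step j y : `|ln (b_ j.+1 y) - ln (b_ j y)| <= C * r ^+ j.
  have [m [M [m0m m1 M1 mMD h]]] := H j.
  have m0' : 0 < m by exact: lt_le_trans m0m.
  have M0' : 0 < M by exact: lt_le_trans M1.
  have DC : M - m <= C * r ^+ j * m0.
    by rewrite /C mulrAC divfK// gt_eqF.
  have Cr : 0 <= C * r ^+ j by rewrite mulr_ge0// exprn_ge0.
  have m01 : m0 <= 1 by exact: le_trans m1.
  have /andP[h1 h2] := h y.
  have l1 : ln m + ln (b_ j y) <= ln (b_ j.+1 y).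
    by rewrite -lnM ?posrE// ler_ln ?posrE// mulr_gt0.
  have l2 : ln (b_ j.+1 y) <= ln M + ln (b_ j y).
    by rewrite -lnM ?posrE// ler_ln ?posrE// mulr_gt0.
  have l3 : ln M <= M - 1.
    by have := @le_ln1Dx R (M - 1); rewrite (addrC 1) subrK; apply; lra.
  have l4 : - ln m <= m^-1 - 1.
    rewrite -lnV ?posrE//; have := @le_ln1Dx R (m^-1 - 1).
    by rewrite (addrC 1) subrK; apply; have : 0 < m^-1 by [rewrite invr_gt0]; lra.
  have l5 : m^-1 - 1 <= C * r ^+ j.
    rewrite -(ler_pM2r m0') mulrBl mulVf ?gt_eqF// mul1r.
    apply: (@le_trans _ _ (M - m)); first by rewrite lerD2r.
    by apply: (le_trans DC); rewrite ler_wpM2l.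
  have l6 : M - 1 <= C * r ^+ j.
    apply: (@le_trans _ _ (M - m)); first by rewrite lerD2l lerN2.
    by apply: (le_trans DC); rewrite ler_piMr.
  by rewrite ler_norml; apply/andP; split; lra.
have lim y : {l | forall j, `|l - ln (b_ j y)| <= C / (1 - r) * r ^+ j}.
  apply: cid; apply: (geometric_cauchy_limit (u := fun j => ln (b_ j y))) => //.
  by rewrite r0.
pose u y := sval (lim y).
have uE y j : `|u y - ln (b_ j y)| <= C / (1 - r) * r ^+ j by exact: (svalP (lim y)).
set E := C / (1 - r) in uE.
have E0 : 0 <= E by rewrite divr_ge0// subr_ge0 ltW.
have Ecvg : E * r ^+ j @[j --> \oo] --> 0.
  by rewrite -[X in _ --> X](mulr0 E); apply: cvgMr; apply: cvg_expr; rewrite ger0_norm.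
have mu' : measurable_fun setT u.
  apply: (@measurable_fun_cvg _ _ _ _ (fun j y => ln (b_ j y))).
    by move=> j; apply: measurableT_comp => //; have [] := b_pos j.
  move=> y _; apply/cvgrPdist_lt => e e0.
  have /cvgrPdist_lt /(_ e e0) := Ecvg; apply: filterS => j.
  rewrite sub0r normrN => h; apply: le_lt_trans h.
  by rewrite (le_trans (uE y j))// ler_norm.
pose b y := expR (u y).
have b_lo j y : expR (- (E * r ^+ j)) * b_ j y <= b y.
  have -> : b_ j y = expR (ln (b_ j y)) by rewrite lnK// posrE.
  by rewrite -expRD ler_expR; have := uE y j; rewrite ler_norml; lra.
have b_up j y : expR (- (E * r ^+ j)) * b y <= b_ j y.
  have -> : b_ j y = expR (ln (b_ j y)) by rewrite lnK// posrE.
  by rewrite -expRD ler_expR; have := uE y j; rewrite ler_norml; lra.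
have pb : positive_mfun b.
  split; first exact: measurableT_comp.
  exists (expR (- E)), (expR E); split; first exact: expR_gt0.
  move=> y; have := uE y 0%N; rewrite /b_ /= ln1 subr0 expr0 mulr1 ler_norml.
  by rewrite !ler_expR.
have pa := A_pos pb.
have fixb y : B (A b) y = b y.
  pose v := ln (B (A b) y).
  have BA0 : 0 < B (A b) y by exact: (positive_mfun_gt0 (B_pos pa)).
  have close j : `|v - u y| <= 2 * (E * r ^+ j).
    have e0 := expR_gt0 (- (E * r ^+ j)).
    have a1 := half_step_antitone nu k0 mK K1 e0 (b_pos j) pb (b_lo j).
    have a2 := half_step_antitone nu k0 mK K1 e0 pb (b_pos j) (b_up j).
    have c1 := half_step_antitone mu k0 mK' K'1 e0 pa (A_pos (b_pos j)) a1.
    have c2 := half_step_antitone mu k0 mK' K'1 e0 (A_pos (b_pos j)) pa a2.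
    have {}c1 := ln_expRM_le (bj0 j.+1 y) BA0 (c1 y).
    have {}c2 := ln_expRM_le BA0 (bj0 j.+1 y) (c2 y).
    rewrite -/v in c1 c2.
    have := uE y j.+1; rewrite ler_norml exprS => /andP[d1' d2'].
    have Er : E * (r * r ^+ j) <= E * r ^+ j.
      by rewrite ler_wpM2l// ler_piMl ?exprn_ge0// ltW.
    by rewrite ler_norml; apply/andP; split; lra.
  have : v - u y = 0.
    apply/eqP; rewrite -normr_le0; apply/ler_addgt0Pl => e e0; rewrite addr0.
    have e20 : 0 < e / 2 by rewrite divr_gt0.
    have /cvgrPdist_lt /(_ _ e20) [N _ /(_ N (leqnn N))] := Ecvg.
    rewrite /= sub0r normrN => h; apply: (le_trans (close N)).
    by have := ler_norm (E * r ^+ N); lra.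
  by move/eqP; rewrite subr_eq0 => /eqP; rewrite /b => <-; rewrite /v lnK// posrE.
exists (A b), b; split => //.
- by move=> x; exact: (half_step_int nu k0).
move=> y; rewrite -{1}fixb.
exact: (half_step_int mu k0 mK' K'1 y pa).
Qed.

(** The density of the Schrodinger coupling is bounded above and below by
    constants depending on the lower bound k of the kernel only. *)
Lemma sinkhorn_density_bounds a b : positive_mfun a -> positive_mfun b ->
  (forall x, a x * \int[nu]_y (K (x, y) * b y) = 1) ->
  (forall y, b y * \int[mu]_x (K (x, y) * a x) = 1) ->
  forall z, k ^+ 2 <= a z.1 * K z * b z.2 <= (k ^+ 2)^-1.
Proof.
move=> pa pb ab ba [x y] /=.
have a0 := positive_mfun_gt0 pa; have b0 := positive_mfun_gt0 pb.
have bE : b = B a.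
  apply/funext => y'; rewrite /B /half_step -[LHS]mulr1.
  rewrite -(@mulfV _ (\int[mu]_x0 (K (x0, y') * a x0))); last first.
    by apply: contra_eq_neq (ba y') => ->; rewrite mulr0 eq_sym oner_neq0.
  by rewrite mulrA ba mul1r.
have osc y1 y2 : k * b y1 <= b y2 by rewrite bE; exact: half_step_osc.
have /andP[Kl Ku] := K1 (x, y).
have bK := kernel_mul_section_bounded k0 mK K1 x pb.
have ax := a0 x; have byy := b0 y.
have up : \int[nu]_y (K (x, y) * b y) <= k^-1 * b y.
  rewrite -[leRHS](prob_Rintegral_cst nu); apply: le_prob_Rintegral => //.
    exact: bounded_mfun_cst.
  move=> y'; rewrite ler_pdivlMl//; apply: le_trans (osc y' y).
  rewrite ler_wpM2l ?(ltW k0)// ler_piMl ?(ltW (b0 _))//.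
  by have /andP[] := K1 (x, y').
have lo : k * (k * b y) <= \int[nu]_y (K (x, y) * b y).
  rewrite -[leLHS](prob_Rintegral_cst nu); apply: le_prob_Rintegral => //.
    exact: bounded_mfun_cst.
  move=> y'; rewrite ler_pM ?mulr_ge0 ?(ltW k0) ?(ltW byy)//.
  by have /andP[] := K1 (x, y').
have {}up : k <= a x * b y.
  have := ler_wpM2l (ltW ax) up; rewrite ab mulrCA.
  by rewrite ler_pdivlMl// mulr1.
have {}lo : a x * b y <= (k ^+ 2)^-1.
  have := ler_wpM2l (ltW ax) lo; rewrite ab => h.
  rewrite -[leRHS]mulr1 ler_pdivlMl ?exprn_gt0//; apply: le_trans h.
  by rewrite expr2 -!mulrA [a x * (k * _)]mulrCA [k * (a x * _)]mulrCA mulrCA lexx.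
rewrite mulrAC; apply/andP; split.
  by rewrite expr2 ler_pM// ltW.
by apply: le_trans lo; rewrite ler_piMr// mulr_ge0// ltW.
Qed.

End sinkhorn.

(** * Relative entropy *)

Section density_law.
Context d (T : measurableType d) (R : realType) (Q : probability T R).
Variable p : T -> R.
Hypotheses (p0 : forall x, 0 <= p x) (mp : measurable_fun setT p).
Hypothesis p1 : (\int[Q]_x (p x)%:E = 1)%E.
Local Open Scope ereal_scope.

(** The law with density p with respect to Q; the three facts that make it a
    probability are arguments. *)
Definition density_law of (forall x, (0 <= p x)%R) & measurable_fun setT p &
  \int[Q]_x (p x)%:E = 1 := fun B => \int[Q]_(x in B) (p x)%:E.

Local Notation D := (density_law p0 mp p1).

Let density0 : D set0 = 0. Proof. exact: integral_set0. Qed.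

Let density_ge0 B : 0 <= D B.
Proof. by apply: integral_ge0 => x _; rewrite lee_fin. Qed.

Let density_sigma_additive : semi_sigma_additive D.
Proof.
move=> F mF tF mUF; rewrite /density_law ge0_integral_bigcup//.
- apply: is_cvg_ereal_nneg_natsum_cond => n _ _.
  by apply: integral_ge0 => x _; rewrite lee_fin.
- by apply: measurable_funTS; exact/measurable_EFinP.
- by move=> x _; rewrite lee_fin.
Qed.

HB.instance Definition _ := isMeasure.Build _ _ _ D
  density0 density_ge0 density_sigma_additive.

Let density_setT : D setT = 1. Proof. exact: p1. Qed.

HB.instance Definition _ := Measure_isProbability.Build _ _ _ D density_setT.

End density_law.

Section relative_entropy.
Context d (T : measurableType d) (R : realType).
Local Open Scope ereal_scope.

Let measurable_lne_comp (f : T -> \bar R) : (forall x, f x \is a fin_num) ->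
  measurable_fun setT f -> measurable_fun setT (@lne R \o f).
Proof.
move=> ffin mf; have mr : measurable_fun setT (fine \o f).
  exact: measurableT_comp.
rewrite (_ : @lne R \o f = fun x => if (fine (f x) <= 0)%R then -oo
    else (ln (fine (f x)))%:E); last first.
  by apply/funext => x /=; rewrite -{1}(fineK (ffin x)).
apply: measurable_fun_ifT => //.
  by apply: measurable_fun_ler => //; exact: mr.
by apply/measurable_EFinP; exact: measurableT_comp.
Qed.

Lemma KL_density_law (Q : probability T R) (p : T -> R)
    (p0 : forall x, (0 <= p x)%R) (mp : measurable_fun setT p)
    (p1 : \int[Q]_x (p x)%:E = 1) : (forall x, 0 < p x)%R ->
  KL (density_law p0 mp p1) Q = \int[density_law p0 mp p1]_x (ln (p x))%:E.
Proof.
move=> pgt0; set D := density_law p0 mp p1.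
have DQ : D `<< Q.
  apply/null_content_dominatesP => A mA QA.
  rewrite /D /= /density_law null_set_integral//.
  by apply: measurable_funTS; exact/measurable_EFinP.
rewrite /KL; case: asboolP => // _.
have mEp : measurable_fun setT (EFin \o p) by exact/measurable_EFinP.
have ip : Q.-integrable setT (EFin \o p).
  apply/integrableP; split => //.
  under eq_integral do rewrite gee0_abs ?lee_fin//.
  by rewrite p1 ltry.
have rn : ae_eq Q setT (Radon_Nikodym (charge_of_finite_measure D) Q)
    (EFin \o p).
  apply: integral_ae_eq => //.
    exact: Radon_Nikodym_integrable.
  by move=> A _ mA; rewrite -Radon_Nikodym_integral.
have rnD := null_dominates_ae_eq measurableT DQ rn.
apply: ae_eq_integral => //.
- apply: measurable_lne_comp; first by move=> x; exact: Radon_Nikodym_fin_num.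
  by apply: measurable_int; exact: Radon_Nikodym_integrable.
- by apply/measurable_EFinP; exact: measurableT_comp.
- move: rnD; apply: filterS => x /(_ Logic.I) /= -> _.
  by rewrite lne_EFin.
Qed.

(** Equality case of the Gibbs inequality int ln p dP <= KL(P | Q): with r the
    density of P and v = ln p - ln r, the inequalities int e^v dP <= 1 and
    int v dP >= 0 force e^v - 1 - v to vanish P-almost everywhere, so that
    P = p Q. *)
Lemma KL_le_density (P Q : probability T R) (p : T -> R) :
  positive_mfun p -> \int[Q]_x (p x)%:E = 1 ->
  KL P Q <= \int[P]_x (ln (p x))%:E ->
  forall B, measurable B -> P B = \int[Q]_(x in B) (p x)%:E.
Proof.
move=> pp p1; have p0 := positive_mfun_gt0 pp.
have [mp [m [M [m0 pM]]]] := pp.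
have bln := positive_mfun_ln pp.
have iln := bounded_mfun_integrable P bln.
rewrite /KL; case: asboolP => [PQ|_]; last first.
  by rewrite Rintegral_EFin// leye_eq.
pose f := Radon_Nikodym_SigmaFinite.f P Q.
have f0 x : 0 <= f x by exact: Radon_Nikodym_SigmaFinite.f_ge0.
have ffin x : f x \is a fin_num by exact: Radon_Nikodym_SigmaFinite.f_fin_num.
have fint : Q.-integrable setT f by exact: Radon_Nikodym_SigmaFinite.f_integrable.
have mf : measurable_fun setT f by exact: measurable_int fint.
pose r x := fine (f x).
have rE x : f x = (r x)%:E by rewrite /r fineK.
have mr : measurable_fun setT r.
  apply/measurable_EFinP; rewrite (_ : EFin \o r = f)//.
  by apply/funext => x; rewrite /= -rE.
have r0 x : (0 <= r x)%R by rewrite -lee_fin -rE.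
have PE A : measurable A -> P A = \int[Q]_(x in A) (r x)%:E.
  move=> mA; rewrite (Radon_Nikodym_SigmaFinite.f_integral PQ mA).
  by apply: eq_integral => x _; rewrite -rE.
have rpos : {ae P, forall x, (0 < r x)%R}.
  have mA : measurable (r @^-1` [set 0%R]).
    by rewrite -[X in measurable X]setTI; exact: mr.
  exists (r @^-1` [set 0%R]); split => //.
    by rewrite PE// integral0_eq// => x /= ->.
  by move=> x /= /negP; rewrite -leNgt => rx; apply/eqP; rewrite eq_le rx r0.
pose g x := ln (r x).
have mg : measurable_fun setT g by exact: measurableT_comp.
have -> : \int[P]_x lne (Radon_Nikodym (charge_of_finite_measure P) Q x) =
    \int[P]_x (g x)%:E.
  apply: ae_eq_integral => //.
  - apply: measurable_lne_comp; first by move=> x; exact: Radon_Nikodym_fin_num.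
    by apply: measurable_int; exact: Radon_Nikodym_integrable.
  - exact/measurable_EFinP.
  have := null_dominates_ae_eq measurableT PQ
    (ae_eq_Radon_Nikodym_SigmaFinite PQ measurableT).
  move: rpos; apply: filterS2 => x rx /(_ Logic.I) <- _.
  by rewrite -/f rE lne_EFin.
move=> gL.
pose v x := (ln (p x) - g x)%R.
have mv : measurable_fun setT v.
  by apply: measurable_funB => //; exact: measurableT_comp.
have mev : measurable_fun setT (fun x => expR (v x)) by exact: measurableT_comp.
have ev : \int[P]_x (expR (v x))%:E <= 1.
  rewrite -(Radon_Nikodym_SigmaFinite.change_of_variables PQ)//; last first.
    exact/measurable_EFinP.
  rewrite -p1; apply: ge0_le_integral => //.
  - by move=> x _; rewrite mule_ge0// lee_fin expR_ge0.
  - by apply: emeasurable_funM => //; exact/measurable_EFinP.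
  - exact/measurable_EFinP.
  move=> x _; rewrite -/(f x) rE -EFinM lee_fin /v /g.
  have [rx|] := ltP 0%R (r x).
    by rewrite expRB !lnK ?posrE// divfK// gt_eqF.
  move=> rx; have -> : r x = 0%R by apply/eqP; rewrite eq_le rx r0.
  by rewrite mulr0 ltW.
have iev : P.-integrable setT (fun x => (expR (v x))%:E).
  apply/integrableP; split; first exact/measurable_EFinP.
  under eq_integral do rewrite gee0_abs ?lee_fin ?expR_ge0//.
  by rewrite (le_lt_trans ev)// ltry.
(* the negative part of ln r is dominated by the integrable e^v / m *)
have gneg : \int[P]_x (EFin \o g)^\- x < +oo.
  apply: (@le_lt_trans _ _ (\int[P]_x ((m^-1)%:E * (expR (v x))%:E))).
    apply: ge0_le_integral => //.
    - by apply: measurable_funeneg; exact/measurable_EFinP.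
    - by apply: measurable_funeM; exact/measurable_EFinP.
    move=> x _; rewrite funenegE ge_max; apply/andP; split; last first.
      by rewrite -EFinM lee_fin mulr_ge0 ?expR_ge0// invr_ge0 ltW.
    rewrite -EFinM lee_fin ler_pdivlMl//=.
    rewrite /v expRD lnK ?posrE//.
    have h := expR_ge1Dx (- g x); have /andP[h1 _] := pM x.
    have h3 := expR_ge0 (- g x).
    apply: (@le_trans _ _ (m * expR (- g x))%R).
      by rewrite ler_wpM2l ?ltW//; lra.
    by rewrite ler_wpM2r.
  rewrite ge0_integralZl//.
  - apply: lte_mul_pinfty => //; first by rewrite lee_fin invr_ge0 ltW.
    by rewrite (le_lt_trans ev)// ltry.
  - exact/measurable_EFinP.
  - by rewrite lee_fin invr_ge0 ltW.
have ig : P.-integrable setT (EFin \o g).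
  apply/integrableP; split; first exact/measurable_EFinP.
  under eq_integral do rewrite -[`|_|]/((abse \o (EFin \o g)) _) fune_abse.
  rewrite ge0_integralD//; last 2 first.
  - by apply: measurable_funepos; exact/measurable_EFinP.
  - by apply: measurable_funeneg; exact/measurable_EFinP.
  rewrite lte_add_pinfty//.
  rewrite ltNge leye_eq; apply/negP => /eqP gy.
  move: gL; rewrite integralE gy Rintegral_EFin//.
  have : \int[P]_x (EFin \o g)^\- x \is a fin_num.
    by rewrite ge0_fin_numE//; apply: integral_ge0.
  by move=> /fineK <-; rewrite leye_eq.
have phi0 x : (0 <= expR (v x) - 1 - v x)%R.
  by have := expR_ge1Dx (v x); lra.
have iv : P.-integrable setT (EFin \o v).
  rewrite (_ : EFin \o v = (EFin \o (@ln R \o p)) \- (EFin \o g)).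
    exact: integrableB.
  by apply/funext => x.
have ic : P.-integrable setT (EFin \o (fun=> 1%R) : T -> \bar R).
  exact: (bounded_mfun_integrable P (bounded_mfun_cst _ 1%R)).
have iev1 : P.-integrable setT (EFin \o (fun x => expR (v x) - 1)%R).
  rewrite (_ : EFin \o _ = (EFin \o (fun x => expR (v x))) \- (EFin \o (fun=> 1%R))).
    exact: integrableB.
  by apply/funext => x.
have mphi : measurable_fun setT (fun x => (expR (v x) - 1 - v x)%:E).
  by apply/measurable_EFinP; apply: measurable_funB => //; exact: measurable_funB.
have phi_eq0 : \int[P]_x `|(expR (v x) - 1 - v x)%:E| = 0.
  under eq_integral do rewrite gee0_abs ?lee_fin//.
  apply/eqP; rewrite eq_le; apply/andP; split; last first.
    by apply: integral_ge0 => x _; rewrite lee_fin.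
  under eq_integral do rewrite EFinB.
  rewrite integralB_EFin//.
  under eq_integral do rewrite EFinB.
  rewrite integralB_EFin//.
  under [X in _ - X]eq_integral do rewrite EFinB.
  rewrite integralB_EFin// integral_cst//= probability_setT mule1.
  move: ev gL.
  rewrite -(fineK (integrable_fin_num measurableT iev)).
  rewrite -(fineK (integrable_fin_num measurableT ig)).
  rewrite -(fineK (integrable_fin_num measurableT iln)).
  by rewrite -!EFinB !lee_fin; lra.
have v0 : ae_eq P setT (fun x => (expR (v x) - 1 - v x)%:E) (cst 0).
  exact/(ae_eq_integral_abs P measurableT mphi).
have rp : {ae P, forall x, r x = p x}.
  move: v0 rpos; apply: filterS2 => x /(_ Logic.I) h rx.
  have vx : (expR (v x) - 1 - v x = 0)%R by apply: EFin_inj; exact: h.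
  have [vx0|vx0] := eqVneq (v x) 0%R.
    move: vx0; rewrite /v /g => /eqP; rewrite subr_eq0 => /eqP.
    by move=> pr; apply/esym/(@ln_inj R); rewrite ?posrE.
  by have := expR_gt1Dx vx0; lra.
pose D : probability T R := density_law (fun x => ltW (p0 x)) mp p1.
have [N [mN PN0 rN]] := rp.
(* P is below p Q on every event, hence equal to it since both have mass 1 *)
have PD B : measurable B -> P B <= D B.
  move=> mB; have mBN : measurable (B `\` N) by exact: measurableD.
  apply: (@le_trans _ _ (P (B `\` N))).
    apply: (@le_trans _ _ (P ((B `\` N) `|` N))).
      apply: le_measure; rewrite ?inE//; first exact: measurableU.
      by move=> x Bx; have [|Nx] := pselect (N x); [right|left].
    by rewrite -[leRHS]adde0 -PN0 measureU2.
  rewrite PE//; apply: (@le_trans _ _ (D (B `\` N))).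
    rewrite le_eqVlt; apply/orP; left; apply/eqP.
    apply: eq_integral => x /[!inE] -[_ Nx]; congr EFin.
    by apply: contrapT => rx; apply: Nx; exact: rN.
  by apply: le_measure; rewrite ?inE//; exact: subDsetl.
move=> B mB; apply/eqP; rewrite eq_le; apply/andP; split; first exact: PD.
have := PD _ (measurableC mB).
rewrite (probability_setC P mB) (probability_setC D mB).
have fP : P B \is a fin_num by exact: fin_num_measure.
have fD : D B \is a fin_num by exact: fin_num_measure.
rewrite (_ : \int[Q]_(x in B) (p x)%:E = D B)//.
rewrite -(fineK fP) -(fineK fD) -!EFinB !lee_fin; lra.
Qed.

End relative_entropy.

(** * The density of the Schrodinger coupling *)

Section squared_distance.
Context {R : realType} {d : nat}.
Local Notation E := (d.-tuple R).

Lemma enorm_sqr (x : E) : enorm x ^+ 2 = \sum_(i < d) tnth x i ^+ 2.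
Proof. by rewrite sqr_sqrtr// sumr_ge0// => i _; exact: sqr_ge0. Qed.

Lemma qcostE (x y : E) : qcost x y = \sum_(i < d) (tnth x i - tnth y i) ^+ 2.
Proof.
by rewrite /qcost enorm_sqr; apply: eq_bigr => i _; rewrite tnth_mktuple.
Qed.

Lemma qcost_ge0 (x y : E) : 0 <= qcost x y.
Proof. exact: sqr_ge0. Qed.

(** The ball of radius 1/2 has diameter 1. *)
Lemma qcost_le1 (x y : E) : enorm x <= 2^-1 -> enorm y <= 2^-1 ->
  qcost x y <= 1.
Proof.
have sq (z : E) : enorm z <= 2^-1 -> \sum_(i < d) tnth z i ^+ 2 <= 4^-1.
  move=> z2; rewrite -enorm_sqr (_ : 4^-1 = 2^-1 ^+ 2 :> R); last by field.
  by rewrite lerXn2r ?nnegrE ?sqrtr_ge0// invr_ge0.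
move=> /sq hx /sq hy; rewrite qcostE.
apply: (@le_trans _ _ (\sum_(i < d) (2 * tnth x i ^+ 2 + 2 * tnth y i ^+ 2))).
  apply: ler_sum => i _; have := sqr_ge0 (tnth x i + tnth y i).
  by rewrite sqrrD sqrrB; lra.
by rewrite big_split /= -!mulr_sumr; lra.
Qed.

Lemma measurable_qcost : measurable_fun setT (fun z : E * E => qcost z.1 z.2).
Proof.
rewrite (_ : (fun z => _) =
    fun z : E * E => \sum_(i < d) (tnth z.1 i - tnth z.2 i) ^+ 2); last first.
  by apply/funext => z; rewrite qcostE.
apply: measurable_sum => i; apply: measurable_funX; apply: measurable_funB.
  exact: (measurableT_comp (measurable_tnth i) measurable_fst).
exact: (measurableT_comp (measurable_tnth i) measurable_snd).
Qed.

(** The cost, truncated at its maximum over the supports: this changes nothing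
    almost everywhere and makes the Gibbs kernel bounded below everywhere. *)
Definition tcost (z : E * E) : R := Num.min (qcost z.1 z.2) 1.

Lemma tcostE (z : E * E) : enorm z.1 <= 2^-1 -> enorm z.2 <= 2^-1 ->
  tcost z = qcost z.1 z.2.
Proof. by move=> h1 h2; rewrite /tcost min_l// qcost_le1. Qed.

Lemma tcost_bounds z : 0 <= tcost z <= 1.
Proof. by rewrite /tcost le_min qcost_ge0 ler01 ge_min lexx orbT. Qed.

Lemma measurable_tcost : measurable_fun setT tcost.
Proof. by apply: measurable_minr => //; exact: measurable_qcost. Qed.

Lemma bounded_tcost : bounded_mfun tcost.
Proof.
split; first exact: measurable_tcost.
by exists 1 => z; have /andP[h1 h2] := tcost_bounds z; rewrite ger0_norm.
Qed.

(** The kernel e^(- eta c) of the truncated cost. *)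
Definition gibbs_kernel (eta : R) (z : E * E) : R := expR (- eta * tcost z).

Lemma measurable_gibbs_kernel eta : measurable_fun setT (gibbs_kernel eta).
Proof.
apply: measurableT_comp => //; apply: measurable_funM => //.
exact: measurable_tcost.
Qed.

Lemma gibbs_kernel_bounds eta z : 0 < eta ->
  expR (- eta) <= gibbs_kernel eta z <= 1.
Proof.
move=> e0; have /andP[h1 h2] := tcost_bounds z.
rewrite ler_expR expR_le1 !mulNr lerN2 oppr_le0 mulr_ge0 ?(ltW e0)// andbT.
by rewrite ler_piMr// ltW.
Qed.

End squared_distance.

Section couplings.
Context d1 (T1 : measurableType d1) d2 (T2 : measurableType d2) (R : realType).
Variables (mu : probability T1 R) (nu : probability T2 R).
Variable pi : probability (T1 * T2)%type R.
Hypothesis cpl : coupling mu nu pi.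

Lemma coupling_Rintegral1 (F : T1 -> R) : bounded_mfun F ->
  \int[pi]_z F z.1 = \int[mu]_x F x.
Proof.
move=> bF; have [mF _] := bF.
rewrite /Rintegral; congr fine.
have := @integral_pushforward _ _ _ _ R fst measurable_fst pi setT (EFin \o F).
rewrite preimage_setT => <-//.
- by apply: eq_measure_integral => A mA _; exact: cpl.1.
- exact/measurable_EFinP.
- exact: (bounded_mfun_integrable pi (bounded_mfun_comp measurable_fst bF)).
Qed.

Lemma coupling_Rintegral2 (F : T2 -> R) : bounded_mfun F ->
  \int[pi]_z F z.2 = \int[nu]_y F y.
Proof.
move=> bF; have [mF _] := bF.
rewrite /Rintegral; congr fine.
have := @integral_pushforward _ _ _ _ R snd measurable_snd pi setT (EFin \o F).
rewrite preimage_setT => <-//.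
- by apply: eq_measure_integral => A mA _; exact: cpl.2.
- exact/measurable_EFinP.
- exact: (bounded_mfun_integrable pi (bounded_mfun_comp measurable_snd bF)).
Qed.

Lemma coupling_ae1 (S : T1 -> Prop) :
  {ae mu, forall x, S x} -> {ae pi, forall z, S z.1}.
Proof.
move=> [N [mN N0 SN]]; exists (fst @^-1` N); split.
- by have := @measurable_fst _ _ T1 T2 measurableT _ mN; rewrite setTI.
- by rewrite -[RHS]N0; exact: cpl.1.
- by move=> z /= /SN.
Qed.

Lemma coupling_ae2 (S : T2 -> Prop) :
  {ae nu, forall y, S y} -> {ae pi, forall z, S z.2}.
Proof.
move=> [N [mN N0 SN]]; exists (snd @^-1` N); split.
- by have := @measurable_snd _ _ T1 T2 measurableT _ mN; rewrite setTI.
- by rewrite -[RHS]N0; exact: cpl.2.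
- by move=> z /= /SN.
Qed.

End couplings.

Section schrodinger.
Context {R : realType} {d : nat}.
Local Notation E := (d.-tuple R).
Variables (eta : R) (mu nu : probability E R).
Hypothesis eta0 : 0 < eta.
Hypothesis mu_bounded : {ae mu, forall x, enorm x <= 2^-1}.
Hypothesis nu_bounded : {ae nu, forall y, enorm y <= 2^-1}.
Variables (a b : E -> R).
Hypotheses (pa : positive_mfun a) (pb : positive_mfun b).
Hypothesis aE : forall x,
  a x * \int[nu]_y (gibbs_kernel eta (x, y) * b y) = 1.
Hypothesis bE : forall y,
  b y * \int[mu]_x (gibbs_kernel eta (x, y) * a x) = 1.

(** The density given by exponentials a, b of potentials; aE and bE say that
    its marginals are mu and nu. *)
Definition schrodinger_density (z : E * E) : R :=
  a z.1 * gibbs_kernel eta z * b z.2.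

Local Notation p := schrodinger_density.
Local Notation Q := (product_probability mu nu).

Let pK : positive_mfun (gibbs_kernel eta : E * E -> R).
Proof.
split; first exact: measurable_gibbs_kernel.
exists (expR (- eta)), 1; split; first exact: expR_gt0.
by move=> z; exact: gibbs_kernel_bounds.
Qed.

Lemma schrodinger_density_positive : positive_mfun p.
Proof.
apply: positive_mfunM; first (apply: positive_mfunM => //).
- have [ma [m [M [m0 aM]]]] := pa; split; last by exists m, M; split.
  exact: (measurableT_comp ma measurable_fst).
- have [mb [m [M [m0 bM]]]] := pb; split; last by exists m, M; split.
  exact: (measurableT_comp mb measurable_snd).
Qed.

Let pp := schrodinger_density_positive.
Let bp := positive_mfun_bounded pp.
Let p0 z : 0 <= p z. Proof. exact/ltW/positive_mfun_gt0. Qed.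
Let mp : measurable_fun setT p. Proof. by have [] := pp. Qed.

Lemma schrodinger_density_int1 x : \int[nu]_y p (x, y) = 1.
Proof.
rewrite -[RHS](aE x) -prob_RintegralZl.
  by apply: eq_Rintegral => y _; rewrite /p /= mulrA.
exact: (kernel_mul_section_bounded (expR_gt0 (- eta))
  (@measurable_gibbs_kernel R d eta) (fun z => gibbs_kernel_bounds z eta0)).
Qed.

Lemma schrodinger_density_int2 y : \int[mu]_x p (x, y) = 1.
Proof.
have bb := positive_mfun_bounded pa.
rewrite -[RHS](bE y) -prob_RintegralZl.
  by apply: eq_Rintegral => x _; rewrite /p /=; ring.
apply: bounded_mfunM => //.
exact: (bounded_mfun_pair2 y (positive_mfun_bounded pK)).
Qed.

Let Eint1 x : (\int[nu]_y (p (x, y))%:E = 1)%E.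
Proof.
by rewrite Rintegral_EFin ?schrodinger_density_int1//; exact: bounded_mfun_pair1.
Qed.

Let Eint2 y : (\int[mu]_x (p (x, y))%:E = 1)%E.
Proof.
by rewrite Rintegral_EFin ?schrodinger_density_int2//; exact: bounded_mfun_pair2.
Qed.

Let mEp : measurable_fun setT (EFin \o p). Proof. exact/measurable_EFinP. Qed.
Let Ep0 z : (0 <= (EFin \o p) z)%E. Proof. by rewrite lee_fin. Qed.

Let p1 : (\int[Q]_z (p z)%:E = 1)%E.
Proof.
rewrite (fubini_tonelli1 (EFin \o p))// -[RHS](probability_setT mu).
rewrite -[RHS]mul1e -integral_cst//.
by apply: eq_integral => x _; exact: Eint1.
Qed.

(* the coupling with this density, which turns out to be the minimizer *)
Let pi0 : probability (E * E)%type R := density_law p0 mp p1.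

Let pi0_coupling : coupling mu nu pi0.
Proof.
split => B mB.
  have mB' : measurable (fst @^-1` B : set (E * E)).
    by have := @measurable_fst _ _ E E measurableT _ mB; rewrite setTI.
  rewrite /pi0 /= /density_law integral_mkcond.
  rewrite (fubini_tonelli1 ((EFin \o p) \_ (fst @^-1` B)))/=; last 2 first.
  - by apply: (measurable_restrictT (EFin \o p) mB').1; exact: measurable_funTS.
  - by move=> z; apply: erestrict_ge0 => w _; exact: Ep0.
  transitivity (\int[mu]_(x in B) 1)%E; last by rewrite integral_cst// mul1e.
  rewrite [RHS]integral_mkcond; apply: eq_integral => x _.
  rewrite patchE /fubini_F; case: ifPn => xB.
    rewrite -(Eint1 x); apply: eq_integral => y _.
    by rewrite patchE mem_set//; exact/set_mem.
  rewrite integral0_eq// => y _; rewrite patchE memNset//.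
  by move=> /= Bx; move: xB; rewrite mem_set.
have mB' : measurable (snd @^-1` B : set (E * E)).
  by have := @measurable_snd _ _ E E measurableT _ mB; rewrite setTI.
rewrite /pi0 /= /density_law integral_mkcond.
rewrite (fubini_tonelli2 ((EFin \o p) \_ (snd @^-1` B)))/=; last 2 first.
- by apply: (measurable_restrictT (EFin \o p) mB').1; exact: measurable_funTS.
- by move=> z; apply: erestrict_ge0 => w _; exact: Ep0.
transitivity (\int[nu]_(x in B) 1)%E; last by rewrite integral_cst// mul1e.
rewrite [RHS]integral_mkcond; apply: eq_integral => y _.
rewrite patchE /fubini_G; case: ifPn => yB.
  rewrite -(Eint2 y); apply: eq_integral => x _.
  by rewrite patchE mem_set//; exact/set_mem.
rewrite integral0_eq// => x _; rewrite patchE memNset//.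
by move=> /= By; move: yB; rewrite mem_set.
Qed.

Let ln_density z : ln (p z) = ln (a z.1) + ln (b z.2) - eta * tcost z.
Proof.
have a0 := positive_mfun_gt0 pa; have b0 := positive_mfun_gt0 pb.
rewrite /p !lnM ?posrE ?mulr_gt0 ?expR_gt0// /gibbs_kernel expRK.
by rewrite mulNr addrAC.
Qed.

(* The integral of ln a + ln b against a coupling only depends on the marginals;
   hence the entropic cost of pi0 is S / eta, and a coupling of cost at most
   S / eta has relative entropy at most the integral of ln p. *)
Let S := \int[mu]_x ln (a x) + \int[nu]_y ln (b y).

Let ln_density_int pi : coupling mu nu pi ->
  (\int[pi]_z (ln (p z))%:E = (S - eta * \int[pi]_z tcost z)%:E)%E.
Proof.
move=> cpl; have bla := positive_mfun_ln pa; have blb := positive_mfun_ln pb.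
have bla' : bounded_mfun (fun z : E * E => ln (a z.1)).
  exact: (bounded_mfun_comp measurable_fst bla).
have blb' : bounded_mfun (fun z : E * E => ln (b z.2)).
  exact: (bounded_mfun_comp measurable_snd blb).
have bt := @bounded_tcost R d.
have bet : bounded_mfun (fun z : E * E => eta * tcost z).
  by apply: bounded_mfunM => //; exact: bounded_mfun_cst.
rewrite Rintegral_EFin; last exact: positive_mfun_ln.
congr EFin; rewrite /S -(coupling_Rintegral1 cpl bla).
rewrite -(coupling_Rintegral2 cpl blb) -prob_RintegralD// -prob_RintegralZl//.
rewrite -prob_RintegralB//; last exact: bounded_mfunD.
by apply: eq_Rintegral => z _; rewrite ln_density.
Qed.

Let qcost_int pi : coupling mu nu pi ->
  (\int[pi]_z (qcost z.1 z.2)%:E = (\int[pi]_z tcost z)%:E)%E.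
Proof.
move=> cpl; rewrite -Rintegral_EFin; last exact: bounded_tcost.
apply: ae_eq_integral => //.
- by apply/measurable_EFinP; exact: measurable_qcost.
- by apply/measurable_EFinP; exact: measurable_tcost.
have := coupling_ae2 cpl nu_bounded; have := coupling_ae1 cpl mu_bounded.
by apply: filterS2 => z h1 h2 _; rewrite tcostE.
Qed.

(** The minimizer of the entropic cost has the density p with respect to the
    product measure. *)
Lemma schrodinger_coupling_density pi : schrodinger_coupling eta mu nu pi ->
  forall B, measurable B -> pi B = (\int[Q]_(z in B) (p z)%:E)%E.
Proof.
move=> [cpl min_pi]; apply: KL_le_density => //.
rewrite ln_density_int//.
have := min_pi pi0 pi0_coupling; rewrite /entropic_cost !qcost_int//.
rewrite KL_density_law; last exact: positive_mfun_gt0.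
rewrite ln_density_int//.
set c0 := \int[pi0]_z _; set c := \int[pi]_z _.
rewrite -EFinM -EFinD (_ : c0 + eta^-1 * (S - eta * c0) = eta^-1 * S); last first.
  by field; rewrite gt_eqF.
have eV : 0 < eta^-1 by rewrite invr_gt0.
case: (KL _ _) => [r| |].
- rewrite -EFinM -EFinD !lee_fin => h.
  have := ler_wpM2l (ltW eta0) h; rewrite mulrDr !mulrA mulfV ?gt_eqF// !mul1r.
  lra.
- by rewrite gt0_muley ?lte_fin// addey// leye_eq.
- by rewrite leNye.
Qed.

End schrodinger.

(** * Regression function and excess risk *)

Section density_integral.
Context d1 (T1 : measurableType d1) d2 (T2 : measurableType d2) (R : realType).
Variables (mu : probability T1 R) (nu : probability T2 R).
Variable p : T1 * T2 -> R.
Hypothesis bp : bounded_mfun p.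
Variable pi : probability (T1 * T2)%type R.
Hypothesis piE : forall B, measurable B ->
  pi B = (\int[product_probability mu nu]_(z in B) (p z)%:E)%E.

Lemma density_Rintegral (F : T1 * T2 -> R) : bounded_mfun F ->
  \int[pi]_z F z = \int[mu]_x \int[nu]_y (F (x, y) * p (x, y)).
Proof.
move=> bF; have [mF _] := bF; have [mp _] := bp.
set Q := product_probability mu nu.
have bFp := bounded_mfunM bF bp.
have piQ : pi `<< Q.
  apply/null_content_dominatesP => A mA QA.
  rewrite piE// null_set_integral//.
  by apply: measurable_funTS; exact/measurable_EFinP.
have rn : ae_eq Q setT (Radon_Nikodym (charge_of_finite_measure pi) Q)
    (EFin \o p).
  apply: integral_ae_eq => //.
  - exact: Radon_Nikodym_integrable.
  - exact/measurable_EFinP.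
  by move=> A _ mA; rewrite -Radon_Nikodym_integral// -piE.
apply: EFin_inj; rewrite -Rintegral_EFin//.
rewrite -(Radon_Nikodym_change_of_variables piQ)//; last first.
  exact: bounded_mfun_integrable.
transitivity (\int[Q]_z (EFin \o (fun z => F z * p z)%R) z)%E.
  apply: ae_eq_integral => //.
  - apply: emeasurable_funM; first exact/measurable_EFinP.
    by apply: measurable_int; exact: Radon_Nikodym_integrable.
  - by apply/measurable_EFinP; exact: measurable_funM.
  by move: rn; apply: filterS => z /(_ Logic.I) /= -> _; rewrite EFinM.
rewrite -(integral12_prod_meas1 (bounded_mfun_prod_integrable nu mu bFp)).
rewrite -Rintegral_EFin; last exact: (bounded_mfun_Rintegral nu bFp).
apply: eq_integral => x _; rewrite /fubini_F /=.
by rewrite Rintegral_EFin//; exact: (bounded_mfun_pair1 x bFp).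
Qed.

End density_integral.

Section regression.
Context {R : realType} {d : nat}.
Local Notation E := (d.-tuple R).
Variables (mu nu : probability E R) (pi : probability (E * E)%type R).
Variable p : E * E -> R.
Hypothesis pp : positive_mfun p.
Hypothesis piE : forall B, measurable B ->
  pi B = (\int[product_probability mu nu]_(z in B) (p z)%:E)%E.
Hypothesis p1 : forall x, \int[nu]_y p (x, y) = 1.
Variable q : R.-pker E ~> bool.

(** The conditional probability of the label 1. *)
Definition label_prob (y : E) : R := fine (q y [set true]).

Lemma label_probE y : q y [set true] = (label_prob y)%:E.
Proof.
rewrite /label_prob fineK// ge0_fin_numE//.
apply: (@le_lt_trans _ _ (q y setT)); first by apply: le_measure; rewrite ?inE.
by rewrite prob_kernel ltry.
Qed.

Lemma label_prob_false y : q y [set false] = (1 - label_prob y)%:E.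
Proof.
have h : q y setT = (q y [set true] + q y [set false])%E.
  rewrite -measureU//; last first.
    by apply/seteqP; split => // -[]; [case=> _|case].
  by congr (q y _); apply/seteqP; split => // -[] _; [left|right].
move: h; rewrite prob_kernel label_probE EFinB => ->.
by rewrite addeAC subee// add0e.
Qed.

Lemma label_prob_bounds y : 0 <= label_prob y <= 1.
Proof.
rewrite fine_ge0//= -subr_ge0 -lee_fin -label_prob_false.
exact: measure_ge0.
Qed.

Lemma bounded_label_prob : bounded_mfun label_prob.
Proof.
split.
  apply: (@measurableT_comp _ _ _ _ _ _ fine) => //.
  exact: measurable_kernel.
by exists 1 => y; have /andP[h1 h2] := label_prob_bounds y; rewrite ger0_norm.
Qed.

(** The regression function E[A | X = x], given pointwise by the density p of
    the coupling: E[A | X = x] = int q(1 | y) p(x, y) dnu(y). *)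
Definition regression (x : E) : R := \int[nu]_y (label_prob y * p (x, y)).

Let bql : bounded_mfun (fun z : E * E => label_prob z.2).
Proof. exact: (bounded_mfun_comp measurable_snd bounded_label_prob). Qed.

Let bp := positive_mfun_bounded pp.

Lemma bounded_regression : bounded_mfun regression.
Proof.
exact: (bounded_mfun_Rintegral nu (bounded_mfunM bql bp)).
Qed.

Lemma regression_bounds x : 0 <= regression x <= 1.
Proof.
have p0 := positive_mfun_gt0 pp.
rewrite /regression; apply/andP; split.
  apply: Rintegral_ge0 => y _; rewrite mulr_ge0 ?(ltW (p0 _))//.
  by have /andP[] := label_prob_bounds y.
rewrite -(p1 x); apply: le_prob_Rintegral.
- exact: (bounded_mfun_pair1 x (bounded_mfunM bql bp)).
- exact: (bounded_mfun_pair1 x bp).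
move=> y; rewrite ler_piMl ?(ltW (p0 _))//.
by have /andP[] := label_prob_bounds y.
Qed.

Lemma coupling_regression (phi psi : E -> R) :
  bounded_mfun phi -> bounded_mfun psi ->
  \int[pi]_z (phi z.1 + psi z.1 * label_prob z.2) =
  \int[mu]_x (phi x + psi x * regression x).
Proof.
move=> bphi bpsi.
have bphi' : bounded_mfun (fun z : E * E => phi z.1).
  exact: (bounded_mfun_comp measurable_fst bphi).
have bpsi' : bounded_mfun (fun z : E * E => psi z.1).
  exact: (bounded_mfun_comp measurable_fst bpsi).
have bF : bounded_mfun (fun z : E * E => phi z.1 + psi z.1 * label_prob z.2).
  by apply: bounded_mfunD => //; exact: bounded_mfunM.
rewrite (density_Rintegral bp piE bF); apply: eq_Rintegral => x _ /=.
have b1 := bounded_mfun_pair1 x bp.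
have b2 := bounded_mfun_pair1 x (bounded_mfunM bql bp).
transitivity (\int[nu]_y (phi x * p (x, y) + psi x * (label_prob y * p (x, y)))).
  by apply: eq_Rintegral => y _; ring.
rewrite prob_RintegralD; last 2 first.
- by apply: bounded_mfunM => //; exact: bounded_mfun_cst.
- by apply: bounded_mfunM => //; exact: bounded_mfun_cst.
by rewrite !prob_RintegralZl// p1 mulr1.
Qed.

Local Notation omega := (transfer_law pi q).

(** The probability of an event that only depends on the first coordinate and
    on the label. *)
Lemma transfer_lawE (S : E -> set bool) : measurable [set x | S x true] ->
  measurable [set x | S x false] ->
  omega [set z | S z.1.1 z.2] = (\int[mu]_x
     (\1_[set x | S x false] x +
      (\1_[set x | S x true] x - \1_[set x | S x false] x) * regression x))%:E.
Proof.
move=> mt mf.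
have bi (A : set E) : measurable A -> bounded_mfun (\1_A : E -> R).
  move=> mA; split; first exact: measurable_indic.
  by exists 1 => x; rewrite indicE; case: (_ \in _); rewrite ?normr1 ?normr0.
have bt := bi _ mt; have bf := bi _ mf.
have btf : bounded_mfun
    (fun x => \1_[set x | S x true] x - \1_[set x | S x false] x : R).
  by apply: bounded_mfunD => //; exact: bounded_mfunN.
rewrite -coupling_regression// -Rintegral_EFin; last first.
  apply: bounded_mfunD; first exact: (bounded_mfun_comp measurable_fst bf).
  by apply: bounded_mfunM => //; exact: (bounded_mfun_comp measurable_fst btf).
apply: eq_integral => z _; rewrite /ksnd /=.
have -> : xsection [set z : E * E * bool | S z.1.1 z.2] z = S z.1.
  by apply/seteqP; split => a; rewrite /xsection /= inE.
rewrite !indicE.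
have [St|St] := pselect (S z.1 true); have [Sf|Sf] := pselect (S z.1 false).
- rewrite (mem_set (A := [set x | S x true]) St).
  rewrite (mem_set (A := [set x | S x false]) Sf) /= subrr mul0r addr0.
  have -> : S z.1 = setT by apply/seteqP; split => // -[].
  exact: prob_kernel.
- rewrite (mem_set (A := [set x | S x true]) St).
  rewrite (memNset (A := [set x | S x false]) Sf) /= subr0 mul1r add0r.
  have -> : S z.1 = [set true] by apply/seteqP; split => // -[] //= ->.
  exact: label_probE.
- rewrite (memNset (A := [set x | S x true]) St).
  rewrite (mem_set (A := [set x | S x false]) Sf) /= sub0r mulN1r.
  have -> : S z.1 = [set false] by apply/seteqP; split => // -[] //= ->.
  exact: label_prob_false.
- rewrite (memNset (A := [set x | S x true]) St).
  rewrite (memNset (A := [set x | S x false]) Sf) /= subrr mul0r addr0.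
  have -> : S z.1 = set0 by apply/seteqP; split => // -[].
  exact: measure0.
Qed.

Lemma transfer_law_marginal B : measurable B ->
  omega [set z | B z.1.1] = mu B.
Proof.
move=> mB; rewrite (transfer_lawE (S := fun x => [set _ | B x]))//=.
rewrite (_ : mu B = \int[mu]_x (\1_B x)%:E)%E; last first.
  by rewrite integral_indic// setIT.
rewrite Rintegral_EFin.
  by congr EFin; apply: eq_Rintegral => x _; rewrite subrr mul0r addr0.
split; first exact: measurable_indic.
by exists 1 => x; rewrite indicE; case: (_ \in _); rewrite ?normr1 ?normr0.
Qed.

(** Every version of the regression function agrees with the pointwise one. *)
Lemma regression_function_unique (h : E -> R) :
  is_regression_function omega h -> {ae mu, forall x, h x = regression x}.
Proof.
move=> [mh ih hE].
pose X (z : E * E * bool) : E := z.1.1.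
have mX : measurable_fun setT X.
  exact: (measurableT_comp measurable_fst measurable_fst).
have omX A : measurable A -> pushforward omega X A = mu A.
  exact: transfer_law_marginal.
have ihmu : mu.-integrable setT (EFin \o h).
  apply/integrableP; split; first exact/measurable_EFinP.
  have [_] := integrableP _ _ _ ih.
  rewrite (_ : \int[omega]_z _ = \int[omega]_(z in X @^-1` setT)
    ((fun x => `|(h x)%:E|) \o X) z)%E; last by rewrite preimage_setT.
  rewrite -ge0_integral_pushforward//; last first.
    by apply: measurableT_comp => //; exact/measurable_EFinP.
  rewrite (eq_measure_integral mu)// => A mA _; exact: omX.
have bR := bounded_regression.
have ae_h : ae_eq mu setT (EFin \o h) (EFin \o regression).
  apply: integral_ae_eq => //.
    by apply/measurable_EFinP; have [] := bR.
  move=> B _ mB.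
  have mXB : measurable (X @^-1` B) by rewrite -[X in measurable X]setTI; exact: mX.
  transitivity (\int[omega]_(z in X @^-1` B) ((EFin \o h) \o X) z)%E.
    rewrite -integral_pushforward//.
    - by apply: eq_measure_integral => A mA _; exact/esym/omX.
    - exact/measurable_EFinP.
    - exact: (integrableS measurableT).
  rewrite -[LHS]hE//.
  transitivity (omega [set z | B z.1.1 /\ z.2 = true]).
    transitivity (\int[omega]_(z in [set z | B z.1.1])
       (\1_[set z : E * E * bool | z.2 = true] z)%:E)%E.
      apply: eq_integral => -[z []] _ /=; rewrite indicE.
        by rewrite mem_set.
      by rewrite memNset.
    rewrite integral_indic//; last first.
      have := @measurable_snd _ _ (E * E)%type bool measurableT [set true] Logic.I.
      by rewrite setTI.
    by congr (omega _); apply/seteqP; split => z /= [].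
  rewrite (transfer_lawE (S := fun x => [set a | B x /\ a = true]))//=; last 2 first.
  - by rewrite (_ : [set x | _] = B)//; apply/seteqP; split => x /=; tauto.
  - by rewrite (_ : [set x | _] = set0)//; apply/seteqP; split => x /= [].
  have -> : [set x | B x /\ true = true] = B by apply/seteqP; split => x /=; tauto.
  have -> : [set x | B x /\ false = true] = set0 by apply/seteqP; split => x /= [].
  rewrite [RHS]integral_mkcond -Rintegral_EFin; last first.
    rewrite indic0.
    apply: bounded_mfunD; first exact: bounded_mfun_cst.
    apply: bounded_mfunM => //; apply: bounded_mfunD; last first.
      exact/bounded_mfunN/bounded_mfun_cst.
    split; first exact: measurable_indic.
    by exists 1 => x; rewrite indicE; case: (_ \in _); rewrite ?normr1 ?normr0.
  apply: eq_integral => x _; rewrite indic0 patchE indicE/= add0r subr0.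
  by case: (x \in B); rewrite ?mul1r ?mul0r.
by move: ae_h; apply: filterS => x hx; apply: EFin_inj; exact: hx.
Qed.

(** The excess risk is the integral of |2 h - 1| over the region where the
    classifier disagrees with the Bayes classifier. *)
Lemma excess_riskE (h : E -> R) (l : E -> bool) :
  is_regression_function omega h -> measurable_fun setT l ->
  excess_risk omega h l = \int[mu]_x
    ((l x != (2^-1 < regression x))%:R * (2 * `|regression x - 2^-1|)).
Proof.
move=> rh ml.
have bR := bounded_regression; have [mR _] := bR.
have riskE (k : E -> bool) : measurable_fun setT k ->
    risk omega k = \int[mu]_x (if k x then 1 - regression x else regression x).
  move=> mk; rewrite /risk.
  have mkt : measurable [set x | k x != true].
    rewrite (_ : [set x | _] = k @^-1` [set false]).
      by rewrite -[X in measurable X]setTI; exact: mk.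
    by apply/seteqP; split => x /=; case: (k x).
  have mkf : measurable [set x | k x != false].
    rewrite (_ : [set x | _] = k @^-1` [set true]).
      by rewrite -[X in measurable X]setTI; exact: mk.
    by apply/seteqP; split => x /=; case: (k x).
  rewrite (transfer_lawE (S := fun x => [set a | k x != a]))//=.
  apply: eq_Rintegral => x _; rewrite !indicE.
  have -> : (x \in [set x | k x != false]) = k x.
    by apply/idP/idP => [/set_mem/=|kx]; [|apply/mem_set => /=; move: kx]; case: (k x).
  have -> : (x \in [set x | k x != true]) = ~~ k x.
    by apply/idP/idP => [/set_mem/=|kx]; [|apply/mem_set => /=; move: kx]; case: (k x).
  by case: (k x) => /=; ring.
have mh : measurable_fun setT h by case: rh.
have mpl (f : E -> R) : measurable_fun setT f -> measurable_fun setT (plugin f).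
  by move=> mf; apply: measurable_fun_ltr.
rewrite /excess_risk !riskE//; last exact: mpl.
have bk (k : E -> bool) : measurable_fun setT k ->
    bounded_mfun (fun x => if k x then 1 - regression x else regression x).
  move=> mk; split.
    by apply: measurable_fun_ifT => //; apply: measurable_funB.
  exists 1 => x; have /andP[h1 h2] := regression_bounds x.
  by case: ifP => _; rewrite ger0_norm ?subr_ge0//; lra.
rewrite [X in _ - X](_ : _ = \int[mu]_x (if plugin regression x then
    1 - regression x else regression x)); last first.
  congr fine; apply: ae_eq_integral => //.
  - by apply/measurable_EFinP; have [] := bk _ (mpl _ mh).
  - by apply/measurable_EFinP; have [] := bk _ (mpl _ mR).
  have := regression_function_unique rh; apply: filterS => x hx _.
  by rewrite /plugin hx.
rewrite -prob_RintegralB; last 2 first.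
- exact: bk.
- by apply: bk; exact: mpl.
apply: eq_Rintegral => x _; rewrite /plugin.
case: (ltP 2^-1 (regression x)) => hx; case: (l x) => /=.
- by rewrite subrr mul0r.
- by rewrite mul1r ger0_norm; lra.
- by rewrite mul1r ler0_norm; lra.
- by rewrite subrr mul0r.
Qed.

End regression.

(** * The margin condition *)

Section peeling.
Context d (T : measurableType d) (R : realType) (mu : probability T R).
Variables (s : T -> R) (C0 alpha : R) (N : nat).
Hypotheses (ms : measurable_fun setT s) (s_bounds : forall x, 0 <= s x <= 2^-1).
Hypotheses (C00 : 0 < C0) (alpha0 : 0 < alpha) (alphaN : alpha <= N%:R).
Hypothesis margin : forall eps : R, 0 < eps <= 2^-1 ->
  (mu [set x | (0 < s x <= eps)%R] <= (C0 * eps `^ alpha)%:E)%E.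

Let measurable_margin eps : measurable [set x | (0 < s x <= eps)%R].
Proof.
rewrite (_ : [set x | _] = s @^-1` `]0, eps]%classic).
  by rewrite -[X in measurable X]setTI; exact: ms.
by apply/seteqP; split => x /=; rewrite in_itv.
Qed.

(** As s is at most 1/2, the margin condition holds at all scales. *)
Lemma margin_all eps : 0 < eps ->
  (mu [set x | (0 < s x <= eps)%R] <= (C0 * eps `^ alpha)%:E)%E.
Proof.
move=> e0; have [e2|e2] := leP eps 2^-1; first by apply: margin; rewrite e0.
apply: (@le_trans _ _ (mu [set x | (0 < s x <= 2^-1)%R])).
  apply: le_measure; rewrite ?inE// => x /= /andP[-> _].
  by have /andP[_ ->] := s_bounds x.
apply: (le_trans (margin _)); first by rewrite invr_gt0 ltr0n lexx.
rewrite lee_fin ler_wpM2l ?(ltW C00)//.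
by rewrite ge0_ler_powR// ?nnegrE ?invr_ge0 ?(ltW alpha0) ?(ltW e0) ?(ltW e2).
Qed.

Variable t : R.
Hypothesis t0 : 0 < t.

(** The tail weight s^(-N-1) off the margin s <= t. *)
Definition margin_tail (x : T) : R := if t < s x then (s x ^+ N.+1)^-1 else 0.

Lemma margin_tail_ge0 x : 0 <= margin_tail x.
Proof.
rewrite /margin_tail; case: ifP => // ts.
by rewrite invr_ge0 exprn_ge0// (le_trans (ltW t0))// ltW.
Qed.

Lemma measurable_margin_tail : measurable_fun setT margin_tail.
Proof.
rewrite (_ : margin_tail =
    fun x => if t < s x then expR (- N.+1%:R * ln (s x)) else 0).
  apply: measurable_fun_ifT => //; first exact: measurable_fun_ltr.
  apply: measurableT_comp => //; apply: measurable_funM => //.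
  exact: measurableT_comp.
apply/funext => x; rewrite /margin_tail; case: ifP => // ts.
by rewrite mulNr expRN expRM_natl lnK// posrE (lt_trans t0).
Qed.

(* peeling: cut the region s > t at the dyadic multiples of t *)
Let tail_peel : exists K : nat, forall x, margin_tail x <=
  \sum_(k < K) ((2 ^+ k * t) ^+ N.+1)^-1 *
    \1_[set x | (0 < s x <= 2 ^+ k.+1 * t)%R] x.
Proof.
pose K := (Num.truncn t^-1).+1; exists K => x.
have term0 (k : 'I_K) : true -> 0 <= ((2 ^+ k * t) ^+ N.+1)^-1 *
    \1_[set x | (0 < s x <= 2 ^+ k.+1 * t)%R] x.
  by rewrite mulr_ge0// ?indicE// invr_ge0 exprn_ge0// mulr_ge0 ?exprn_ge0// ltW.
rewrite /margin_tail; case: ifPn => [ts|_]; last first.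
  by apply: sumr_ge0 => k _; exact: term0.
have s0 : 0 < s x by exact: lt_trans ts.
have Kt : s x <= 2 ^+ K * t.
  have /andP[_ s2] := s_bounds x; apply: (le_trans s2).
  apply: (@le_trans _ _ 1); first by rewrite invf_le1//; lra.
  rewrite -ler_pdivrMr// mul1r; apply: (@le_trans _ _ K%:R).
    by apply/ltW; rewrite /K truncnS_gt.
  by rewrite -natrX ler_nat ltnW// ltn_expl.
pose Q k := s x <= 2 ^+ k.+1 * t.
have exQ : exists k, Q k by exists (Num.truncn t^-1).
have [k Qk mink] := ex_minnP exQ.
have kK : (k < K)%N by rewrite ltnS; exact: mink.
have lk : 2 ^+ k * t < s x.
  case: k Qk mink {kK} => [|k] Qk mink; first by rewrite expr0 mul1r.
  by rewrite ltNge; apply/negP => /mink; rewrite ltnn.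
rewrite (bigD1 (Ordinal kK))//= ler_wpDr//.
  by apply: sumr_ge0 => i _; exact: term0.
rewrite indicE mem_set/=; last by rewrite s0.
have p0 : 0 < 2 ^+ k * t by rewrite mulr_gt0// exprn_gt0.
rewrite mulr1 lef_pV2 ?posrE ?exprn_gt0//.
by rewrite lerXn2r// ?nnegrE ?ltW.
Qed.

(** The margin condition, of exponent at most N, makes the dyadic sum
    geometric. *)
Lemma margin_tail_int :
  (\int[mu]_x (margin_tail x)%:E <=
   (C0 * 2 ^+ N.+1 * (t `^ alpha / t ^+ N.+1))%:E)%E.
Proof.
have [K HK] := tail_peel.
pose c k : R := ((2 ^+ k * t) ^+ N.+1)^-1.
have c0 k : 0 <= c k.
  by rewrite invr_ge0 exprn_ge0// mulr_ge0 ?exprn_ge0// ltW.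
have mi k : measurable_fun setT
    (fun x => (c k * \1_[set x | (0 < s x <= 2 ^+ k.+1 * t)%R] x)%:E).
  by apply/measurable_EFinP; apply: measurable_funM => //; exact: measurable_indic.
apply: (@le_trans _ _ (\int[mu]_x
    (\sum_(k < K) (c k * \1_[set x | (0 < s x <= 2 ^+ k.+1 * t)%R] x)%:E))%E).
  apply: ge0_le_integral => //.
  - by move=> x _; rewrite lee_fin margin_tail_ge0.
  - by apply/measurable_EFinP; exact: measurable_margin_tail.
  - by apply: emeasurable_sum => k; exact: mi.
  - by move=> x _; rewrite sumEFin lee_fin; exact: HK.
rewrite ge0_integral_sum//; last first.
  by move=> k x _; rewrite lee_fin mulr_ge0// indicE.
pose G := C0 * 2 ^+ N * (t `^ alpha / t ^+ N.+1).
have G0 : 0 <= G.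
  apply: mulr_ge0; first by rewrite mulr_ge0 ?(ltW C00) ?exprn_ge0.
  by rewrite mulr_ge0 ?powR_ge0// invr_ge0 exprn_ge0// ltW.
apply: (@le_trans _ _ (\sum_(k < K) (G * (2^-1) ^+ k)%:E)%E).
  apply: lee_sum => k _.
  under eq_integral do rewrite EFinM.
  rewrite ge0_integralZl//; last 2 first.
  - by apply/measurable_EFinP; exact: measurable_indic.
  - by rewrite lee_fin.
  rewrite integral_indic// setIT.
  have p0 : 0 < 2 ^+ k.+1 * t by rewrite mulr_gt0// exprn_gt0.
  apply: (@le_trans _ _ ((c k)%:E * (C0 * (2 ^+ k.+1 * t) `^ alpha)%:E)%E).
    by rewrite lee_wpmul2l ?lee_fin// margin_all.
  rewrite -EFinM lee_fin.
  have h : (2 ^+ k.+1 * t) `^ alpha <= (2 ^+ k.+1) ^+ N * t `^ alpha.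
    rewrite powRM ?exprn_ge0 ?(ltW t0)// ler_wpM2r ?powR_ge0//.
    rewrite -[leRHS]powR_mulrn ?exprn_ge0//.
    by rewrite ler_powR// exprn_ege1// ler1n.
  apply: (@le_trans _ _ (c k * (C0 * ((2 ^+ k.+1) ^+ N * t `^ alpha)))).
    by rewrite ler_wpM2l// ler_wpM2l// ltW.
  rewrite le_eqVlt; apply/orP; left; apply/eqP.
  rewrite /c /G exprVn !exprMn -!exprM.
  have -> : (2 : R) ^+ (k.+1 * N) = 2 ^+ (k * N) * 2 ^+ N.
    by rewrite -exprD mulSn addnC.
  have -> : (2 : R) ^+ (k * N.+1) = 2 ^+ k * 2 ^+ (k * N).
    by rewrite -exprD mulnS.
  field.
  by rewrite ?expf_neq0 ?gt_eqF.
rewrite sumEFin lee_fin -mulr_sumr.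
have -> : C0 * 2 ^+ N.+1 * (t `^ alpha / t ^+ N.+1) = G * 2.
  by rewrite /G exprS; ring.
rewrite ler_wpM2l//.
have := @subrX1 R (2^-1) K => h.
have : 0 <= (2^-1 : R) ^+ K by rewrite exprn_ge0// invr_ge0.
lra.
Qed.

End peeling.

Section margin_expectation.
Context d (T : measurableType d) (R : realType) (mu : probability T R).
Context dW (W : measurableType dW) (P : probability W R).
Variables (s : T -> R) (C0 alpha : R) (N : nat).
Hypotheses (ms : measurable_fun setT s) (s_bounds : forall x, 0 <= s x <= 2^-1).
Hypotheses (C00 : 0 < C0) (alpha0 : 0 < alpha) (alphaN : alpha <= N%:R).
Hypothesis margin : forall eps : R, 0 < eps <= 2^-1 ->
  (mu [set x | (0 < s x <= eps)%R] <= (C0 * eps `^ alpha)%:E)%E.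
Variables (t M : R).
Hypotheses (t0 : 0 < t) (M0 : 0 <= M).
(* DD majorizes the (N + 2)-th power of a deviation of typical size t *)
Variable DD : W * T -> R.
Hypotheses (mDD : measurable_fun setT DD) (DD0 : forall z, 0 <= DD z).
Hypothesis EDD : forall x, (\int[P]_w (DD (w, x))%:E <= (M * t ^+ N.+2)%:E)%E.

(** A majorant of s on the event that the deviation is at least s: t if s <= t,
    and s times a Markov-type bound otherwise. *)
Definition margin_majorant (z : W * T) : R :=
  t * \1_[set x | (0 < s x <= t)%R] z.2 + margin_tail s N t z.2 * DD z.

Lemma margin_majorantP w x : 0 < s x -> s x ^+ N.+2 <= DD (w, x) ->
  s x <= margin_majorant (w, x).
Proof.
move=> s0 sD; rewrite /margin_majorant /margin_tail /=; case: ifPn => st.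
  have h : s x <= (s x ^+ N.+1)^-1 * DD (w, x).
    by rewrite ler_pdivlMl ?exprn_gt0// -exprSr.
  by apply: (le_trans h); rewrite lerDr mulr_ge0 ?(ltW t0)// indicE.
rewrite mul0r addr0 indicE mem_set ?mulr1; first by rewrite leNgt.
by rewrite /= s0 leNgt.
Qed.

Lemma margin_majorant_ge0 z : 0 <= margin_majorant z.
Proof.
by rewrite /margin_majorant addr_ge0// mulr_ge0 ?(ltW t0) ?margin_tail_ge0// indicE.
Qed.

Let measurable_margin : measurable [set x | (0 < s x <= t)%R].
Proof.
rewrite (_ : [set x | _] = s @^-1` `]0, t]%classic).
  by rewrite -[X in measurable X]setTI; exact: ms.
by apply/seteqP; split => x /=; rewrite in_itv.
Qed.

Let mtail : measurable_fun setT (margin_tail s N t).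
Proof. exact: measurable_margin_tail. Qed.

Lemma measurable_margin_majorant : measurable_fun setT margin_majorant.
Proof.
apply: measurable_funD; apply: measurable_funM => //.
  exact: (measurableT_comp (measurable_indic measurable_margin) measurable_snd).
exact: (measurableT_comp mtail measurable_snd).
Qed.

(** The expected mass of the majorant is of order t^(1 + alpha). *)
Lemma margin_majorant_int :
  (\int[P]_w \int[mu]_x (margin_majorant (w, x))%:E <=
   (C0 * (1 + 2 ^+ N.+1 * M) * t `^ (1 + alpha))%:E)%E.
Proof.
have mm := measurable_margin_majorant.
rewrite (fubini_tonelli (EFin \o margin_majorant))//; last 2 first.
- exact/measurable_EFinP.
- by move=> z; rewrite lee_fin margin_majorant_ge0.
have t0' : 0 <= t by exact: ltW.
have tt : t * t `^ alpha = t `^ (1 + alpha).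
  by rewrite powRD ?powRr1//; apply/implyP => _; rewrite gt_eqF.
apply: (@le_trans _ _ (\int[mu]_x (t%:E * (\1_[set x | (0 < s x <= t)%R] x)%:E +
   (M * t ^+ N.+2)%:E * (margin_tail s N t x)%:E))%E).
  apply: ge0_le_integral => //.
  - by move=> x _; apply: integral_ge0 => w _; rewrite lee_fin margin_majorant_ge0.
  - apply: (measurable_fun_fubini_tonelli_G (EFin \o margin_majorant)).
      exact/measurable_EFinP.
    by move=> z; rewrite lee_fin margin_majorant_ge0.
  - apply: emeasurable_funD; apply: measurable_funeM; apply/measurable_EFinP => //.
  - move=> x _; rewrite /margin_majorant/=.
    under eq_integral do rewrite EFinD [in X in (_ + X)%E]EFinM.
    have mDx : measurable_fun setT (fun w => (DD (w, x))%:E).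
      apply/measurable_EFinP; apply: (measurableT_comp mDD).
      exact: pair2_measurable.
    rewrite ge0_integralD//; last 3 first.
    + by move=> w _; rewrite lee_fin mulr_ge0// indicE.
    + by move=> w _; rewrite mule_ge0// lee_fin ?margin_tail_ge0.
    + exact: measurable_funeM.
    rewrite integral_cst//= probability_setT mule1 EFinM leeD//.
    rewrite ge0_integralZl//.
    + by rewrite muleC lee_wpmul2r// lee_fin margin_tail_ge0.
    + by move=> w _; rewrite lee_fin.
    + by rewrite lee_fin margin_tail_ge0.
rewrite ge0_integralD//; last 4 first.
- by move=> x _; rewrite mule_ge0// lee_fin ?indicE.
- by apply: measurable_funeM; apply/measurable_EFinP.
- by move=> x _; rewrite mule_ge0// lee_fin ?margin_tail_ge0// mulr_ge0// exprn_ge0.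
- by apply: measurable_funeM; apply/measurable_EFinP.
rewrite ge0_integralZl//; last by apply/measurable_EFinP.
rewrite ge0_integralZl//; last 3 first.
- by apply/measurable_EFinP.
- by move=> x _; rewrite lee_fin margin_tail_ge0.
- by rewrite lee_fin mulr_ge0// exprn_ge0.
rewrite integral_indic// setIT.
apply: (@le_trans _ _ (t%:E * (C0 * t `^ alpha)%:E + (M * t ^+ N.+2)%:E *
    (C0 * 2 ^+ N.+1 * (t `^ alpha / t ^+ N.+1))%:E)%E).
  have tN0 : 0 <= t ^+ N.+2 by exact: exprn_ge0.
  apply: leeD; apply: lee_wpmul2l; rewrite ?lee_fin ?(mulr_ge0 M0 tN0)//.
    exact: (margin_all ms s_bounds).
  exact: (margin_tail_int ms s_bounds C00 alpha0 alphaN margin t0).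
rewrite -!EFinM -EFinD lee_fin -tt le_eqVlt; apply/orP; left; apply/eqP.
rewrite [t ^+ N.+2]exprS; field.
by rewrite ?expf_neq0 ?gt_eqF.
Qed.

End margin_expectation.

(** * Labels and power means *)

Section fair_coin.
Context {R : realType}.

Lemma Rintegral_fair_coin (g : bool -> R) :
  \int[bernoulli_prob 2^-1]_a g a = 2^-1 * (g true + g false).
Proof.
have h01 : 0 <= (2^-1 : R) <= 1 by apply/andP; split; lra.
pose M := `|g true| + `|g false|.
have bg (f : bool -> R) : bounded_mfun f.
  split; first by [].
  by exists (`|f true| + `|f false|) => -[]; rewrite ?lerDl ?lerDr.
have gM a : 0 <= g a + M.
  have := ler_norm (- g a); rewrite normrN /M.
  by case: a => h; have := normr_ge0 (g true); have := normr_ge0 (g false); lra.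
have := integral_bernoulli_prob h01 (f := fun a => (g a + M)%:E) gM.
rewrite (Rintegral_EFin _ (bg _)) prob_RintegralD ?prob_Rintegral_cst//.
by rewrite -!EFinM -EFinD => h; have := EFin_inj h; rewrite /unstable.onem; lra.
Qed.

End fair_coin.

Section semidirect_integral.
Context {R : realType} {d : nat}.
Local Notation E := (d.-tuple R).
Variables (nu : probability E R) (q : R.-pker E ~> bool).

(* the density of the law of (Y, A) with respect to the law of (Y, coin), where
   the coin is fair and independent of Y *)
Let w (z : E * bool) : R :=
  if z.2 then 2 * label_prob q z.1 else 2 * (1 - label_prob q z.1).

Let bounded_if (f g : E -> R) : bounded_mfun f -> bounded_mfun g ->
  bounded_mfun (fun z : E * bool => if z.2 then f z.1 else g z.1).
Proof.
move=> [mf [M fM]] [mg [N gN]]; split.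
  apply: measurable_fun_ifT; first exact: measurable_snd.
    exact: (measurableT_comp mf measurable_fst).
  exact: (measurableT_comp mg measurable_fst).
exists (`|M| + `|N|) => -[y []] /=.
  by apply: (le_trans (fM y)); apply: (le_trans (ler_norm M)); rewrite lerDl.
by apply: (le_trans (gN y)); apply: (le_trans (ler_norm N)); rewrite lerDr.
Qed.

Let bl := bounded_label_prob q.
Let bl' : bounded_mfun (fun y => 1 - label_prob q y).
Proof. by apply: bounded_mfunD; [exact: bounded_mfun_cst|exact: bounded_mfunN]. Qed.

Let bw : bounded_mfun w.
Proof.
by apply: (@bounded_if (fun y => 2 * label_prob q y)
  (fun y => 2 * (1 - label_prob q y))); apply: bounded_mfunM => //;
  exact: bounded_mfun_cst.
Qed.

Let w0 z : 0 <= w z.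
Proof.
have /andP[h1 h2] := label_prob_bounds q z.1.
by rewrite /w; case: ifP => _; rewrite mulr_ge0// subr_ge0.
Qed.

Let semidirectE B : measurable B -> semidirect nu q B =
  (\int[product_probability nu (bernoulli_prob 2^-1)]_(z in B) (w z)%:E)%E.
Proof.
move=> mB; have [mw _] := bw.
have h01 : 0 <= (2^-1 : R) <= 1 by apply/andP; split; lra.
rewrite integral_mkcond.
have wB0 z : (0 <= ((EFin \o w) \_ B) z)%E.
  by apply: erestrict_ge0 => x _; rewrite lee_fin.
rewrite (fubini_tonelli1 ((EFin \o w) \_ B))//=; last first.
  apply: (measurable_restrictT (EFin \o w) mB).1; apply: measurable_funTS.
  exact/measurable_EFinP.
apply: eq_integral => y _; rewrite /fubini_F.
rewrite (integral_bernoulli_prob h01)//.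
have lt := label_probE q y; have lf := label_prob_false q y.
have mem a : ((y, a) \in B) = (a \in xsection B y).
  by apply/idP/idP => [/set_mem h|]; rewrite ?mem_xsection//; apply/mem_set.
rewrite !patchE !mem /w /=.
have -> : unstable.onem (2^-1 : R) = 2^-1 by rewrite /unstable.onem; lra.
have [ht|ht] := pselect (xsection B y true);
  have [hf|hf] := pselect (xsection B y false).
- rewrite (mem_set ht) (mem_set hf).
  have -> : xsection B y = setT by apply/seteqP; split => // -[].
  by rewrite prob_kernel -!EFinM -EFinD; congr EFin; lra.
- rewrite (mem_set ht) (memNset hf).
  have -> : xsection B y = [set true] by apply/seteqP; split => // -[] //= ->.
  by rewrite mule0 adde0 -EFinM lt; congr EFin; lra.
- rewrite (memNset ht) (mem_set hf).
  have -> : xsection B y = [set false] by apply/seteqP; split => // -[] //= ->.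
  by rewrite mule0 add0e -EFinM lf; congr EFin; lra.
- rewrite (memNset ht) (memNset hf).
  have -> : xsection B y = set0 by apply/seteqP; split => // -[].
  by rewrite measure0 !mule0 adde0.
Qed.

Lemma semidirect_Rintegral (F : E * bool -> R) : bounded_mfun F ->
  \int[semidirect nu q]_z F z = \int[nu]_y
    (label_prob q y * F (y, true) + (1 - label_prob q y) * F (y, false)).
Proof.
move=> bF; rewrite (density_Rintegral bw semidirectE bF).
by apply: eq_Rintegral => y _; rewrite Rintegral_fair_coin /w /=; lra.
Qed.

Lemma semidirect_marginal B : measurable B ->
  semidirect nu q (fst @^-1` B) = nu B.
Proof.
move=> mB; rewrite /= /semidirect.
transitivity (\int[nu]_y (\1_B y)%:E)%E; last by rewrite integral_indic// setIT.
apply: eq_integral => y _; rewrite indicE; have [yB|yB] := pselect (B y).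
  rewrite mem_set//.
  have -> : xsection (fst @^-1` B : set (E * bool)) y = setT.
    by apply/seteqP; split => // a _; rewrite /xsection /= inE.
  exact: prob_kernel.
rewrite memNset//.
have -> : xsection (fst @^-1` B : set (E * bool)) y = set0.
  by apply/seteqP; split => // a; rewrite /xsection /= inE.
exact: measure0.
Qed.

End semidirect_integral.

Section power_mean.
Context {R : realType}.

(** The tangent line inequality for x^(m+1) at M. *)
Lemma expr_tangent (x M : R) m : 0 <= x -> 0 <= M ->
  m.+1%:R * M ^+ m * x - m%:R * M ^+ m.+1 <= x ^+ m.+1.
Proof.
move=> x0 M0; elim: m => [|m IH]; first by rewrite expr0 mul0r subr0 mulr1 mul1r.
rewrite [leRHS]exprS; apply: le_trans (ler_wpM2l x0 IH).
rewrite -subr_ge0.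
have -> : x * (m.+1%:R * M ^+ m * x - m%:R * M ^+ m.+1) -
    (m.+2%:R * M ^+ m.+1 * x - m.+1%:R * M ^+ m.+2) =
    m.+1%:R * M ^+ m * (x - M) ^+ 2.
  by rewrite !exprS -!natr1; ring.
by rewrite mulr_ge0 ?sqr_ge0// mulr_ge0// exprn_ge0.
Qed.

Lemma power_mean_le n (x : 'I_n -> R) m : (0 < n)%N -> (forall i, 0 <= x i) ->
  (n%:R^-1 * \sum_i x i) ^+ m <= n%:R^-1 * \sum_i x i ^+ m.
Proof.
move=> n0 x0; have N0 : 0 < n%:R :> R by rewrite ltr0n.
case: m => [|m].
  rewrite expr0 (eq_bigr (fun=> 1)) => [|i _]; last by rewrite expr0.
  by rewrite sumr_const card_ord mulVf// gt_eqF.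
set M := _ * \sum_i x i.
have M0 : 0 <= M by rewrite mulr_ge0 ?invr_ge0 ?(ltW N0)// sumr_ge0.
have sE : \sum_i x i = n%:R * M by rewrite /M mulrA mulfV ?mul1r ?gt_eqF.
have h : \sum_i (m.+1%:R * M ^+ m * x i - m%:R * M ^+ m.+1) <=
    \sum_i x i ^+ m.+1.
  by apply: ler_sum => i _; exact: expr_tangent.
rewrite ler_pdivlMl//; apply: le_trans h.
rewrite sumrB -mulr_sumr sE sumr_const card_ord -(mulr_natl (m%:R * _)).
by rewrite le_eqVlt; apply/orP; left; apply/eqP; rewrite exprS -natr1; ring.
Qed.

Lemma sum4_expr_le (a b c e : R) m : 0 <= a -> 0 <= b -> 0 <= c -> 0 <= e ->
  (a + b + c + e) ^+ m <= 4 ^+ m * (a ^+ m + b ^+ m + c ^+ m + e ^+ m).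
Proof.
move=> a0 b0 c0 e0.
pose x (i : 'I_4) := nth 0 [:: a; b; c; e] i.
have x0 i : 0 <= x i by case: i => -[|[|[|[|//]]]] ?.
have := power_mean_le m (isT : (0 < 4)%N) x0.
rewrite !big_ord_recl !big_ord0 /x /= !addr0 exprMn => h.
have p4 : 0 < (4 : R) ^+ m by rewrite exprn_gt0.
have am : 0 <= a ^+ m + (b ^+ m + (c ^+ m + e ^+ m)) by rewrite !addr_ge0 ?exprn_ge0.
rewrite -!addrA.
have := ler_wpM2l (ltW p4) h; rewrite mulrA -exprMn mulfV// expr1n mul1r.
move=> /le_trans; apply; rewrite ler_wpM2l ?(ltW p4)//.
by rewrite ler_piMl// invf_le1//; lra.
Qed.

End power_mean.

(** * Deviation of the empirical regression function *)

Section empirical_deviation.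
Context {R : realType} {d n : nat}.
Local Notation E := (d.-tuple R).
Variables (eta : R) (x y : 'I_n -> E) (f g : E -> R).
Hypotheses (eta0 : 0 < eta) (n0 : (0 < n)%N).
Hypothesis x2 : forall i, enorm (x i) <= 2^-1.
Hypothesis y2 : forall j, enorm (y j) <= 2^-1.
Hypothesis fg : empirical_potentials eta x y f g.

Local Notation pn := (empirical_density eta f g).
Let k : R := expR (- eta) ^+ 2.
Let k0 : 0 < k. Proof. by rewrite exprn_gt0// expR_gt0. Qed.
Let k1 : k <= 1.
Proof. by rewrite exprn_ile1 ?expR_ge0// expR_le1 oppr_le0 ltW. Qed.
Let N0 : 0 < n%:R :> R. Proof. by rewrite ltr0n. Qed.

(** The equations that extend the potentials are the marginal conditions of
    the empirical density. *)
Lemma empirical_density_row u : n%:R^-1 * \sum_j pn u (y j) = 1.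
Proof.
have [_ _ /(_ u) fE _] := fg.
transitivity (expR (eta * f u) * expR (- eta * f u)); last first.
  by rewrite -expRD -mulrDl subrr mul0r expR0.
rewrite fE mulrCA [X in _ = _ * X]mulr_sumr; congr (_ * _); apply: eq_bigr => j _.
by rewrite -expRD; congr expR; ring.
Qed.

Lemma empirical_density_col v : n%:R^-1 * \sum_i pn (x i) v = 1.
Proof.
have [_ _ _ /(_ v) gE] := fg.
transitivity (expR (eta * g v) * expR (- eta * g v)); last first.
  by rewrite -expRD -mulrDl subrr mul0r expR0.
rewrite gE mulrCA [X in _ = _ * X]mulr_sumr; congr (_ * _); apply: eq_bigr => i _.
by rewrite -expRD; congr expR; ring.
Qed.

(* over a support of diameter 1 the potential g varies by at most 1 *)
Let g_osc v v' : enorm v <= 2^-1 -> enorm v' <= 2^-1 -> g v <= g v' + 1.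
Proof.
move=> v2 v'2; have [_ _ _ gE] := fg.
have : expR (- eta) * expR (- eta * g v') <= expR (- eta * g v).
  rewrite !gE mulrCA ler_pM2l ?invr_gt0// mulr_sumr; apply: ler_sum => i _.
  rewrite -expRD ler_expR.
  have := qcost_le1 (x2 i) v2; have := qcost_ge0 (x i) v'.
  set q := qcost (x i) v; set q' := qcost (x i) v' => h1 h2.
  have h3 := ler_wpM2l (ltW eta0) h2; have h4 := mulr_ge0 (ltW eta0) h1.
  lra.
rewrite -expRD ler_expR => h.
rewrite -(ler_pM2l eta0) mulrDr; lra.
Qed.

Lemma empirical_density_bounds u j : enorm u <= 2^-1 ->
  k <= pn u (y j) <= k^-1.
Proof.
move=> u2.
have cmp i l : k * pn u (y i) <= pn u (y l).
  rewrite /k -expRM_natl -expRD ler_expR.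
  have c1 := qcost_le1 u2 (y2 l); have c2 := qcost_ge0 u (y i).
  have go := g_osc (y2 i) (y2 l).
  have h1 := ler_wpM2l (ltW eta0) c1; have h2 := mulr_ge0 (ltW eta0) c2.
  have h3 := ler_wpM2l (ltW eta0) go.
  rewrite mulrDr in h3; lra.
have avg (c : R) : n%:R^-1 * \sum_(i < n) c = c.
  by rewrite sumr_const card_ord -(mulr_natl c) mulrA mulVf ?mul1r ?gt_eqF.
apply/andP; split.
  rewrite -[leLHS]mulr1 -(empirical_density_row u) mulrCA mulr_sumr.
  rewrite -[leRHS]avg ler_pM2l ?invr_gt0//.
  by apply: ler_sum => i _; exact: cmp.
rewrite -[leRHS]mulr1 ler_pdivlMl// -(empirical_density_row u).
rewrite -[leLHS]avg ler_pM2l ?invr_gt0//.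
by apply: ler_sum => i _; exact: cmp.
Qed.

Variables (a b : E -> R).
Hypotheses (a0 : forall u, 0 < a u) (b0 : forall v, 0 < b v).
Local Notation p := (schrodinger_density eta a b).
Hypothesis pk : forall z, k <= p z <= k^-1.

Let row_defect u : R := n%:R^-1 * \sum_j p (u, y j) - 1.
Let col_defect v : R := n%:R^-1 * \sum_i p (x i, v) - 1.

(** The squared deviation of the empirical regression function at u is bounded
    by four fluctuations of averages involving the population density only: the
    two marginal defects on the sample, the marginal defect at u, and the label
    average at u. *)
Lemma empirical_regression_deviation (lab : 'I_n -> bool) (h u : _) :
  enorm u <= 2^-1 ->
  (empirical_regression eta y lab f g u - h) ^+ 2 <= 16 * k^-1 ^+ 10 *
    (n%:R^-1 * \sum_i row_defect (x i) ^+ 2 +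
     n%:R^-1 * \sum_j col_defect (y j) ^+ 2 + row_defect u ^+ 2 +
     (n%:R^-1 * \sum_j (lab j : nat)%:R * p (u, y j) - h) ^+ 2).
Proof.
move=> u2.
pose A v := ln (a v) - eta * f v; pose B v := ln (b v) - eta * g v.
(* m moves the additive constant from the second potential to the first, so
   that the differences bj have mean zero *)
pose m := n%:R^-1 * \sum_j B (y j).
pose bj j := B (y j) - m.
have sb : \sum_j bj j = 0.
  rewrite sumrB sumr_const card_ord -(mulr_natl m) /m mulrA mulfV ?gt_eqF//.
  by rewrite mul1r subrr.
have pE v j : enorm v <= 2^-1 -> p (v, y j) = pn v (y j) * expR (A v + m + bj j).
  move=> v2; rewrite /schrodinger_density /gibbs_kernel tcostE//=.
  rewrite -[a v]lnK ?posrE// -[b (y j)]lnK ?posrE// -!expRD; congr expR.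
  by rewrite /A /bj /B; ring.
pose G1 := \sum_i row_defect (x i) ^+ 2; pose G2 := \sum_j col_defect (y j) ^+ 2.
have st : k ^+ 2 * \sum_j bj j ^+ 2 <= G1 + G2.
  apply: (potential_stability (k := k) (M := k^-1) k0
    (p := fun i j => pn (x i) (y j)) (q := fun i j => p (x i, y j))
    (a := fun i => A (x i) + m)) => //.
  - by move=> i j; exact: empirical_density_bounds.
  - by move=> i j; exact: pE.
  - by move=> i; exact: empirical_density_row.
  - by move=> j; exact: empirical_density_col.
pose r := row_defect u.
pose S := n%:R^-1 * \sum_j (lab j : nat)%:R * p (u, y j) - h.
have dst := density_stability k0 n0 k1 erefl
  (fun j => empirical_density_bounds j u2) (fun j => pk (u, y j))
  (fun j => pE u j u2) (empirical_density_row u).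
set D := n%:R^-1 * \sum_j `|_| in dst.
set mb := n%:R^-1 * \sum_j bj j ^+ 2 in dst.
have mbG : k ^+ 2 * mb <= n%:R^-1 * G1 + n%:R^-1 * G2.
  by rewrite /mb mulrCA -mulrDr ler_pM2l ?invr_gt0.
have D0 : 0 <= D by rewrite mulr_ge0 ?invr_ge0 ?(ltW N0)// sumr_ge0.
pose e := empirical_regression eta y lab f g u - h.
have eE : e - S = n%:R^-1 * \sum_j (lab j : nat)%:R * (pn u (y j) - p (u, y j)).
  rewrite /e /S /empirical_regression opprB addrA subrK -mulrBr -sumrB.
  by congr (_ * _); apply: eq_bigr => j _; rewrite mulrBr.
have eD : `|e - S| <= D.
  rewrite eE normrM (ger0_norm (x := n%:R^-1)) ?invr_ge0 ?(ltW N0)//.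
  rewrite ler_pM2l ?invr_gt0//; apply: (le_trans (ler_norm_sum _ _ _)).
  apply: ler_sum => j _; rewrite normrM distrC.
  by case: (lab j); rewrite ?normr1 ?mul1r// normr0 mul0r.
have e2 : (e - S) ^+ 2 <= D ^+ 2.
  by rewrite -real_normK ?num_real// lerXn2r ?nnegrE//.
have c0 : 0 < k^-1 by rewrite invr_gt0.
have c1 : 1 <= k^-1 by rewrite invf_ge1.
have mbG' : mb <= k^-1 ^+ 2 * (n%:R^-1 * G1 + n%:R^-1 * G2).
  by rewrite exprVn ler_pdivlMl ?(exprn_gt0 2 k0)//.
have G10 : 0 <= n%:R^-1 * G1.
  by rewrite mulr_ge0 ?invr_ge0 ?(ltW N0)// sumr_ge0// => i _; exact: sqr_ge0.
have G20 : 0 <= n%:R^-1 * G2.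
  by rewrite mulr_ge0 ?invr_ge0 ?(ltW N0)// sumr_ge0// => i _; exact: sqr_ge0.
have r0 : 0 <= r ^+ 2 by exact: sqr_ge0.
have S0 : 0 <= S ^+ 2 by exact: sqr_ge0.
have step : r ^+ 2 + mb <= k^-1 ^+ 2 * (n%:R^-1 * G1 + n%:R^-1 * G2 + r ^+ 2).
  rewrite [leRHS]mulrDr addrC lerD//.
  by rewrite ler_peMl// exprn_ege1.
have D2 : D ^+ 2 <= 8 * k^-1 ^+ 10 * (n%:R^-1 * G1 + n%:R^-1 * G2 + r ^+ 2).
  apply: (le_trans dst).
  have -> : 8 * k^-1 ^+ 10 * (n%:R^-1 * G1 + n%:R^-1 * G2 + r ^+ 2) =
    8 * k^-1 ^+ 8 * (k^-1 ^+ 2 * (n%:R^-1 * G1 + n%:R^-1 * G2 + r ^+ 2)) by ring.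
  by rewrite ler_wpM2l// mulr_ge0// exprn_ge0// ltW.
have S2 : S ^+ 2 <= k^-1 ^+ 10 * S ^+ 2 by rewrite ler_peMl// exprn_ege1.
rewrite -/r -/S -/G1 -/G2 -/e.
have := sqr_ge0 (e - S - S).
have -> : (e - S - S) ^+ 2 = 2 * (e - S) ^+ 2 + 2 * S ^+ 2 - e ^+ 2 by ring.
set Q := k^-1 ^+ 10 in D2 S2 *.
set X := n%:R^-1 * G1 + n%:R^-1 * G2 + r ^+ 2 in D2 *.
rewrite [16 * Q * _]mulrDr.
have QS0 : 0 <= Q * S ^+ 2 by rewrite mulr_ge0// exprn_ge0// ltW.
lra.
Qed.

End empirical_deviation.

(** * Moments of the sample fluctuations *)

Section sample.
Context {R : realType} {d n : nat}.
Local Notation E := (d.-tuple R).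
Variables (mu nu : probability E R) (q : R.-pker E ~> bool).
Context dW (W : measurableType dW) (P : probability W R).
Variables (X : 'I_n -> {RV P >-> E}) (L : 'I_n -> {RV P >-> (E * bool)%type}).
Hypothesis sample : transfer_sample mu nu q X L.

Lemma sample_X_law i B : measurable B -> P (X i @^-1` B) = mu B.
Proof. by case: sample => + _ _; exact. Qed.

Lemma sample_L_law j C : measurable C -> P (L j @^-1` C) = semidirect nu q C.
Proof. by case: sample => _ + _; exact. Qed.

Let sample_indep (A : 'I_n -> set E) (C : 'I_n -> set (E * bool)) :
  (forall i, measurable (A i)) -> (forall j, measurable (C j)) ->
  P (\bigcap_i (X i @^-1` A i) `&` \bigcap_j (L j @^-1` C j)) =
  (\prod_i P (X i @^-1` A i) * \prod_j P (L j @^-1` C j))%E.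
Proof.
move=> mA mC; case: sample => _ _ ind.
pose G (k : 'I_n + 'I_n) : set W := match k with
  | inl i => X i @^-1` A i | inr j => L j @^-1` C j end.
have hG k : k \in [set: ('I_n + 'I_n)%type]%SET ->
    (match k with
     | inl i => sigma_generated (X i)
     | inr j => sigma_generated (L j) end : set (set W)) (G k).
  by case: k => [i|j] _; [exists (A i)|exists (C j)] => //; rewrite setTI.
have <- : \bigcap_(k in [set` [set: ('I_n + 'I_n)%type]%SET]) G k =
    \bigcap_i (X i @^-1` A i) `&` \bigcap_j (L j @^-1` C j).
  apply/seteqP; split => w.
    move=> h; split => i _.
      by have := h (inl i); rewrite /= inE; exact.
    by have := h (inr i); rewrite /= inE; exact.
  by move=> [h1 h2] [i|j] _ /=; [exact: h1|exact: h2].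
rewrite (ind _ _ hG) (eq_bigl xpredT) => [|k]; last by rewrite inE.
by rewrite big_sumType.
Qed.

Lemma sample_indep_XL i0 (A : set E) (C : 'I_n -> set (E * bool)) :
  measurable A -> (forall j, measurable (C j)) ->
  P (X i0 @^-1` A `&` \bigcap_j (L j @^-1` C j)) =
  (P (X i0 @^-1` A) * \prod_j P (L j @^-1` C j))%E.
Proof.
move=> mA mC; pose A' i := if i == i0 then A else setT.
have -> : X i0 @^-1` A = \bigcap_i (X i @^-1` A' i).
  apply/seteqP; split => w.
    by move=> Aw i _; rewrite /A' /=; case: eqP => // ->.
  by move=> /(_ i0 Logic.I); rewrite /A' /= eqxx.
rewrite sample_indep//; last by move=> i; rewrite /A'; case: ifP.
rewrite (bigD1 i0)//= [X in (_ * X * _)%E]big1; last first.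
  by move=> i /negbTE ii; rewrite /A' ii preimage_setT probability_setT.
rewrite mule1 (_ : \bigcap_i _ = X i0 @^-1` A); last first.
  apply/seteqP; split => w.
    by move=> /(_ i0 Logic.I); rewrite /A' /= eqxx.
  by move=> Aw i _; rewrite /A' /=; case: eqP => // ->.
by rewrite /A' eqxx.
Qed.

Lemma sample_indep_LX j0 (C : set (E * bool)) (A : 'I_n -> set E) :
  measurable C -> (forall i, measurable (A i)) ->
  P (L j0 @^-1` C `&` \bigcap_i (X i @^-1` A i)) =
  (P (L j0 @^-1` C) * \prod_i P (X i @^-1` A i))%E.
Proof.
move=> mC mA; pose C' j := if j == j0 then C else setT.
have E' : \bigcap_j (L j @^-1` C' j) = L j0 @^-1` C.
  apply/seteqP; split => w.
    by move=> /(_ j0 Logic.I); rewrite /C' /= eqxx.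
  by move=> Cw j _; rewrite /C' /=; case: eqP => // ->.
rewrite setIC -E' sample_indep//; last by move=> j; rewrite /C'; case: ifP.
rewrite (bigD1 j0 (F := fun j => P (L j @^-1` C' j)))//=.
rewrite [X in (_ * (_ * X))%E]big1; last first.
  by move=> j /negbTE jj; rewrite /C' jj preimage_setT probability_setT.
by rewrite mule1 E' {1}/C' eqxx muleC.
Qed.

Hypothesis n0 : (0 < n)%N.
Variables (p : E * E -> R) (k : R).
Hypotheses (pp : positive_mfun p) (k0 : 0 < k) (k1 : k <= 1).
Hypothesis pk : forall z, k <= p z <= k^-1.
Hypothesis p1 : forall x, \int[nu]_y p (x, y) = 1.
Hypothesis p2 : forall y, \int[mu]_x p (x, y) = 1.

(** The constant of the bound on moments of order 2m of averages of variables
    bounded by 1/k. *)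
Definition moment_constant m : R :=
  2 * expR 1 * (2 * m)`!%:R * (9 * k^-1 ^+ 2) ^+ m.

Let bp := positive_mfun_bounded pp.
Let c1 : 1 <= k^-1. Proof. by rewrite invf_ge1. Qed.
Let p0 z : 0 <= p z. Proof. exact/ltW/positive_mfun_gt0. Qed.

Let defect_le z : `|p z - 1| <= k^-1.
Proof.
have /andP[_ h] := pk z; have := p0 z; have c1' := c1.
by rewrite ler_norml => h0; apply/andP; split; lra.
Qed.

Let meanB (c : R) (F : 'I_n -> R) :
  n%:R^-1 * \sum_i (F i - c) = n%:R^-1 * \sum_i F i - c.
Proof.
rewrite sumrB sumr_const card_ord -(mulr_natl c) mulrBr mulrA mulVf ?mul1r//.
by rewrite gt_eqF// ltr0n.
Qed.

Let momentE m : (2 * expR 1 * (2 * m)`!%:R * (9 * k^-1 ^+ 2 / n%:R) ^+ m) =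
  moment_constant m * (n%:R^-1) ^+ m.
Proof. by rewrite /moment_constant exprMn mulrA. Qed.

Let bLy : bounded_mfun (fun z : E * (E * bool) => p (z.1, z.2.1)).
Proof.
have mm : measurable_fun setT (fun z : E * (E * bool) => (z.1, z.2.1)).
  apply: measurable_fun_pair; first exact: measurable_fst.
  exact: (measurableT_comp measurable_fst measurable_snd).
exact: (bounded_mfun_comp mm bp).
Qed.

Lemma row_defect_moment m i : (\int[P]_w
  ((n%:R^-1 * \sum_j p (X i w, (L j w).1) - 1) ^+ (2 * m))%:E <=
  (moment_constant m * (n%:R^-1) ^+ m)%:E)%E.
Proof.
pose xi (z : E * (E * bool)) : R := p (z.1, z.2.1) - 1.
have bxi : bounded_mfun xi.
  by apply: bounded_mfunD; [exact: bLy|exact: bounded_mfun_cst].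
have [mxi _] := bxi.
have := mean_moment_le n0 (@sample_L_law) (sample_indep_XL i) mxi
  (_ : 0 < k^-1) (fun z => defect_le _) _ m.
rewrite momentE; under eq_integral do rewrite meanB.
apply; first by rewrite invr_gt0.
move=> x; have bx := bounded_mfun_pair1 x bxi.
rewrite (Rintegral_EFin _ bx) (semidirect_Rintegral nu q bx); congr EFin.
transitivity (\int[nu]_y (p (x, y) - 1)).
  by apply: eq_Rintegral => y _; rewrite /xi /=; ring.
rewrite prob_RintegralB ?p1 ?prob_Rintegral_cst ?subrr//.
  exact: bounded_mfun_pair1.
exact: bounded_mfun_cst.
Qed.

Lemma fixed_row_defect_moment m u : (\int[P]_w
  ((n%:R^-1 * \sum_j p (u, (L j w).1) - 1) ^+ (2 * m))%:E <=
  (moment_constant m * (n%:R^-1) ^+ m)%:E)%E.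
Proof.
pose i0 := Ordinal n0.
pose xi (z : E * (E * bool)) : R := p (u, z.2.1) - 1.
have bpu := bounded_mfun_pair1 u bp.
have bxi : bounded_mfun xi.
  apply: bounded_mfunD; last exact: bounded_mfun_cst.
  exact: (bounded_mfun_comp (measurableT_comp measurable_fst measurable_snd) bpu).
have [mxi _] := bxi.
have := mean_moment_le n0 (@sample_L_law) (sample_indep_XL i0) mxi
  (_ : 0 < k^-1) (fun z => defect_le _) _ m.
rewrite momentE; under eq_integral do rewrite meanB.
apply; first by rewrite invr_gt0.
move=> x; have bx := bounded_mfun_pair1 x bxi.
rewrite (Rintegral_EFin _ bx) (semidirect_Rintegral nu q bx); congr EFin.
transitivity (\int[nu]_y (p (u, y) - 1)).
  by apply: eq_Rintegral => y _; rewrite /xi /=; ring.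
rewrite prob_RintegralB ?p1 ?prob_Rintegral_cst ?subrr//.
exact: bounded_mfun_cst.
Qed.

Lemma col_defect_moment m j : (\int[P]_w
  ((n%:R^-1 * \sum_i p (X i w, (L j w).1) - 1) ^+ (2 * m))%:E <=
  (moment_constant m * (n%:R^-1) ^+ m)%:E)%E.
Proof.
pose xi (z : E * bool * E) : R := p (z.2, z.1.1) - 1.
have mm : measurable_fun setT (fun z : E * bool * E => (z.2, z.1.1)).
  apply: measurable_fun_pair; first exact: measurable_snd.
  exact: (measurableT_comp measurable_fst measurable_fst).
have bxi : bounded_mfun xi.
  apply: bounded_mfunD; last exact: bounded_mfun_cst.
  exact: (bounded_mfun_comp mm bp).
have [mxi _] := bxi.
have := mean_moment_le n0 (@sample_X_law) (sample_indep_LX j) mxi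
  (_ : 0 < k^-1) (fun z => defect_le _) _ m.
rewrite momentE; under eq_integral do rewrite meanB.
apply; first by rewrite invr_gt0.
move=> z; have bx := bounded_mfun_pair1 z bxi.
rewrite (Rintegral_EFin _ bx); congr EFin.
rewrite prob_RintegralB ?p2 ?prob_Rintegral_cst ?subrr//.
  exact: bounded_mfun_pair2.
exact: bounded_mfun_cst.
Qed.

Lemma label_defect_moment m u : (\int[P]_w
  ((n%:R^-1 * \sum_j ((L j w).2 : nat)%:R * p (u, (L j w).1) -
    regression nu p q u) ^+ (2 * m))%:E <=
  (moment_constant m * (n%:R^-1) ^+ m)%:E)%E.
Proof.
pose i0 := Ordinal n0.
pose h0 := regression nu p q u.
pose xi (z : E * (E * bool)) : R := (z.2.2 : nat)%:R * p (u, z.2.1) - h0.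
have bpu := bounded_mfun_pair1 u bp.
have mb : bounded_mfun (fun z : E * (E * bool) => (z.2.2 : nat)%:R : R).
  split.
    have m2 : measurable_fun setT (fun z : E * (E * bool) => z.2.2).
      exact: (measurableT_comp measurable_snd measurable_snd).
    rewrite (_ : (fun z => _) = fun z : E * (E * bool) => if z.2.2 then 1 else 0).
      exact: measurable_fun_ifT.
    by apply/funext => z; case: z.2.2.
  by exists 1 => -[? [? []]]; rewrite /= ?normr1 ?normr0.
have bxi : bounded_mfun xi.
  apply: bounded_mfunD; last exact: bounded_mfun_cst.
  apply: bounded_mfunM => //.
  exact: (bounded_mfun_comp (measurableT_comp measurable_fst measurable_snd) bpu).
have [mxi _] := bxi.
have /andP[h00 h01] := regression_bounds pp p1 q u.
have xiB z : `|xi z| <= k^-1.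
  have c1' := c1; rewrite /xi -/h0.
  have /andP[_ h] := pk (u, z.2.1); have := p0 (u, z.2.1).
  move=> hp; rewrite -/h0 in h00 h01; rewrite ler_norml.
  by case: (z.2.2) => /=; apply/andP; split; rewrite ?mul1r ?mul0r; lra.
have := mean_moment_le n0 (@sample_L_law) (sample_indep_XL i0) mxi
  (_ : 0 < k^-1) xiB _ m.
rewrite momentE; under eq_integral do rewrite meanB.
apply; first by rewrite invr_gt0.
move=> x; have bx := bounded_mfun_pair1 x bxi.
have bl := bounded_label_prob q.
rewrite (Rintegral_EFin _ bx) (semidirect_Rintegral nu q bx); congr EFin.
transitivity (\int[nu]_y (label_prob q y * p (u, y) - h0)).
  by apply: eq_Rintegral => y _; rewrite /xi /=; ring.
rewrite prob_RintegralB ?prob_Rintegral_cst ?subrr//.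
  exact: bounded_mfunM.
exact: bounded_mfun_cst.
Qed.

End sample.

(** * A majorant of the deviation *)

Section deviation_majorant.
Context {R : realType} {d n : nat}.
Local Notation E := (d.-tuple R).
Variables (mu nu : probability E R) (q : R.-pker E ~> bool).
Context dW (W : measurableType dW) (P : probability W R).
Variables (X : 'I_n -> {RV P >-> E}) (L : 'I_n -> {RV P >-> (E * bool)%type}).
Hypothesis sample : transfer_sample mu nu q X L.
Hypothesis n0 : (0 < n)%N.
Variables (p : E * E -> R) (k : R).
Hypotheses (pp : positive_mfun p) (k0 : 0 < k) (k1 : k <= 1).
Hypothesis pk : forall z, k <= p z <= k^-1.
Hypothesis p1 : forall x, \int[nu]_y p (x, y) = 1.
Hypothesis p2 : forall y, \int[mu]_x p (x, y) = 1.
Variables (m : nat) (Kc : R).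
Hypothesis Kc0 : 0 <= Kc.

Let rowd (i : 'I_n) (w : W) : R := n%:R^-1 * \sum_j p (X i w, (L j w).1) - 1.
Let cold (j : 'I_n) (w : W) : R := n%:R^-1 * \sum_i p (X i w, (L j w).1) - 1.
Let rowu (z : W * E) : R := n%:R^-1 * \sum_j p (z.2, (L j z.1).1) - 1.
Let labu (z : W * E) : R :=
  n%:R^-1 * \sum_j ((L j z.1).2 : nat)%:R * p (z.2, (L j z.1).1) -
  regression nu p q z.2.

(** A majorant of the m-th power of the squared pointwise deviation, in which
    every term is an even power of one average. *)
Definition deviation_majorant (z : W * E) : R := Kc ^+ m * 4 ^+ m *
  (n%:R^-1 * \sum_i rowd i z.1 ^+ (2 * m) +
   n%:R^-1 * \sum_j cold j z.1 ^+ (2 * m) + rowu z ^+ (2 * m) +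
   labu z ^+ (2 * m)).

Let even_ge0 (x : R) : 0 <= x ^+ (2 * m).
Proof. by rewrite exprM exprn_ge0// sqr_ge0. Qed.

Let N0 : 0 < n%:R :> R. Proof. by rewrite ltr0n. Qed.

Let mean_ge0 (F : 'I_n -> R) : 0 <= n%:R^-1 * \sum_i F i ^+ (2 * m).
Proof. by rewrite mulr_ge0 ?invr_ge0 ?(ltW N0)// sumr_ge0. Qed.

Let Km0 : 0 <= Kc ^+ m * 4 ^+ m.
Proof. by rewrite mulr_ge0// exprn_ge0. Qed.

Lemma deviation_majorant_ge0 z : 0 <= deviation_majorant z.
Proof. by rewrite mulr_ge0// !addr_ge0. Qed.

Lemma deviation_majorantP e w u :
  e ^+ 2 <= Kc * (n%:R^-1 * \sum_i rowd i w ^+ 2 +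
    n%:R^-1 * \sum_j cold j w ^+ 2 + rowu (w, u) ^+ 2 + labu (w, u) ^+ 2) ->
  e ^+ (2 * m) <= deviation_majorant (w, u).
Proof.
have mean2_ge0 (F : 'I_n -> R) : 0 <= n%:R^-1 * \sum_i F i ^+ 2.
  by rewrite mulr_ge0 ?invr_ge0 ?(ltW N0)// sumr_ge0// => i _; exact: sqr_ge0.
move=> h; rewrite exprM.
have := lerXn2r m (sqr_ge0 e : e ^+ 2 \is Num.nneg) _ h => h'.
apply: (le_trans (h' _)).
  by rewrite nnegrE mulr_ge0// !addr_ge0 ?sqr_ge0.
rewrite exprMn /deviation_majorant -[X in _ <= X]mulrA ler_wpM2l ?exprn_ge0//.
apply: (le_trans (sum4_expr_le _ _ _ _ _)); rewrite ?sqr_ge0//.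
rewrite ler_wpM2l ?exprn_ge0// -!exprM !lerD//.
  apply: (le_trans (power_mean_le _ n0 _)) => [i|]; first exact: sqr_ge0.
  by under eq_bigr do rewrite -exprM.
apply: (le_trans (power_mean_le _ n0 _)) => [i|]; first exact: sqr_ge0.
by under eq_bigr do rewrite -exprM.
Qed.

Let mp : measurable_fun setT p. Proof. by have [] := pp. Qed.

Let mXL i j : measurable_fun setT (fun w => p (X i w, (L j w).1)).
Proof.
apply: (measurableT_comp mp); apply: measurable_fun_pair.
  exact: measurable_funPT.
exact: (measurableT_comp measurable_fst (@measurable_funPT _ _ _ _ (L j))).
Qed.

Let mL (j : 'I_n) : measurable_fun setT (fun z : W * E => L j z.1).
Proof. exact: (measurableT_comp (@measurable_funPT _ _ _ _ (L j)) measurable_fst). Qed.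

Let mpu (j : 'I_n) : measurable_fun setT (fun z : W * E => p (z.2, (L j z.1).1)).
Proof.
apply: (measurableT_comp mp); apply: measurable_fun_pair.
  exact: measurable_snd.
exact: (measurableT_comp measurable_fst (mL j)).
Qed.

Let mrow i : measurable_fun setT (rowd i).
Proof.
apply: measurable_funB => //; apply: measurable_funM => //.
by apply: measurable_sum => j; exact: mXL.
Qed.

Let mcol j : measurable_fun setT (cold j).
Proof.
apply: measurable_funB => //; apply: measurable_funM => //.
by apply: measurable_sum => i; exact: mXL.
Qed.

Let mrowu : measurable_fun setT rowu.
Proof.
apply: measurable_funB => //; apply: measurable_funM => //.
by apply: measurable_sum => j; exact: mpu.
Qed.

Let mlabu : measurable_fun setT labu.
Proof.
apply: measurable_funB; last first.
  have [mR _] := bounded_regression nu pp q.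
  exact: (measurableT_comp mR measurable_snd).
apply: measurable_funM => //.
apply: measurable_sum => j; apply: measurable_funM; last exact: mpu.
rewrite (_ : (fun z => _) = fun z : W * E => if (L j z.1).2 then 1 else 0).
  apply: measurable_fun_ifT => //.
  exact: (measurableT_comp measurable_snd (mL j)).
by apply/funext => z; case: (L j z.1).2.
Qed.

Lemma measurable_deviation_majorant : measurable_fun setT deviation_majorant.
Proof.
apply: measurable_funM => //; apply: measurable_funD; last exact: measurable_funX.
apply: measurable_funD; last exact: measurable_funX.
apply: measurable_funD; apply: measurable_funM => //; apply: measurable_sum => i;
  apply: measurable_funX.
  exact: (measurableT_comp (mrow i) measurable_fst).
exact: (measurableT_comp (mcol i) measurable_fst).
Qed.

(** The m-th power of the squared deviation at u has expectation of order
    n^(-m), uniformly in u. *)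
Lemma deviation_majorant_int u :
  (\int[P]_w (deviation_majorant (w, u))%:E <=
    (Kc ^+ m * 4 ^+ m * 4 * moment_constant k m * (n%:R^-1) ^+ m)%:E)%E.
Proof.
pose B := moment_constant k m * (n%:R^-1) ^+ m.
have m2 (F : W -> R) : measurable_fun setT F ->
    measurable_fun setT (fun w => (F w ^+ (2 * m))%:E).
  by move=> mF; apply/measurable_EFinP; exact: measurable_funX.
have mean_le (F : 'I_n -> W -> R) : (forall i, measurable_fun setT (F i)) ->
    (forall i, \int[P]_w (F i w ^+ (2 * m))%:E <= B%:E)%E ->
    (\int[P]_w (n%:R^-1 * \sum_i F i w ^+ (2 * m))%:E <= B%:E)%E.
  move=> mF FB.
  under eq_integral do rewrite EFinM -sumEFin.
  rewrite ge0_integralZl//; last 2 first.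
  - by apply: emeasurable_sum => i; exact: m2.
  - by move=> w _; rewrite sumEFin lee_fin sumr_ge0.
  rewrite ge0_integral_sum//; last 2 first.
  - by move=> i; exact: m2.
  - by move=> i w _; rewrite lee_fin.
  rewrite muleC lee_pdivrMr//; apply: (@le_trans _ _ (\sum_(i < n) B%:E)%E).
    by apply: lee_sum => i _; exact: FB.
  by rewrite sumEFin sumr_const card_ord -EFinM mulr_natr.
have mr : measurable_fun setT (fun w => rowu (w, u)).
  by apply: (measurableT_comp mrowu); exact: pair2_measurable.
have ml : measurable_fun setT (fun w => labu (w, u)).
  by apply: (measurableT_comp mlabu); exact: pair2_measurable.
have mmean (F : 'I_n -> W -> R) : (forall i, measurable_fun setT (F i)) ->
    measurable_fun setT (fun w => (n%:R^-1 * \sum_i F i w ^+ (2 * m))%:E).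
  move=> mF; apply/measurable_EFinP; apply: measurable_funM => //.
  by apply: measurable_sum => i; exact: measurable_funX.
have mr' := mmean _ mrow; have mc' := mmean _ mcol.
under eq_integral do rewrite EFinM 3!EFinD.
rewrite ge0_integralZl; last 4 first.
- by [].
- apply: emeasurable_funD; last exact: m2.
  by apply: emeasurable_funD; [apply: emeasurable_funD|exact: m2].
- by move=> w _; rewrite -!EFinD lee_fin !addr_ge0.
- by rewrite lee_fin.
rewrite ge0_integralD; last 5 first.
- by [].
- by move=> w _; rewrite -!EFinD lee_fin !addr_ge0.
- by apply: emeasurable_funD; [apply: emeasurable_funD|exact: m2].
- by move=> w _; rewrite lee_fin.
- exact: m2.
rewrite ge0_integralD; last 5 first.
- by [].
- by move=> w _; rewrite -!EFinD lee_fin !addr_ge0.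
- by apply: emeasurable_funD.
- by move=> w _; rewrite lee_fin.
- exact: m2.
rewrite ge0_integralD; last 5 first.
- by [].
- by move=> w _; rewrite lee_fin.
- exact: mr'.
- by move=> w _; rewrite lee_fin.
- exact: mc'.
apply: (@le_trans _ _ ((Kc ^+ m * 4 ^+ m)%:E * (B%:E + B%:E + B%:E + B%:E))%E).
  rewrite lee_wpmul2l ?lee_fin//.
  apply: leeD; first apply: leeD; first apply: leeD.
  - apply: mean_le => // i.
    exact: (row_defect_moment sample n0 pp k0 k1 pk p1).
  - apply: mean_le => // j.
    exact: (col_defect_moment sample n0 pp k0 k1 pk p2).
  - exact: (fixed_row_defect_moment sample n0 pp k0 k1 pk p1).
  - exact: (label_defect_moment sample n0 pp k0 k1 pk p1).
by rewrite -!EFinD -EFinM lee_fin /B le_eqVlt; apply/orP; left; apply/eqP; ring.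
Qed.

End deviation_majorant.

(** * The plug-in classifier *)

(** Monotonicity of the integral does not need the smaller function to be
    measurable; the data-dependent excess risk below is only known to be
    dominated by a measurable function. *)
Lemma integral_le_majorant d (T : measurableType d) (R : realType)
    (mu : {measure set T -> \bar R}) (f g : T -> \bar R) :
  (forall x, f x <= g x)%E -> (forall x, 0 <= g x)%E ->
  (\int[mu]_x f x <= \int[mu]_x g x)%E.
Proof.
move=> fg g0; rewrite integralE.
apply: (@le_trans _ _ (\int[mu]_x f^\+ x)%E).
  by rewrite -[leRHS]adde0 leeD2l// oppe_le0; apply: integral_ge0.
rewrite !ge0_integralTE//; apply: ereal_sup_le => _ [h hf <-].
exists h => // x.
by apply: (le_trans (hf x)); rewrite funeposE ge_max fg g0.
Qed.

Section classification_margin.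
Context {R : realType}.

(** A classification error forces a deviation at least as large as the
    margin. *)
Lemma margin_le_deviation (u v : R) : (2^-1 < u) != (2^-1 < v) ->
  `|v - 2^-1| <= `|u - v|.
Proof.
case: (ltP 2^-1 u) => hu; case: (ltP 2^-1 v) => hv // _.
  by rewrite ler0_norm ?ger0_norm; lra.
by rewrite ger0_norm ?ler0_norm; lra.
Qed.

Lemma margin_le_half (r : R) : 0 <= r <= 1 -> 0 <= `|r - 2^-1| <= 2^-1.
Proof.
by move=> /andP[h1 h2]; rewrite normr_ge0 ler_norml; apply/andP; split; lra.
Qed.

Lemma invr_sqrt_sqr (r : R) : 0 < r -> (r `^ (- 2^-1)) ^+ 2 = r^-1.
Proof.
move=> r0; rewrite expr2 -powRD; last by apply/implyP => _; rewrite gt_eqF.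
by rewrite (_ : - 2^-1 + - 2^-1 = -1) ?powR_inv1 ?ltW//; lra.
Qed.

Lemma invr_sqrt_powR (r al : R) :
  (r `^ (- 2^-1)) `^ (1 + al) = r `^ (- ((1 + al) / 2)).
Proof. by rewrite -powRrM; congr (_ `^ _); lra. Qed.

End classification_margin.

Section margin_transfer.
Context {R : realType} {d : nat}.
Local Notation E := (d.-tuple R).

Lemma mammen_tsybakov_ae (mu : probability E R) (h h' : E -> R) (alpha C0 : R) :
  measurable_fun setT h -> measurable_fun setT h' ->
  {ae mu, forall x, h x = h' x} ->
  mammen_tsybakov mu h alpha C0 -> mammen_tsybakov mu h' alpha C0.
Proof.
move=> mh mh' [N [mN N0 hN]] MT eps e; apply: le_trans (MT eps e).
have ms (f : E -> R) : measurable_fun setT f ->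
    measurable [set x | (0 < `|f x - 2^-1| <= eps)%R].
  move=> mf; have mF : measurable_fun setT (fun x => `|f x - 2^-1|).
    by apply: measurableT_comp => //; exact: measurable_funB.
  rewrite (_ : [set x | _] = (fun x => `|f x - 2^-1|) @^-1` `]0, eps]%classic).
    by rewrite -[X in measurable X]setTI; exact: mF.
  by apply/seteqP; split => x /=; rewrite in_itv.
have m1 := ms _ mh; have m2 := ms _ mh'.
rewrite -[leRHS]adde0 -N0; apply: le_trans (measureU2 _ m1 mN).
apply: le_measure; rewrite ?inE//; first exact: measurableU.
move=> x /= hx; have [Nx|Nx] := pselect (N x); [by right|left].
rewrite (_ : h x = h' x)//; apply: contrapT => hh; apply: Nx; exact: hN.
Qed.

End margin_transfer.

Section empirical_measurability.
Context {R : realType} {d n : nat}.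
Local Notation E := (d.-tuple R).
Variables (eta : R) (x y : 'I_n -> E) (f g : E -> R).
Hypothesis fg : empirical_potentials eta x y f g.
Hypothesis eta0 : 0 < eta.

Lemma measurable_empirical_regression (a : 'I_n -> bool) :
  measurable_fun setT (empirical_regression eta y a f g).
Proof.
have mc v : measurable_fun setT (fun u : E => qcost u v).
  rewrite (_ : (fun u => _) = (fun z : E * E => qcost z.1 z.2) \o (pair^~ v))//.
  exact: (measurableT_comp (@measurable_qcost R d) (pair2_measurable v)).
have mf : measurable_fun setT f.
  have [_ _ fE _] := fg.
  rewrite (_ : f = fun u => - eta^-1 * ln (n%:R^-1 *
      \sum_(j < n) expR (- eta * qcost u (y j) + eta * g (y j)))).
    apply: measurable_funM => //; apply: measurableT_comp => //.
    apply: measurable_funM => //; apply: measurable_sum => j.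
    apply: measurableT_comp => //; apply: measurable_funD => //.
    exact: measurable_funM.
  by apply/funext => u; rewrite -fE expRK mulrA mulrNN mulVf ?mul1r// gt_eqF.
apply: measurable_funM => //; apply: measurable_sum => j.
apply: measurable_funM => //; apply: measurableT_comp => //.
apply: measurable_funM => //; apply: measurable_funB => //.
exact: measurable_funB.
Qed.

End empirical_measurability.

Theorem theorem7 (R : realType) (eta alpha C0 : R)
    (eta_gt0 : 0 < eta) (alpha_gt0 : 0 < alpha) (C0_gt0 : 0 < C0) :
  exists c : R, forall (d n : nat) (d_ge1 : (1 <= d)%N) (n_ge1 : (1 <= n)%N)
    (mu nu : probability (d.-tuple R) R)
    (mu_bounded : {ae mu, forall x, enorm x <= 2^-1})
    (nu_bounded : {ae nu, forall y, enorm y <= 2^-1})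
    (pi : probability (d.-tuple R * d.-tuple R)%type R)
    (pi_star : schrodinger_coupling eta mu nu pi)
    (q : R.-pker (d.-tuple R) ~> bool)
    (h : d.-tuple R -> R)
    (h_star : is_regression_function (transfer_law pi q) h)
    (MT : mammen_tsybakov mu h alpha C0)
    (dW : measure_display) (W : measurableType dW) (P : probability W R)
    (X : 'I_n -> {RV P >-> d.-tuple R})
    (L : 'I_n -> {RV P >-> (d.-tuple R * bool)%type})
    (sample : transfer_sample mu nu q X L)
    (f g : W -> d.-tuple R -> R)
    (fg_potentials : forall w, empirical_potentials eta
       (fun i => X i w) (fun j => (L j w).1) (f w) (g w)),
  ('E_P[fun w => excess_risk (transfer_law pi q) h
          (plugin (empirical_regression eta (fun j => (L j w).1)
             (fun j => (L j w).2) (f w) (g w)))]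
     <= (c * n%:R `^ (- ((1 + alpha) / 2)))%:E)%E.
Proof.
pose k : R := expR (- eta) ^+ 2.
have k0 : 0 < k by rewrite exprn_gt0// expR_gt0.
have k1 : k <= 1 by rewrite exprn_ile1 ?expR_ge0// expR_le1 oppr_le0 ltW.
(* the moment order 2m must exceed 1 + alpha for the peeling sum to converge *)
pose m' := (Num.truncn alpha).+1; pose m := m'.+1; pose N := (2 * m')%N.
have N2 : N.+2 = (2 * m)%N by rewrite /N /m mulnS.
have alphaN : alpha <= N%:R.
  apply: (@le_trans _ _ m'%:R); first by rewrite ltW// /m' truncnS_gt.
  by rewrite ler_nat /N leq_pmull.
pose Kc : R := 16 * k^-1 ^+ 10.
have Kc0 : 0 <= Kc by rewrite mulr_ge0// exprn_ge0// invr_ge0 ltW.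
pose M : R := Kc ^+ m * 4 ^+ m * 4 * moment_constant k m.
have M0 : 0 <= M.
  rewrite /M /moment_constant.
  apply: mulr_ge0.
    by rewrite mulr_ge0// mulr_ge0 ?exprn_ge0.
  apply: mulr_ge0; first by rewrite mulr_ge0// mulr_ge0// expR_ge0.
  by rewrite exprn_ge0// mulr_ge0// sqr_ge0.
exists (2 * (C0 * (1 + 2 ^+ N.+1 * M))).
move=> d n d_ge1 n_ge1 mu nu mu_bounded nu_bounded pi pi_star q h h_star MT.
move=> dW W P X L sample f g fg.
set E := d.-tuple R in mu nu mu_bounded nu_bounded pi pi_star q h h_star MT X L
  sample f g fg *.
have ke0 : 0 < expR (- eta) by exact: expR_gt0.
have ke1 : expR (- eta) <= 1 by rewrite expR_le1 oppr_le0 ltW.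
have mK := @measurable_gibbs_kernel R d eta.
have K1 := fun z : E * E => gibbs_kernel_bounds z eta_gt0.
have [a [b [pa pb aE bE]]] := sinkhorn_fixpoint mu nu ke0 ke1 mK K1.
pose p : E * E -> R := schrodinger_density eta a b.
have pp : positive_mfun p by exact: schrodinger_density_positive.
have pk z : k <= p z <= k^-1.
  exact: (sinkhorn_density_bounds ke0 mK K1 pa pb aE bE).
have p1 u : \int[nu]_y p (u, y) = 1 by exact: schrodinger_density_int1.
have p2 v : \int[mu]_x p (x, v) = 1 by exact: schrodinger_density_int2.
have piE := schrodinger_coupling_density eta_gt0 mu_bounded nu_bounded pa pb aE bE
  pi_star.
pose h0 : E -> R := regression nu p q.
have bh0 : bounded_mfun h0 by exact: bounded_regression.
have [mh0 _] := bh0.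
have hh0 : {ae mu, forall x, h x = h0 x}.
  exact: (regression_function_unique pp piE p1 h_star).
have MT0 : mammen_tsybakov mu h0 alpha C0.
  by apply: mammen_tsybakov_ae hh0 MT => //; case: h_star.
pose s (u : E) : R := `|h0 u - 2^-1|.
have ms : measurable_fun setT s.
  by apply: measurableT_comp => //; exact: measurable_funB.
have s_bounds u : 0 <= s u <= 2^-1.
  by apply: margin_le_half; exact: (regression_bounds pp p1 q u).
have N0 : 0 < n%:R :> R by rewrite ltr0n.
pose t : R := n%:R `^ (- 2^-1).
have t0 : 0 < t by exact: powR_gt0.
have t2 : t ^+ 2 = n%:R^-1 by exact: invr_sqrt_sqr.
have tE : t `^ (1 + alpha) = n%:R `^ (- ((1 + alpha) / 2)).
  exact: invr_sqrt_powR.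
pose DD := deviation_majorant nu q X L p m Kc.
have mDD : measurable_fun setT DD by exact: measurable_deviation_majorant.
have DD0 z : 0 <= DD z by exact: deviation_majorant_ge0.
have EDD u : (\int[P]_w (DD (w, u))%:E <= (M * t ^+ N.+2)%:E)%E.
  rewrite N2 exprM t2.
  exact: (deviation_majorant_int sample n_ge1 pp k0 k1 pk p1 p2).
pose maj := margin_majorant s N t DD.
have mmaj : measurable_fun setT maj by exact: measurable_margin_majorant.
have maj0 z : 0 <= maj z by exact: margin_majorant_ge0.
have maj_int : (\int[P]_w \int[mu]_u (maj (w, u))%:E <=
    (C0 * (1 + 2 ^+ N.+1 * M) * t `^ (1 + alpha))%:E)%E.
  exact: (margin_majorant_int ms s_bounds C0_gt0 alpha_gt0 alphaN MT0 t0 M0 mDD).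
(* almost surely, the sample lies in the ball of radius 1/2 *)
have aeX : {ae P, forall w, forall i, enorm (X i w) <= 2^-1}.
  apply: filter_forall => i; have [N1 [mN1 N10 sN1]] := mu_bounded.
  exists (X i @^-1` N1); split.
  - by rewrite -[X in measurable X]setTI; exact: measurable_funPT.
  - by rewrite -[RHS]N10; exact: (sample_X_law sample).
  - by move=> w /= /sN1.
have aeL : {ae P, forall w, forall j, enorm (L j w).1 <= 2^-1}.
  apply: filter_forall => j; have [N1 [mN1 N10 sN1]] := nu_bounded.
  have mN1' : measurable (fst @^-1` N1 : set (E * bool)).
    by have := @measurable_fst _ _ E bool measurableT _ mN1; rewrite setTI.
  exists (L j @^-1` (fst @^-1` N1)); split.
  - by rewrite -[X in measurable X]setTI; exact: measurable_funPT.
  - rewrite -[RHS]N10 -(semidirect_marginal nu q mN1).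
    exact: (sample_L_law sample).
  - by move=> w /= /sN1.
have [NB [mNB NB0 goodP]] : {ae P, forall w,
    (forall i, enorm (X i w) <= 2^-1) /\ (forall j, enorm (L j w).1 <= 2^-1)}.
  by move: aeX aeL; apply: filterS2.
pose hn w : E -> R := empirical_regression eta (fun j => (L j w).1)
  (fun j => (L j w).2) (f w) (g w).
have mhn w : measurable_fun setT (hn w).
  exact: (measurable_empirical_regression (fg w) eta_gt0).
have pointwise w : ~ NB w -> forall u, enorm u <= 2^-1 ->
    (plugin (hn w) u != (2^-1 < h0 u))%:R * (2 * s u) <= 2 * maj (w, u).
  move=> NBw u u2.
  have [Xw Lw] : (forall i, enorm (X i w) <= 2^-1) /\
      (forall j, enorm (L j w).1 <= 2^-1).
    by apply: contrapT => bad; apply: NBw; exact: goodP.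
  have [_|neq] := eqVneq (plugin (hn w) u) (2^-1 < h0 u).
    by rewrite mul0r mulr_ge0.
  rewrite mul1r ler_pM2l//.
  have [s0|s0] := ltP 0 (s u); last exact: le_trans (maj0 _).
  apply: margin_majorantP => //.
  have sdev : s u <= `|hn w u - h0 u| by exact: margin_le_deviation.
  have : s u ^+ N.+2 <= (hn w u - h0 u) ^+ (2 * m).
    rewrite N2 exprM [leRHS]exprM lerXn2r ?nnegrE ?sqr_ge0//.
    by rewrite -(real_normK (num_real (hn w u - h0 u))) lerXn2r ?nnegrE ?normr_ge0//.
  move=> /le_trans; apply.
  apply: deviation_majorantP => //.
  apply: (empirical_regression_deviation eta_gt0 n_ge1 Xw Lw (fg w)) => //.
  - exact: positive_mfun_gt0 pa.
  - exact: positive_mfun_gt0 pb.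
(* the majorant is infinite on the null event where the sample leaves the ball *)
pose Bd w : \bar R := if w \in NB then +oo%E else
  (2%:E * \int[mu]_u (maj (w, u))%:E)%E.
have Emaj0 w : (0 <= \int[mu]_u (maj (w, u))%:E)%E.
  by apply: integral_ge0 => u _; rewrite lee_fin.
have Bd0 w : (0 <= Bd w)%E.
  by rewrite /Bd; case: ifP => // _; rewrite mule_ge0// lee_fin.
have mEmaj : measurable_fun setT (fun w => (\int[mu]_u (maj (w, u))%:E)%E).
  apply: (measurable_fun_fubini_tonelli_F (EFin \o maj)).
    exact/measurable_EFinP.
  by move=> z; rewrite lee_fin.
have risk_le w : ((excess_risk (transfer_law pi q) h (plugin (hn w)))%:E <= Bd w)%E.
  rewrite /Bd; case: ifPn => [_|NBw]; first by rewrite leey.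
  have {}NBw : ~ NB w by move=> NBw'; move: NBw; rewrite mem_set.
  have mpl : measurable_fun setT (plugin (hn w)) by exact: measurable_fun_ltr.
  rewrite (excess_riskE pp piE p1 h_star mpl).
  have berr : bounded_mfun (fun u => (plugin (hn w) u != (2^-1 < h0 u))%:R * (2 * s u)).
    apply: bounded_mfunM.
      split; last first.
        by exists 1 => u; case: (_ != _); rewrite ?normr1 ?normr0.
      rewrite (_ : (fun u => _) = fun u => if plugin (hn w) u then
          (if 2^-1 < h0 u then 0 else 1) else (if 2^-1 < h0 u then 1 else 0)).
        apply: measurable_fun_ifT => //;
          by apply: measurable_fun_ifT => //; exact: measurable_fun_ltr.
      by apply/funext => u; case: (plugin _ _); case: (_ < _).
    split; first exact: measurable_funM.
    exists (2 * 2^-1) => u; have /andP[h1 h2] := s_bounds u.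
    by rewrite ger0_norm ?mulr_ge0// ler_pM2l.
  rewrite -(Rintegral_EFin mu berr) -ge0_integralZl//; last 2 first.
  - apply/measurable_EFinP; apply: (measurableT_comp mmaj).
    exact: pair1_measurable.
  - by move=> u _; rewrite lee_fin.
  apply: ae_ge0_le_integral => //.
  - by move=> u _; have /andP[s0 _] := s_bounds u; rewrite lee_fin !mulr_ge0.
  - by apply/measurable_EFinP; case: berr.
  - by move=> u _; rewrite mule_ge0// lee_fin.
  - apply: measurable_funeM; apply/measurable_EFinP.
    by apply: (measurableT_comp mmaj); exact: pair1_measurable.
  move: mu_bounded; apply: filterS => u u2 _.
  by rewrite -EFinM lee_fin; exact: pointwise.
rewrite unlock; apply: (le_trans (integral_le_majorant P risk_le Bd0)).
rewrite (_ : \int[P]_w Bd w = \int[P]_w (2%:E * \int[mu]_u (maj (w, u))%:E))%E;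
  last first.
  apply: ge0_ae_eq_integral => //.
  - apply: measurable_fun_ifT => //.
      rewrite (_ : (fun w => _) = mem NB)//.
      by apply: (measurable_fun_bool true); rewrite setTI preimage_mem_true.
    exact: measurable_funeM.
  - exact: measurable_funeM.
  - by move=> w _; rewrite mule_ge0// lee_fin.
  exists NB; split => // w /=; apply: contra_notP => NBw _.
  by rewrite /Bd memNset.
rewrite ge0_integralZl//.
rewrite -tE -mulrA EFinM lee_wpmul2l// lee_fin//.
Qed.
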